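(* For each $\lambda\in\mathbb{R}$, $\lambda\neq 0$, $\rho_\lambda$ is an irreducible unitary representation of the group $\mathbb{H}^n_\lambda(\mathbb{C})$ on $\mathcal{F}^\lambda(\mathbb{C}^{2n})$. However, the restriction of $\rho_\lambda$ to the subgroup $\mathbb{H}^n_\lambda(\mathbb{R})$ is not irreducible.
   Context: For $z,w\in\mathbb{C}^n$ write $z\cdot w=\sum_{j=1}^n z_jw_j$ (bilinear), $|a|^2=a\cdot\bar a$, and $|(z,w)|^2=|z|^2+|w|^2$. Let $\lambda\in\mathbb{R}$, $\lambda\ne0$. Twisted Fock space: let $w_\lambda(z,w)=c_\lambda e^{\lambda\,\mathrm{Im}(z\cdot\bar w)}e^{-\frac12\lambda(\coth\lambda)|(z,w)|^2}$, with $c_\lambda>0$ a normalizing constant. $\mathcal{F}^\lambda(\mathbb{C}^{2n})$ is the Hilbert space of entire functions $F$ on $\mathbb{C}^{2n}$ with $\|F\|^2=\int_{\mathbb{C}^{2n}}|F(z,w)|^2w_\lambda(z,w)\,dz\,dw<\infty$. Operators: for $(a,b)\in\mathbb{C}^n\times\mathbb{C}^n$, $$\rho_\lambda(a,b)F(z,w)=e^{\frac{\lambda}{2}\mathrm{Im}(a\cdot\bar b)}\,e^{-\frac{\lambda}{4}(\coth\lambda)(|a|^2+|b|^2)}\,e^{-i\frac{\lambda}{2}(w\cdot\bar a-z\cdot\bar b)}\,e^{\frac{\lambda}{2}(\coth\lambda)(z\cdot\bar a+w\cdot\bar b)}\,F(z-a,w-b).$$ Group: the twisted Heisenberg group $\mathbb{H}^n_\lambda(\mathbb{C})$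 is $\mathbb{C}^n\times\mathbb{C}^n\times\mathbb{R}$ with group law $$(a,b,t)(a',b',t')=\Big(a+a',\,b+b',\,t+t'-\tfrac{\lambda}{2}\mathrm{Re}(b\cdot\overline{a'}-a\cdot\overline{b'})+\tfrac{\lambda}{2}(\coth\lambda)\,\mathrm{Im}(a\cdot\overline{a'}+b\cdot\overline{b'})\Big).$$ $\mathbb{H}^n_\lambda(\mathbb{R})$ is the subgroup $\mathbb{R}^n\times\mathbb{R}^n\times\mathbb{R}$. Representation: $\rho_\lambda(a,b,t)=e^{-it}\rho_\lambda(a,b)$ for $(a,b,t)\in\mathbb{H}^n_\lambda(\mathbb{C})$. A unitary representation is irreducible if the only closed invariant subspaces are $\{0\}$ and the whole (nonzero) space. *)

(* Defs.v *)
From HB Require Import structures.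
From mathcomp Require Import all_boot all_order all_algebra.
From mathcomp Require Import ring complex.
From mathcomp Require Import all_classical all_reals all_analysis.
Import Order.TTheory GRing.Theory Num.Theory.
Import numFieldNormedType.Exports.

Set Implicit Arguments.
Unset Strict Implicit.
Unset Printing Implicit Defensive.

Local Open Scope classical_set_scope.
Local Open Scope complex_scope.
Local Open Scope ring_scope.

(* shadow the numClosedFieldType versions *)
Local Notation Re := complex.Re.
Local Notation Im := complex.Im.

(* R[i] as a one-dimensional normed module over itself, so that
   [differentiable] below means complex (Frechet) differentiable. *)
HB.instance Definition _ (R : realType) := NormedModule.copy R[i] R[i]^o.

Section complex_preliminaries.
Context {R : realType}.
Local Notation C := R[i].

Definition cexp (z : C) : C :=
  (expR (Re z))%:C * (cos (Im z) +i* sin (Im z)).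

Definition coth (x : R) : R :=
  (expR x + expR (- x)) / (expR x - expR (- x)).

Definition dotc n (z w : 'rV[C]_n) : C := \sum_(j < n) z 0 j * w 0 j.

Definition conjv n (z : 'rV[C]_n) : 'rV[C]_n := map_mx conjc z.

Definition sqnormv n (a : 'rV[C]_n) : R := Re (dotc a (conjv a)).

Lemma dotcDl n (a b c : 'rV[C]_n) : dotc (a + b) c = dotc a c + dotc b c.
Proof.
by rewrite /dotc -big_split; apply: eq_bigr => j _; rewrite mxE mulrDl.
Qed.

Lemma dotcDr n (a b c : 'rV[C]_n) : dotc a (b + c) = dotc a b + dotc a c.
Proof.
by rewrite /dotc -big_split; apply: eq_bigr => j _; rewrite mxE mulrDr.
Qed.

Lemma dotcNr n (a b : 'rV[C]_n) : dotc a (- b) = - dotc a b.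
Proof.
by rewrite /dotc -sumrN; apply: eq_bigr => j _; rewrite mxE mulrN.
Qed.

Lemma dotc0l n (a : 'rV[C]_n) : dotc 0 a = 0.
Proof. by rewrite /dotc big1// => j _; rewrite mxE mul0r. Qed.

Lemma dotc0r n (a : 'rV[C]_n) : dotc a 0 = 0.
Proof. by rewrite /dotc big1// => j _; rewrite mxE mulr0. Qed.

Lemma dotcNl n (a b : 'rV[C]_n) : dotc (- a) b = - dotc a b.
Proof.
by rewrite /dotc -sumrN; apply: eq_bigr => j _; rewrite mxE mulNr.
Qed.

Lemma conjvD n (a b : 'rV[C]_n) : conjv (a + b) = conjv a + conjv b.
Proof. exact: map_mxD. Qed.

Lemma conjvN n (a : 'rV[C]_n) : conjv (- a) = - conjv a.
Proof. exact: map_mxN. Qed.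

Lemma conjv0 n : conjv (0 : 'rV[C]_n) = 0.
Proof. exact: map_mx0. Qed.

Lemma dotc_conjC n (a b : 'rV[C]_n) : dotc b (conjv a) = conjc (dotc a (conjv b)).
Proof.
rewrite /dotc rmorph_sum; apply: eq_bigr => j _; rewrite !mxE.
by case: (a 0 j) (b 0 j) => x y [u v]; congr (_ +i* _); ring.
Qed.

Lemma ReD (x y : C) : Re (x + y) = Re x + Re y.
Proof. by case: x y => ? ? []. Qed.
Lemma ImD (x y : C) : Im (x + y) = Im x + Im y.
Proof. by case: x y => ? ? []. Qed.
Lemma ReN (x : C) : Re (- x) = - Re x.
Proof. by case: x. Qed.
Lemma ImN (x : C) : Im (- x) = - Im x.
Proof. by case: x. Qed.
Lemma Re_conj (x : C) : Re (conjc x) = Re x.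
Proof. by case: x. Qed.
Lemma Im_conj (x : C) : Im (conjc x) = - Im x.
Proof. by case: x. Qed.

Lemma Im_dotc_conj n (a : 'rV[C]_n) : Im (dotc a (conjv a)) = 0.
Proof.
apply/eqP; rewrite -[_ == _](@mulrn_eq0 R _ 2) mulr2n addr_eq0.
by rewrite -Im_conj -dotc_conjC.
Qed.

End complex_preliminaries.

(* The library's sigma-finiteness instance on [m1 \x m2] is shadowed by the one
   for subprobabilities, hence this copy of the product measure. *)
Section sigma_finite_product.
Context d1 d2 (T1 : measurableType d1) (T2 : measurableType d2) {R : realType}.
Variable m1 : {sigma_finite_measure set T1 -> \bar R}.
Variable m2 : {sigma_finite_measure set T2 -> \bar R}.

Definition prodm : set (T1 * T2) -> \bar R := (m1 \x m2)%E.

HB.instance Definition _ := Measure.copy prodm (m1 \x m2)%E.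

Let prodm_sigma_finite : sigma_finite setT prodm.
Proof.
have /sigma_finiteP[F [TF ndF Foo]] := sigma_finiteT m1.
have /sigma_finiteP[G [TG ndG Goo]] := sigma_finiteT m2.
exists (fun k => F k `*` G k).
  rewrite -setXTT TF TG predeqE => -[x y]; split.
    move=> [/= [k _ Fkx] [j _ Gjy]]; exists (maxn k j) => //; split.
    - by move: x Fkx; exact/subsetPset/ndF/leq_maxl.
    - by move: y Gjy; exact/subsetPset/ndG/leq_maxr.
  by move=> [k _ []/= ? ?]; split; exists k.
move=> k; have [mF Fk] := Foo k; have [mG Gk] := Goo k.
split; first exact: measurableX.
by rewrite /prodm product_measure1E// lte_mul_pinfty// ge0_fin_numE.
Qed.

HB.instance Definition _ := Measure_isSigmaFinite.Build _ _ _ prodm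
  prodm_sigma_finite.

End sigma_finite_product.

Section lebesgue_tuple.
Context {R : realType}.
Local Notation mR := (measurableTypeR R).

Definition tuple_consp n (p : mR * n.-tuple mR) : n.+1.-tuple mR :=
  [tuple of p.1 :: p.2].

Lemma measurable_tuple_consp n : measurable_fun setT (@tuple_consp n).
Proof. exact: measurable_cons. Qed.

Section step.
Context n (mu : {sigma_finite_measure set (n.-tuple mR) -> \bar R}).

Definition lebesgue_tuple_step : set (n.+1.-tuple mR) -> \bar R :=
  pushforward (prodm lebesgue_measure mu) (@tuple_consp n).

Let push : {measure set (n.+1.-tuple mR) -> \bar R} :=
  measure_function_pushforward__canonical__measure_function_Measure
    (prodm lebesgue_measure mu) (@measurable_tuple_consp n).

HB.instance Definition _ := isMeasure.Build _ _ _ lebesgue_tuple_step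
  (measure0 push) (measure_ge0 push) (@measure_semi_sigma_additive _ _ _ push).

Let lebesgue_tuple_step_sigma_finite : sigma_finite setT lebesgue_tuple_step.
Proof.
have [F FT mF] := sigma_finiteT (prodm lebesgue_measure mu).
pose u (v : n.+1.-tuple mR) : mR * n.-tuple mR := (thead v, [tuple of behead v]).
have mu' : measurable_fun setT u.
  apply/measurable_fun_pairP; split; first exact: measurable_tnth.
  exact: measurable_behead.
exists (fun k => u @^-1` F k).
  by rewrite -preimage_bigcup -FT preimage_setT.
move=> k; have [mFk Fk] := mF k; split.
  by rewrite -[X in measurable X]setTI; exact: mu'.
rewrite /lebesgue_tuple_step /pushforward -comp_preimage.
rewrite (_ : u \o _ = id)//; apply/funext => -[x v] /=.
by rewrite /u; congr pair; apply/val_inj.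
Qed.

HB.instance Definition _ := Measure_isSigmaFinite.Build _ _ _
  lebesgue_tuple_step lebesgue_tuple_step_sigma_finite.

End step.

Fixpoint lebesgue_tuple n : {sigma_finite_measure set (n.-tuple mR) -> \bar R} :=
  match n with
  | 0 => \d_([tuple] : 0.-tuple mR)
  | m.+1 => lebesgue_tuple_step (lebesgue_tuple m)
  end.

End lebesgue_tuple.

Section unitary_representations.
Context {R : realType} {V : lmodType R[i]}.
Variables (H : set V) (ip : V -> V -> R[i]).

Definition hnorm (v : V) : R := Num.sqrt (Re (ip v v)).

Definition subspace (M : set V) : Prop :=
  M 0 /\ forall (k : R[i]) u v, M u -> M v -> M (k *: u + v).

Definition closed_in (M : set V) : Prop :=
  forall v, H v ->
    (forall e : R, 0 < e -> exists2 u, M u & hnorm (v - u) < e) -> M v.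

Definition unitary_operator (T : V -> V) : Prop :=
  [/\ forall v, H v -> H (T v),
      forall v, H v -> exists2 u, H u & T u = v,
      forall (k : R[i]) u v, H u -> H v -> T (k *: u + v) = k *: T u + T v
    & forall u v, H u -> H v -> ip (T u) (T v) = ip u v].

Definition unitary_representation (G : groupType) (pi : G -> V -> V) : Prop :=
  [/\ forall g, unitary_operator (pi g),
      forall v, H v -> pi 1%g v = v
    & forall g h v, H v -> pi (g * h)%g v = pi g (pi h v)].

Definition strongly_continuous (T : topologicalType) (pi : T -> V -> V) : Prop :=
  forall v, H v -> forall g, hnorm (pi h v - pi g v) @[h --> g] --> (0 : R).

Definition irreducible (I : Type) (pi : I -> V -> V) : Prop :=
  (exists2 v, H v & v <> 0) /\
  forall M : set V, M `<=` H -> subspace M -> closed_in M ->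
    (forall i v, M v -> M (pi i v)) -> M = [set 0] \/ M = H.

End unitary_representations.

Section twisted_heisenberg.
Context {R : realType}.
Local Notation C := R[i].

(* underlying space of the twisted Heisenberg group of parameter [l], whose
   group law depends on [l] *)
Definition heis (n : nat) (l : R) : Type := ('rV[C]_n * 'rV[C]_n * R)%type.

Section group.
Variables (n : nat) (l : R).

HB.instance Definition _ :=
  Choice.copy (heis n l) ('rV[C]_n * 'rV[C]_n * R)%type.
HB.instance Definition _ :=
  Topological.copy (heis n l) ('rV[C]_n * 'rV[C]_n * R)%type.

Definition heis_mul (g h : heis n l) : heis n l :=
  let: (a, b, t) := g in let: (a', b', t') := h in
  (a + a', b + b',
   t + t' - l / 2 * Re (dotc b (conjv a') - dotc a (conjv b'))
   + l / 2 * coth l * Im (dotc a (conjv a') + dotc b (conjv b'))).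

Definition heis_one : heis n l := (0, 0, 0).

Definition heis_inv (g : heis n l) : heis n l :=
  let: (a, b, t) := g in (- a, - b, - t).

Lemma heis_mulA : associative heis_mul.
Proof.
move=> [[a b] t] [[a' b'] t'] [[a'' b''] t''] /=; rewrite !addrA.
congr pair; rewrite !conjvD !dotcDl !dotcDr ?(ReD, ImD, ReN, ImN).
by ring.
Qed.

Lemma heis_mul1g : left_id heis_one heis_mul.
Proof.
move=> [[a b] t]; rewrite /heis_mul /= !add0r !dotc0l subr0 addr0 /=.
by congr pair; ring.
Qed.

Lemma heis_mulg1 : right_id heis_one heis_mul.
Proof.
move=> [[a b] t]; rewrite /heis_mul /= !addr0 !conjv0 !dotc0r subr0 addr0 /=.
by congr pair; ring.
Qed.

Lemma heis_mulVg : left_inverse heis_one heis_inv heis_mul.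
Proof.
move=> [[a b] t]; rewrite /heis_mul /= !addNr !dotcNl.
rewrite [dotc a (conjv b)]dotc_conjC /heis_one; congr pair.
rewrite !(ReD, ImD, ReN, ImN, Re_conj, Im_dotc_conj); ring.
Qed.

Lemma heis_mulgV : right_inverse heis_one heis_inv heis_mul.
Proof.
move=> [[a b] t]; rewrite /heis_mul /= !addrN !conjvN !dotcNr.
rewrite [dotc a (conjv b)]dotc_conjC /heis_one; congr pair.
rewrite !(ReD, ImD, ReN, ImN, Re_conj, Im_dotc_conj); ring.
Qed.

HB.instance Definition _ := isGroup.Build (heis n l)
  heis_mulA heis_mul1g heis_mulg1 heis_mulVg heis_mulgV.

Definition real_heis : {pred heis n l} := fun g =>
  [forall j, (Im (g.1.1 0 j) == 0) && (Im (g.1.2 0 j) == 0)].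

Lemma real_heis_group_closed : group_closed real_heis.
Proof.
split=> [|g h].
  by apply/forallP => j; rewrite !mxE eqxx.
case: g h => [[a b] t] [[a' b'] t'] /forallP g0 /forallP h0.
apply/forallP => j; move: (g0 j) (h0 j) => /= /andP[/eqP aj /eqP bj].
move=> /andP[/eqP aj' /eqP bj'].
by rewrite !mxE !ImD !ImN aj bj aj' bj' subr0 eqxx.
Qed.

Definition real_subgroup : Type := {g : heis n l | g \in real_heis}.

HB.instance Definition _ := SubChoice.on real_subgroup.
HB.instance Definition _ := SubChoice_isSubGroup.Build _ _ real_subgroup
  real_heis_group_closed.

End group.
End twisted_heisenberg.

Section twisted_fock.
Context {R : realType}.
Variable n : nat.
Local Notation C := R[i].
Local Notation E := ('rV[C]_n * 'rV[C]_n)%type.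
Local Notation Rn := (n.-tuple (measurableTypeR R)).

(* Lebesgue measure of C^n x C^n, in real coordinates ((x, y), (u, v)) with
   z = x + i y and w = u + i v *)
Definition lebesgue_C2n :
    {sigma_finite_measure set ((Rn * Rn) * (Rn * Rn))%type -> \bar R} :=
  prodm (prodm (lebesgue_tuple n) (lebesgue_tuple n))
        (prodm (lebesgue_tuple n) (lebesgue_tuple n)).

Definition vecC (x y : Rn) : 'rV[C]_n := \row_j (tnth x j +i* tnth y j).

Definition pointC (p : (Rn * Rn) * (Rn * Rn)) : E :=
  (vecC p.1.1 p.1.2, vecC p.2.1 p.2.2).

(* [c] is the normalizing constant of the weight, left arbitrary *)
Variables (c l : R).

Definition fock_weight (p : E) : R :=
  c * expR (l * Im (dotc p.1 (conjv p.2)))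
    * expR (- (1 / 2 * l * coth l * (sqnormv p.1 + sqnormv p.2))).

Definition fock_sqnorm (F : E -> C) : \bar R :=
  (\int[lebesgue_C2n]_p
     (Normc.normc (F (pointC p)) ^+ 2 * fock_weight (pointC p))%:E)%E.

Definition fock_space : set (E -> C) :=
  [set F | (forall p, differentiable F p) /\ (fock_sqnorm F < +oo)%E].

Definition fock_ip (F G : E -> C) : C :=
  let f p := F (pointC p) * conjc (G (pointC p)) in
  (\int[lebesgue_C2n]_p (Re (f p) * fock_weight (pointC p)))%R +i*
  (\int[lebesgue_C2n]_p (Im (f p) * fock_weight (pointC p)))%R.

Lemma fock_ip_diag (F : E -> C) : Re (fock_ip F F) = fine (fock_sqnorm F).
Proof.
rewrite /= /Rintegral /fock_sqnorm; congr fine; apply: eq_integral => p _.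
congr (_ * _)%:E; case: (F _) => x y /=.
by rewrite sqr_sqrtr ?addr_ge0 ?sqr_ge0//; ring.
Qed.

End twisted_fock.
Arguments fock_space {R} n c l.
Arguments fock_ip {R} n c l F G.

Section twisted_fock_representation.
Context {R : realType} {n : nat}.
Variable l : R.
Local Notation C := R[i].
Local Notation E := ('rV[C]_n * 'rV[C]_n)%type.

Definition rho2 (a b : 'rV[C]_n) (F : E -> C) : E -> C := fun p =>
  let: (z, w) := p in
  (expR (l / 2 * Im (dotc a (conjv b))))%:C
  * (expR (- (l / 4 * coth l * (sqnormv a + sqnormv b))))%:C
  * cexp (- 'i%C * (l / 2)%:C * (dotc w (conjv a) - dotc z (conjv b)))
  * cexp ((l / 2 * coth l)%:C * (dotc z (conjv a) + dotc w (conjv b)))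
  * F (z - a, w - b).

Definition rho (g : heis n l) (F : E -> C) : E -> C :=
  let: (a, b, t) := g in cexp (- 'i%C * t%:C) *: rho2 a b F.

End twisted_fock_representation.

(* Main.v *)
Require Import Defs.
From HB Require Import structures.
From mathcomp Require Import all_boot all_order all_algebra.
From mathcomp Require Import complex.
From mathcomp Require Import all_classical all_reals all_analysis measurable_realfun.
From mathcomp Require Import ring lra.
Import Order.TTheory GRing.Theory Num.Theory.
Import numFieldNormedType.Exports.

(** Write [q - g] for the translate of [q] by the position part of [g].  The
operator [rho g] maps [F] to [q |-> cexp (phase g q) * F (q - g)], where [phase]
is a cocycle for the group law ([phase_mul]) and the squared modulus of the
multiplier is the quotient of the Gaussian weight at [q - g] by the weight at
[q] ([phase_weight]).  Lebesgue measure being invariant under translations,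
[rho] is a representation by unitary operators ([rho_unitary]).

Strong continuity ([rho_strongly_continuous]) comes from the parallelogram law
and Fatou's lemma: if [h k] tends to [g] while [rho (h k) F] stays at distance
[e] from [rho g F], then the vectors [rho (h k) F + rho g F] tend pointwise to a
vector of squared norm [4 * |F|^2], but all have squared norm at most
[4 * |F|^2 - e^2].

Irreducibility rests on the mean value property.  The weight is invariant under
multiplication of all coordinates by a complex number of modulus one, so the
weighted integral of an entire function is its value at the origin times the
total mass ([entire_weight_integral]).  Applied to [F] this says that evaluation
at the origin is, up to a factor, the scalar product with the constant function
[vacuum]; translating, evaluation at any point is, up to a factor, the scalar
product with a vector in the orbit of [vacuum] ([ip_rho_vacuum]), hence is
continuous.  A closed invariant subspace [M] containing [vacuum] is therefore everything
([vacuum_generates]).  Applied to [F q * F (- q)] the mean value property bounds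
the distance from [F] to the constant [F 0] by the distance from [F] to the
conjugate of its reflection [q |-> F (- q)] ([normsq_sub_value]).  Let now [M] be
closed, invariant and nonzero; after translation some [v] in [M] has
[v 0 <> 0].  Let [u] be the projection of [vacuum] on [M].  For every [g],
[<rho g u, vacuum> = <rho g u, u>] is conjugate to
[<rho g^-1 u, u> = <rho g^-1 u, vacuum>]; at the group elements translating
points to the origin this reads [u q = conj (u (- q))].  So [u] is constant, and
the constant is [1] because [<v, u> = <v, vacuum>] is a nonzero multiple of
[v 0] ([vacuum_mem]).  In the proof a minimising sequence stands for the
projection ([near_orthogonal]), and Fatou's lemma turns its pointwise limits into
limits in norm ([cauchy_limit]).

For the restriction to the real subgroup, let [s] be the sign of [l].  Complex
translations along the isotropic direction [(1, - s * 'i)] of one pair of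
coordinates, suitably modulated, commute with [rho g] for real [g].  The
functions fixed by all of them form a closed invariant subspace ([covariant]).
It contains a Gaussian, so it is not zero, and it does not contain [vacuum]. *)

Set Implicit Arguments.
Unset Strict Implicit.
Unset Printing Implicit Defensive.

Local Open Scope classical_set_scope.
Local Open Scope complex_scope.
Local Open Scope ring_scope.

Local Notation Re := complex.Re.
Local Notation Im := complex.Im.
Local Notation normc := Normc.normc.

(** * Measure-preserving maps *)

Section measure_preserving.
Context {R : realType}.

Definition preserves d (T : measurableType d) (m : set T -> \bar R)
    (f : T -> T) : Prop :=
  measurable_fun setT f /\ forall A, measurable A -> m (f @^-1` A) = m A.

Lemma preserves_comp d (T : measurableType d) (m : set T -> \bar R) f g :
  preserves m f -> preserves m g -> preserves m (f \o g).
Proof.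
move=> [mf pf] [mg pg]; split; first exact: measurableT_comp.
move=> A mA; rewrite comp_preimage pg ?pf//.
by rewrite -[X in measurable X]setTI; exact: mf.
Qed.

Lemma ge0_integral_preserves d (T : measurableType d)
    (m : {measure set T -> \bar R}) f (h : T -> \bar R) :
  preserves m f -> measurable_fun setT h -> (forall x, 0 <= h x)%E ->
  (\int[m]_x h (f x) = \int[m]_x h x)%E.
Proof.
move=> [mf pf] mh h0.
rewrite -[LHS](@ge0_integral_pushforward _ _ _ _ _ f mf m setT h)//.
apply: eq_measure_integral => A mA _; exact: pf.
Qed.

Lemma integral_preserves d (T : measurableType d)
    (m : {measure set T -> \bar R}) f (h : T -> \bar R) :
  preserves m f -> measurable_fun setT h ->
  (\int[m]_x h (f x) = \int[m]_x h x)%E.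
Proof.
move=> pf mh; rewrite integralE [RHS]integralE; congr (_ - _)%E.
  rewrite -(ge0_integral_preserves pf (measurable_funepos mh))//.
  by apply: eq_integral => x _; rewrite -[RHS]/((h^\+ \o f)%E x) -funepos_comp.
rewrite -(ge0_integral_preserves pf (measurable_funeneg mh))//.
by apply: eq_integral => x _; rewrite -[RHS]/((h^\- \o f)%E x) -funeneg_comp.
Qed.

Section skew.
Context d1 d2 (T1 : measurableType d1) (T2 : measurableType d2).
Variable m1 : {sigma_finite_measure set T1 -> \bar R}.
Variable m2 : {sigma_finite_measure set T2 -> \bar R}.

(** By Tonelli: the sections of the preimage of a set are the [g x]-preimages of
its sections. *)
Lemma preserves_skew1 (f : T1 -> T1) (g : T1 -> T2 -> T2) :
  preserves m1 f -> (forall x, preserves m2 (g x)) ->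
  measurable_fun setT (fun p : T1 * T2 => g p.1 p.2) ->
  preserves (prodm m1 m2) (fun p => (f p.1, g p.1 p.2)).
Proof.
move=> [mf pf] pg mg; split.
  apply/measurable_fun_pairP; split => //; exact: (measurableT_comp mf).
move=> A mA; rewrite /prodm /product_measure1.
transitivity (\int[m1]_x (m2 \o xsection A) (f x))%E; last first.
  apply: ge0_integral_preserves => //.
  exact: measurable_fun_xsection.
apply: eq_integral => x _; rewrite [RHS]/= -(pg x).2//; last exact: measurable_xsection.
Qed.

(** The symmetric statement, for which the product measure has to be recognised as
the iterated integral in the other order. *)
Lemma preserves_skew2 (f : T2 -> T1 -> T1) (g : T2 -> T2) :
  (forall y, preserves m1 (f y)) -> preserves m2 g ->
  measurable_fun setT (fun p : T1 * T2 => f p.2 p.1) ->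
  preserves (prodm m1 m2) (fun p => (f p.2 p.1, g p.2)).
Proof.
move=> pf [mg pg] mf.
have mfg : measurable_fun setT (fun p : T1 * T2 => (f p.2 p.1, g p.2)).
  apply/measurable_fun_pairP; split => //; exact: (measurableT_comp mg).
split=> // A mA.
have E B : measurable B -> prodm m1 m2 B = product_measure2 m1 m2 B.
  move=> mB; apply: product_measure_unique => //= *.
  by rewrite product_measure2E.
rewrite !E//; last by rewrite -[X in measurable X]setTI; exact: mfg.
rewrite /product_measure2.
transitivity (\int[m2]_x (m1 \o ysection A) (g x))%E; last first.
  apply: ge0_integral_preserves => //.
  exact: measurable_fun_ysection.
apply: eq_integral => y _; rewrite [RHS]/= -(pf y).2//; last exact: measurable_ysection.
Qed.

Lemma preserves_prod (f : T1 -> T1) (g : T2 -> T2) :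
  preserves m1 f -> preserves m2 g ->
  preserves (prodm m1 m2) (fun p => (f p.1, g p.2)).
Proof.
move=> pf pg; apply: (@preserves_skew1 f (fun=> g)) => //.
apply: (measurableT_comp pg.1) => //.
Qed.

End skew.

Local Notation mR := (measurableTypeR R).

(** Lebesgue measure is determined by its values on intervals. *)
Lemma preserves_lebesgue_shift (a : R) :
  preserves (@lebesgue_measure R) (fun x : mR => x + a : mR).
Proof.
have ms : measurable_fun setT (fun x : mR => (x : R) + a : mR).
  by apply: measurable_funD.
split=> // A mA; pose phi : mR -> mR := fun x => x + a.
apply/esym; apply: (@lebesgue_measure_unique _ (measure_function_pushforward__canonical__measure_function_Measure
    (@lebesgue_measure R) ms)) => //= _ [[b c]] _ <-.
rewrite /pushforward /=.
rewrite (_ : _ @^-1` _ = `]b - a, c - a]%classic); last first.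
  by apply/seteqP; split => x /=; rewrite !in_itv/= ltrBlDr lerBrDr.
rewrite !lebesgue_measure_itv/= !lte_fin ltrD2r; case: ifP => // _.
by rewrite -!EFinB; congr (_%:E); ring.
Qed.

Definition shift_tuple n (a v : n.-tuple mR) : n.-tuple mR :=
  [tuple (tnth v i + tnth a i : R) | i < n].

Lemma measurable_tuple_coord d (T : measurableType d) n
    (f : T -> n.-tuple mR) :
  (forall i, measurable_fun setT (fun x => tnth (f x) i : mR)) ->
  measurable_fun setT f.
Proof. by move=> mf; apply/measurable_fun_tnthP => i; exact: mf. Qed.

Lemma measurable_shift_tuple n (a : n.-tuple mR) :
  measurable_fun setT (shift_tuple a).
Proof.
apply: measurable_tuple_coord => i; rewrite /shift_tuple.
under eq_fun do rewrite tnth_mktuple.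
by apply: measurable_funD => //; exact: measurable_tnth.
Qed.

Lemma preserves_shift_tuple n (a : n.-tuple mR) :
  preserves (lebesgue_tuple n) (shift_tuple a).
Proof.
split; first exact: measurable_shift_tuple.
elim: n => [|n IH] in a *.
  move=> A mA; congr (\d_ _ _); rewrite (_ : shift_tuple a = id)//.
  by apply/funext => v; apply/eq_from_tnth => -[].
move=> A mA /=; rewrite /lebesgue_tuple_step /pushforward.
set b : n.-tuple mR := [tuple of behead a].
have pb : preserves (lebesgue_tuple n) (shift_tuple b).
  by split; [exact: measurable_shift_tuple|exact: IH].
have [_ pp] := preserves_prod (preserves_lebesgue_shift (thead a)) pb.
have mA' : measurable (@tuple_consp R n @^-1` A).
  by rewrite -[X in measurable X]setTI; exact: measurable_tuple_consp.
rewrite -(pp _ mA').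
suff -> : @tuple_consp R n @^-1` (shift_tuple a @^-1` A) =
    (fun p => (p.1 + thead a : mR, shift_tuple b p.2)) @^-1` (@tuple_consp R n @^-1` A) by [].
suff E : shift_tuple a \o @tuple_consp R n =
    @tuple_consp R n \o (fun p => (p.1 + thead a : mR, shift_tuple b p.2)).
  by rewrite -[LHS]/((shift_tuple a \o @tuple_consp R n) @^-1` A) E.
apply/funext => -[x v] /=; apply/eq_from_tnth => i.
rewrite tnth_mktuple; case: (unliftP ord0 i) => [j|] ->.
  rewrite /tuple_consp !tnthS tnth_mktuple tnth_behead; congr (_ + tnth a _).
  by apply/val_inj; rewrite /= inordK// ltnS.
by rewrite /tuple_consp !tnth0 (tuple_eta a) tnth0.
Qed.

Definition rotpair n (c s : R) (p : n.-tuple mR * n.-tuple mR) :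
    n.-tuple mR * n.-tuple mR :=
  ([tuple (c * tnth p.1 i - s * tnth p.2 i : R) | i < n],
   [tuple (s * tnth p.1 i + c * tnth p.2 i : R) | i < n]).

Definition shear1 n (t : R) (p : n.-tuple mR * n.-tuple mR) :
    n.-tuple mR * n.-tuple mR :=
  (shift_tuple [tuple (t * tnth p.2 i : R) | i < n] p.1, p.2).

Definition shear2 n (t : R) (p : n.-tuple mR * n.-tuple mR) :
    n.-tuple mR * n.-tuple mR :=
  (p.1, shift_tuple [tuple (t * tnth p.1 i : R) | i < n] p.2).

Lemma preserves_id d (T : measurableType d) (m : set T -> \bar R) :
  preserves m id.
Proof. by split. Qed.

Lemma preserves_shear1 n t :
  preserves (prodm (lebesgue_tuple n) (lebesgue_tuple n)) (@shear1 n t).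
Proof.
pose f (y : n.-tuple mR) := shift_tuple [tuple (t * tnth y i : R) | i < n].
apply: (@preserves_skew2 _ _ _ _ (lebesgue_tuple n) (lebesgue_tuple n) f id).
- by move=> y; exact: preserves_shift_tuple.
- exact: preserves_id.
apply: measurable_tuple_coord => i; rewrite /f /shift_tuple.
under eq_fun do rewrite !tnth_mktuple.
apply: measurable_funD; first exact: (measurableT_comp (measurable_tnth i)).
apply: measurable_funM => //.
exact: (measurableT_comp (measurable_tnth i)).
Qed.

Lemma preserves_shear2 n t :
  preserves (prodm (lebesgue_tuple n) (lebesgue_tuple n)) (@shear2 n t).
Proof.
pose f (x : n.-tuple mR) := shift_tuple [tuple (t * tnth x i : R) | i < n].
apply: (@preserves_skew1 _ _ _ _ (lebesgue_tuple n) (lebesgue_tuple n) id f).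
- exact: preserves_id.
- by move=> y; exact: preserves_shift_tuple.
apply: measurable_tuple_coord => i; rewrite /f /shift_tuple.
under eq_fun do rewrite !tnth_mktuple.
apply: measurable_funD; first exact: (measurableT_comp (measurable_tnth i)).
apply: measurable_funM => //.
exact: (measurableT_comp (measurable_tnth i)).
Qed.

(** A rotation of angle [2 * x] is a product of three shears, of slopes [- tan x],
[sin (2 * x)] and [- tan x], and shears preserve a product measure because their
sections are translations.  The half-turn, where the tangent is infinite, is the
square of a quarter-turn. *)
Lemma preserves_rotpair n (c s : R) : c ^+ 2 + s ^+ 2 = 1 ->
  preserves (prodm (lebesgue_tuple n) (lebesgue_tuple n)) (@rotpair n c s).
Proof.
have main (a b : R) : a != -1 -> a ^+ 2 + b ^+ 2 = 1 ->
    preserves (prodm (lebesgue_tuple n) (lebesgue_tuple n)) (@rotpair n a b).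
  move=> a1 ab; have a1' : 1 + a != 0 by rewrite addrC -subr_eq0 opprK in a1 *.
  (* the tangent of the half-angle *)
  pose t := b / (1 + a).
  suff -> : @rotpair n a b = @shear1 n (- t) \o @shear2 n b \o @shear1 n (- t).
    apply: preserves_comp; last exact: preserves_shear1.
    by apply: preserves_comp; [exact: preserves_shear1|exact: preserves_shear2].
  have E : t * b = 1 - a.
    apply: (mulIf a1'); rewrite /t mulrAC divfK// -expr2.
    by rewrite (_ : b ^+ 2 = 1 - a ^+ 2); [ring|rewrite -ab; ring].
  have E2 : t * a = b - t by rewrite -[b in RHS](divfK a1') -/t; ring.
  apply/funext => -[x y]; congr pair; apply/eq_from_tnth => i;
    rewrite /= !tnth_mktuple.
    transitivity (tnth x i - (t * b) * tnth x i - (t + t * a) * tnth y i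
      + (t * b - 1 + a) * t * tnth y i).
      by rewrite E E2; ring.
    ring.
  transitivity (tnth y i + b * tnth x i - (t * b) * tnth y i); last by ring.
  by rewrite E; ring.
move=> cs; have [c1|] := eqVneq c (-1); last by move=> ?; exact: main.
have s0 : s = 0.
  by apply/eqP; rewrite -sqrf_eq0; apply/eqP; move: cs; rewrite c1 sqrrN expr1n; lra.
have /main h : (0 : R) != -1 by rewrite eq_sym oppr_eq0 oner_eq0.
suff -> : @rotpair n c s = @rotpair n 0 1 \o @rotpair n 0 1.
  by apply: preserves_comp; apply: h; rewrite expr0n expr1n add0r.
apply/funext => -[x y]; congr pair; apply/eq_from_tnth => i;
  by rewrite /= !tnth_mktuple c1 s0; ring.
Qed.

End measure_preserving.

(** * Measurability by discretisation *)

Section discretisation.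
Context {R : realType}.
Local Notation mR := (measurableTypeR R).

(** The topology of the space of complex row vectors and the sigma-algebra of real
tuples are unrelated structures.  Continuous functions will be shown measurable
on tuples by approximating the identity by maps of countable range with
measurable fibres: composed with such a map, any function is measurable. *)
Definition discretises d (T : measurableType d) (D : nat -> T -> T) : Prop :=
  forall N, exists (Z : countType) (z : T -> Z) (e : Z -> T),
    D N = e \o z /\ forall k, measurable (z @^-1` [set k]).

Lemma measurable_discretised d (T : measurableType d) D (h : T -> R) :
  discretises D -> (forall p, h (D N p) @[N --> \oo] --> h p) ->
  measurable_fun setT h.
Proof.
move=> dD hD; apply: (@measurable_fun_cvg _ _ _ setT (fun N => h \o D N)).
  move=> N; have [Z [z [e [-> fz]]]] := dD N.
  move=> _ A mA; rewrite setTI.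
  rewrite (_ : _ @^-1` A =
      \bigcup_k (z @^-1` [set k] `&` [set _ | A (h (e k))])).
    apply: countable_bigcupT_measurable => // k; apply: measurableI => //.
    have [Ak|Ak] := pselect (A (h (e k))).
      suff -> : [set _ : T | A (h (e k))] = setT by [].
      by apply/seteqP; split.
    suff -> : [set _ : T | A (h (e k))] = set0 by [].
    by apply/seteqP; split.
  by apply/seteqP; split => [x Ax|x [k _ [/= <-]]//]; exists (z x).
by move=> p _; exact: hD.
Qed.

Definition grid (N : nat) (x : mR) : mR :=
  (Num.floor ((x : R) * N.+1%:R))%:~R / N.+1%:R : R.

Lemma grid_dist N (x : R) : `|(grid N x : R) - x| <= N.+1%:R^-1.
Proof.
have N0 : 0 < N.+1%:R :> R by rewrite ltr0n.
rewrite -(ler_pM2r N0) mulVf ?gt_eqF// -[X in _ * X]gtr0_norm// -normrM mulrBl.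
rewrite divfK ?gt_eqF// distrC.
have /andP[h1 h2] := floor_itv (x * N.+1%:R).
by rewrite ger0_norm ?subr_ge0// lerBlDl; move: h2; rewrite intrD; exact: ltW.
Qed.

Lemma discretises_grid : discretises grid.
Proof.
move=> N; exists int, (fun x : mR => Num.floor ((x : R) * N.+1%:R)),
  (fun k => (k%:~R / N.+1%:R : R)); split=> // k.
have N0 : 0 < N.+1%:R :> R by rewrite ltr0n.
rewrite (_ : _ @^-1` _ = `[k%:~R / N.+1%:R, (k + 1)%:~R / N.+1%:R[%classic) //.
apply/seteqP; split => x /=; rewrite in_itv/= ler_pdivrMr// ltr_pdivlMr//.
  by move=> <-; exact: floor_itv.
by move=> xk; exact: floor_def.
Qed.

Lemma discretises_pair d1 d2 (T1 : measurableType d1) (T2 : measurableType d2)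
    (D1 : nat -> T1 -> T1) (D2 : nat -> T2 -> T2) :
  discretises D1 -> discretises D2 ->
  discretises (fun N (p : T1 * T2) => (D1 N p.1, D2 N p.2)).
Proof.
move=> d1P d2P N; have [Z1 [z1 [e1 [-> f1]]]] := d1P N.
have [Z2 [z2 [e2 [-> f2]]]] := d2P N.
exists (Z1 * Z2)%type, (fun p => (z1 p.1, z2 p.2)), (fun k => (e1 k.1, e2 k.2)).
split=> // -[k1 k2].
rewrite (_ : _ @^-1` _ = (z1 @^-1` [set k1]) `*` (z2 @^-1` [set k2])).
  exact: measurableX.
by apply/seteqP; split => -[x y] /= [-> ->].
Qed.

Lemma discretises_tuple n (D : nat -> mR -> mR) : discretises D ->
  discretises (fun N (v : n.-tuple mR) => [tuple D N (tnth v i) | i < n]).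
Proof.
move=> dP N; have [Z [z [e [-> f]]]] := dP N.
exists (n.-tuple Z), (fun v => [tuple z (tnth v i) | i < n]),
  (fun k => [tuple e (tnth k i) | i < n]); split.
  by apply/funext => v; apply/eq_from_tnth => i; rewrite /= !tnth_mktuple.
move=> k.
rewrite (_ : _ @^-1` _ =
    \bigcap_(i in [set: 'I_n]) ((@tnth n mR)^~ i @^-1` (z @^-1` [set tnth k i]))).
  apply: fin_bigcap_measurable => [|i _]; first exact: finite_finset.
  by rewrite -[X in measurable X]setTI; exact: measurable_tnth.
apply/seteqP; split => v /=.
  by move=> <- i _ /=; rewrite tnth_mktuple.
by move=> vk; apply/eq_from_tnth => i; rewrite tnth_mktuple (vk i I).
Qed.

End discretisation.

(** * Goursat's theorem on rectangles *)

Section interval_integral.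
Context {R : realType}.
Local Notation mu := (@lebesgue_measure R).
Implicit Types (f g : R -> R) (a b c : R).

Definition itv_integral a b f : R := (\int[mu]_(x in `[a, b]) f x)%R.

Lemma integrable_cont a b f : continuous f ->
  mu.-integrable `[a, b] (EFin \o f).
Proof.
move=> cf; apply: continuous_compact_integrable; first exact: segment_compact.
exact: continuous_subspaceT.
Qed.

Lemma itv_integralD a b c f : continuous f -> a <= b -> b <= c ->
  itv_integral a c f = itv_integral a b f + itv_integral b c f.
Proof.
move=> cf ab bc; apply/eqP; rewrite addrC -subr_eq; apply/eqP; rewrite /itv_integral.
rewrite Rintegral_itvB//; last exact: integrable_cont.
rewrite Rintegral_itv_obnd_cbnd//.
apply: integrableS (integrable_cont b c cf) => //.
exact: subset_itv_oc_cc.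
Qed.

Lemma itv_integralB a b f g : continuous f -> continuous g ->
  itv_integral a b (fun x => f x - g x) = itv_integral a b f - itv_integral a b g.
Proof. by move=> cf cg; rewrite /itv_integral RintegralB//; exact: integrable_cont. Qed.

Lemma itv_integral_cst a b (k : R) : a <= b -> itv_integral a b (fun=> k) = k * (b - a).
Proof.
move=> ab; rewrite /itv_integral Rintegral_cst//= lebesgue_measure_itv/= lte_fin.
move: ab; rewrite le_eqVlt => /predU1P[->|ab]; first by rewrite ltxx subrr.
by rewrite ab -EFinB.
Qed.

Lemma itv_integral_near_cst a b f (k e : R) : continuous f -> a <= b ->
  (forall x, a <= x <= b -> `|f x - k| <= e) ->
  `|itv_integral a b f - k * (b - a)| <= e * (b - a).
Proof.
move=> cf ab fk.
rewrite -(itv_integral_cst k ab) -(itv_integral_cst e ab) -itv_integralB//; last first.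
  by move=> x; exact: cvg_cst.
have cfk : continuous (fun x => f x - k).
  by move=> x; apply: continuousB; [exact: cf|exact: cst_continuous].
apply: (le_trans (le_normr_Rintegral _ _)) => //; first exact: integrable_cont.
apply: le_Rintegral => //.
- apply: (@integrable_cont a b (fun x => `|f x - k|)) => x.
  by apply: cvg_norm; exact: cfk.
- by apply: integrable_cont => x; exact: cvg_cst.
Qed.

End interval_integral.

Section goursat.
Context {R : realType}.
Variables u v : R -> R -> R.

(** Real differentiability together with the Cauchy-Riemann relations: [al] and [be]
are the real and imaginary parts of the complex derivative of [u + i v]. *)
Definition cauchy_riemann_at x0 y0 := exists al be : R,
  forall e : R, 0 < e -> exists2 de : R, 0 < de & forall x y,
    `|x - x0| < de -> `|y - y0| < de ->
    `|u x y - (u x0 y0 + (al * (x - x0) - be * (y - y0)))|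
      <= e * (`|x - x0| + `|y - y0|) /\
    `|v x y - (v x0 y0 + (be * (x - x0) + al * (y - y0)))|
      <= e * (`|x - x0| + `|y - y0|).

Hypothesis uvP : forall x0 y0, cauchy_riemann_at x0 y0.

Lemma cauchy_riemann_cont x0 y0 e : 0 < e -> exists2 de, 0 < de &
  forall x y, `|x - x0| < de -> `|y - y0| < de ->
    `|u x y - u x0 y0| < e /\ `|v x y - v x0 y0| < e.
Proof.
move=> e0; have [al [be h]] := uvP x0 y0; have [de de0 {}h] := h 1 ltr01.
pose K := `|al| + `|be| + 1; have K0 : 0 < K by rewrite ltr_pwDr// addr_ge0.
exists (Num.min de (e / (2 * K))).
  by rewrite lt_min de0 divr_gt0// mulr_gt0.
move=> x y; rewrite !lt_min => /andP[x1 x2] /andP[y1 y2].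
have [h1 h2] := h x y x1 y1.
have S : K * (`|x - x0| + `|y - y0|) < e.
  move: x2 y2; rewrite !ltr_pdivlMr ?mulr_gt0// => x2 y2; rewrite mulrDr.
  lra.
have Nal (s t : R) : `|s * t| = `|s| * `|t| by rewrite normrM.
have := ler_norm; have N (s : R) := ler_norm s.
split.
  apply: le_lt_trans S; rewrite (_ : u x y - _ = u x y - (u x0 y0 + (al * (x - x0) - be * (y - y0))) + (al * (x - x0) - be * (y - y0))); last by ring.
  apply: (le_trans (ler_normD _ _)); apply: (le_trans (lerD h1 (ler_normB _ _))).
  rewrite !Nal /K; have := normr_ge0 al; have := normr_ge0 be.
  have := normr_ge0 (x - x0); have := normr_ge0 (y - y0); nra.
apply: le_lt_trans S; rewrite (_ : v x y - _ = v x y - (v x0 y0 + (be * (x - x0) + al * (y - y0))) + (be * (x - x0) + al * (y - y0))); last by ring.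
apply: (le_trans (ler_normD _ _)); apply: (le_trans (lerD h2 (ler_normD _ _))).
rewrite !Nal /K; have := normr_ge0 al; have := normr_ge0 be.
have := normr_ge0 (x - x0); have := normr_ge0 (y - y0); nra.
Qed.

Lemma cauchy_riemann_continuous x y : [/\ continuous (u ^~ y), continuous (v ^~ y),
  continuous (u x) & continuous (v x)].
Proof.
split=> t; apply/cvgrPdist_lt => e e0 /=.
- have [de de0 h] := cauchy_riemann_cont t y e0.
  near=> s; rewrite distrC; apply: (proj1 (h _ _ _ _)); last by rewrite subrr normr0.
  by rewrite distrC; near: s; exact: cvgr_dist_lt.
- have [de de0 h] := cauchy_riemann_cont t y e0.
  near=> s; rewrite distrC; apply: (proj2 (h _ _ _ _)); last by rewrite subrr normr0.
  by rewrite distrC; near: s; exact: cvgr_dist_lt.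
- have [de de0 h] := cauchy_riemann_cont x t e0.
  near=> s; rewrite distrC; apply: (proj1 (h _ _ _ _)); first by rewrite subrr normr0.
  by rewrite distrC; near: s; exact: cvgr_dist_lt.
- have [de de0 h] := cauchy_riemann_cont x t e0.
  near=> s; rewrite distrC; apply: (proj2 (h _ _ _ _)); first by rewrite subrr normr0.
  by rewrite distrC; near: s; exact: cvgr_dist_lt.
Unshelve. all: by end_near. Qed.

Let cu1 y : continuous (u ^~ y). Proof. by have [] := cauchy_riemann_continuous 0 y. Qed.
Let cv2 x : continuous (v x). Proof. by have [] := cauchy_riemann_continuous x 0. Qed.

(** The real part of the integral of [(u + i v) dz] along the boundary of the
rectangle [a, b] x [c, d]. *)
Definition contour a b c d : R :=
  itv_integral a b (fun x => u x c - u x d) - itv_integral c d (fun y => v b y - v a y).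

Lemma contourDx a m b c d : a <= m -> m <= b ->
  contour a b c d = contour a m c d + contour m b c d.
Proof.
move=> am mb; rewrite /contour (@itv_integralD _ a m b)//; last first.
  by move=> x; apply: continuousB; exact: cu1.
suff -> : itv_integral c d (fun y => v b y - v a y) =
  itv_integral c d (fun y => v b y - v m y) + itv_integral c d (fun y => v m y - v a y) by ring.
rewrite /itv_integral -RintegralD//; last 2 first.
- by apply: integrable_cont => y; apply: continuousB; exact: cv2.
- by apply: integrable_cont => y; apply: continuousB; exact: cv2.
by apply: eq_Rintegral => y _; ring.
Qed.

Lemma contourDy a b c m d : c <= m -> m <= d ->
  contour a b c d = contour a b c m + contour a b m d.
Proof.
move=> cm md; rewrite /contour (@itv_integralD _ c m d)//; last first.
  by move=> x; apply: continuousB; exact: cv2.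
suff -> : itv_integral a b (fun x => u x c - u x d) =
  itv_integral a b (fun x => u x c - u x m) + itv_integral a b (fun x => u x m - u x d) by ring.
rewrite /itv_integral -RintegralD//; last 2 first.
- by apply: integrable_cont => y; apply: continuousB; exact: cu1.
- by apply: integrable_cont => y; apply: continuousB; exact: cu1.
by apply: eq_Rintegral => y _; ring.
Qed.

(** Quartering the rectangle: the contributions of the interior sides cancel. *)
Lemma contour_quarter a c s t : 0 <= s -> 0 <= t ->
  contour a (a + (s + s)) c (c + (t + t)) =
  (contour a (a + s) c (c + t) + contour a (a + s) (c + t) (c + t + t)) +
  (contour (a + s) (a + s + s) c (c + t) +
   contour (a + s) (a + s + s) (c + t) (c + t + t)).
Proof.
move=> s0 t0; rewrite (addrA a) (addrA c).
rewrite (@contourDx a (a + s)) ?lerDl//.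
by rewrite (@contourDy a _ c (c + t)) ?lerDl// (@contourDy (a + s) _ c (c + t)) ?lerDl.
Qed.

Section bisection.
Variables A B : R.
Hypotheses (A0 : 0 <= A) (B0 : 0 <= B).

Let side (S : R) n : R := S / 2 ^+ n.
Let cell n (p : R * R) : R :=
  contour p.1 (p.1 + side A n) p.2 (p.2 + side B n).

Let sideS S n : side S n = side S n.+1 + side S n.+1.
Proof.
rewrite /side exprS invfM; set q := _^-1.
by rewrite [in RHS]mulrCA; field.
Qed.

Let side_ge0 S n : 0 <= S -> 0 <= side S n.
Proof. by move=> S0; rewrite divr_ge0// exprn_ge0. Qed.

(** The pigeonhole step: four smaller terms cannot add up to [cell n p], by the
triangle inequality applied to [contour_quarter]. *)
Lemma bisection_step n p : exists q : R * R,
  [/\ p.1 <= q.1 /\ q.1 + side A n.+1 <= p.1 + side A n,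
      p.2 <= q.2 /\ q.2 + side B n.+1 <= p.2 + side B n
    & `|cell n p| <= 4 * `|cell n.+1 q| ].
Proof.
have sA := side_ge0 n.+1 A0; have sB := side_ge0 n.+1 B0.
have SA := sideS A n; have SB := sideS B n.
pose q00 := p; pose q10 := (p.1 + side A n.+1, p.2).
pose q01 := (p.1, p.2 + side B n.+1).
pose q11 := (p.1 + side A n.+1, p.2 + side B n.+1).
have E : cell n p = (cell n.+1 q00 + cell n.+1 q01) +
  (cell n.+1 q10 + cell n.+1 q11).
  by rewrite /cell SA SB; exact: contour_quarter.
have [|h00] := leP (`|cell n p|) (4 * `|cell n.+1 q00|).
  by exists q00; split => //=; split=> //; lra.
have [|h10] := leP (`|cell n p|) (4 * `|cell n.+1 q10|).
  by exists q10; split => //=; split=> //; lra.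
have [|h01] := leP (`|cell n p|) (4 * `|cell n.+1 q01|).
  by exists q01; split => //=; split=> //; lra.
have [|h11] := leP (`|cell n p|) (4 * `|cell n.+1 q11|).
  by exists q11; split => //=; split=> //; lra.
have T := ler_normD.
have := T _ _ (cell n.+1 q00 + cell n.+1 q01) (cell n.+1 q10 + cell n.+1 q11).
have := T _ _ (cell n.+1 q00) (cell n.+1 q01).
have := T _ _ (cell n.+1 q10) (cell n.+1 q11).
rewrite -E; lra.
Qed.

Lemma nested_limit (X : nat -> R) (S : R) : 0 <= S ->
  (forall n, X n <= X n.+1 /\ X n.+1 + side S n.+1 <= X n + side S n) ->
  exists x, forall n, X n <= x <= X n + side S n.
Proof.
move=> S0 XS.
have up n k : X n <= X (n + k)%N.
  by elim: k => [|k IH]; rewrite ?addn0// addnS (le_trans IH)//; have [] := XS (n + k)%N.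
have dn n k : X (n + k)%N + side S (n + k) <= X n + side S n.
  elim: k => [|k IH]; rewrite ?addn0// addnS; apply: le_trans IH.
  by have [] := XS (n + k)%N.
have bd m n : X m <= X n + side S n.
  have s0 k := side_ge0 k S0.
  have [mn|/ltnW nm] := leqP m n.
    by have := up m (n - m)%N; rewrite subnKC// => h; rewrite (le_trans h)// lerDl.
  have := dn n (m - n)%N; rewrite subnKC// => h; rewrite (le_trans _ h)//.
  by rewrite lerDl.
exists (sup (range X)) => n; apply/andP; split.
  apply: ub_le_sup; last by exists n.
  by exists (X 0%N + side S 0) => _ [m _ <-].
apply: sup_le_ub; first by exists (X 0%N); exists 0%N.
by move=> _ [m _ <-].
Qed.

(** Repeated quartering yields rectangles shrinking to a point, the [n]-th of which
carries at least [4 ^- n] times the contour integral.  The contour integral of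
the affine approximation at the limit point vanishes, and the remainder is
[e / K] times the size of the rectangle, so that its contour integral is of order
[e * 4 ^- n]. *)
Lemma goursat_corner a c : contour a (a + A) c (c + B) = 0.
Proof.
have [f fP] := choice (fun np : nat * (R * R) => @bisection_step np.1 np.2).
pose P := fix P n := if n is m.+1 then f (m, P m) else (a, c).
have [x xP] : exists x, forall n, (P n).1 <= x <= (P n).1 + side A n.
  by apply: nested_limit => // n; have [] := fP (n, P n).
have [y yP] : exists y, forall n, (P n).2 <= y <= (P n).2 + side B n.
  by apply: nested_limit => // n; have [] := fP (n, P n).
have grow n : `|cell 0 (a, c)| <= 4 ^+ n * `|cell n (P n)|.
  elim: n => [|n IH]; first by rewrite expr0 mul1r.
  apply: (le_trans IH); rewrite exprSr -mulrA ler_wpM2l ?exprn_ge0//.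
  by have [] := fP (n, P n).
suff : `|cell 0 (a, c)| <= 0.
  by rewrite normr_le0 => /eqP; rewrite /cell /side /= expr0 !divr1.
apply/ler_addgt0Pr => e e0; rewrite add0r.
(* [2 * (A + B) ^+ 2] is the constant accumulated by the estimate [cb] below *)
pose K := 2 * (A + B) ^+ 2 + 1.
have K0 : 0 < K by rewrite ltr_wpDl// mulr_ge0// sqr_ge0.
have [al [be h]] := uvP x y.
have [de de0 {}h] := h (e / K) (divr_gt0 e0 K0).
have [n nP] : exists n, (A + B) / 2 ^+ n < de.
  near \oo => n; exists n.
  have : `|0 - (A + B) * (2^-1) ^+ n| < de.
    near: n; apply: cvgr_dist_lt => //.
    by rewrite -[X in _ --> X](mulr0 (A + B)); apply: cvgMr; apply: cvg_expr; rewrite ger0_norm; lra.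
  by rewrite sub0r normrN exprVn; apply: le_lt_trans; exact: ler_norm.
apply: (le_trans (grow n)).
set p := P n; set An := side A n; set Bn := side B n.
have An0 : 0 <= An by exact: side_ge0.
have Bn0 : 0 <= Bn by exact: side_ge0.
have nP' : An + Bn < de by rewrite /An /Bn /side -mulrDl.
have /andP[x1 x2] := xP n; have /andP[y1 y2] := yP n.
rewrite -/p -/An -/Bn in x1 x2 y1 y2.
pose eta := e / K * (An + Bn).
have hB s t : p.1 <= s <= p.1 + An -> p.2 <= t <= p.2 + Bn ->
    `|u s t - (u x y + (al * (s - x) - be * (t - y)))| <= eta /\
    `|v s t - (v x y + (be * (s - x) + al * (t - y)))| <= eta.
  move=> /andP[s1 s2] /andP[t1 t2].
  have sx : `|s - x| <= An by rewrite ler_norml; apply/andP; split; lra.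
  have ty : `|t - y| <= Bn by rewrite ler_norml; apply/andP; split; lra.
  have sx' : `|s - x| < de by lra.
  have ty' : `|t - y| < de by lra.
  have [h1 h2] := h s t sx' ty'.
  have eK : 0 <= e / K by rewrite divr_ge0// ltW.
  by split; [apply: (le_trans h1)|apply: (le_trans h2)];
    rewrite ler_wpM2l// lerD.
have e1 : p.1 <= p.1 <= p.1 + An by lra.
have e2 : p.1 <= p.1 + An <= p.1 + An by lra.
have e3 : p.2 <= p.2 <= p.2 + Bn by lra.
have e4 : p.2 <= p.2 + Bn <= p.2 + Bn by lra.
have I1 : `|itv_integral p.1 (p.1 + An) (fun s => u s p.2 - u s (p.2 + Bn))
     - be * Bn * (p.1 + An - p.1)| <= 2 * eta * (p.1 + An - p.1).
  apply: itv_integral_near_cst; [|by lra|].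
    by move=> s; apply: continuousB; exact: cu1.
  move=> s sP; have [h1 _] := hB s p.2 sP e3; have [h2 _] := hB s (p.2 + Bn) sP e4.
  move: h1 h2; rewrite !ler_norml => /andP[? ?] /andP[? ?]; apply/andP; split; lra.
have I2 : `|itv_integral p.2 (p.2 + Bn) (fun t => v (p.1 + An) t - v p.1 t)
     - be * An * (p.2 + Bn - p.2)| <= 2 * eta * (p.2 + Bn - p.2).
  apply: itv_integral_near_cst; [|by lra|].
    by move=> s; apply: continuousB; exact: cv2.
  move=> t tP; have [_ h1] := hB p.1 t e1 tP; have [_ h2] := hB (p.1 + An) t e2 tP.
  move: h1 h2; rewrite !ler_norml => /andP[? ?] /andP[? ?]; apply/andP; split; lra.
have cb : `|cell n p| <= 2 * eta * (An + Bn).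
  rewrite /cell /contour -/An -/Bn; move: I1 I2; rewrite !ler_norml.
  move=> /andP[? ?] /andP[? ?]; apply/andP; split; nra.
apply: (@le_trans _ _ (4 ^+ n * (2 * eta * (An + Bn)))).
  by rewrite ler_wpM2l// exprn_ge0.
have -> : 4 ^+ n * (2 * eta * (An + Bn)) = e * (2 * (A + B) ^+ 2 / K).
  rewrite /eta /An /Bn /side -mulrDl (_ : 4 = 2 * 2 :> R); last by ring.
  rewrite exprMn; field; rewrite expf_neq0//= gt_eqF//.
have KK : 2 * (A + B) ^+ 2 / K <= 1 by rewrite ler_pdivrMr// mul1r /K lerDl.
by rewrite ler_piMr// ltW.
Unshelve. all: by end_near. Qed.

End bisection.

Lemma goursat a b c d : a <= b -> c <= d -> contour a b c d = 0.
Proof.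
move=> ab cd; have := @goursat_corner (b - a) (d - c) _ _ a c.
by rewrite !subr_ge0 => /(_ ab cd); rewrite !(addrC _ (_ - _)) !subrK.
Qed.

End goursat.

(** * Complex differentiability and the mean value property *)

Section complex_norm.
Context {R : realType}.
Local Notation C := R[i].
Implicit Types z w : C.

Lemma normCE z : `|z| = (normc z)%:C.
Proof. by []. Qed.

Lemma normc_ge0 z : 0 <= normc z.
Proof. by case: z => a b; exact: sqrtr_ge0. Qed.

Lemma normc_sqr z : normc z ^+ 2 = Re z ^+ 2 + Im z ^+ 2.
Proof. by case: z => a b; rewrite /= sqr_sqrtr// addr_ge0// sqr_ge0. Qed.

Lemma normc_Re z : `|Re z| <= normc z.
Proof.
rewrite -(@ler_pXn2r _ 2)// ?nnegrE ?normr_ge0 ?normc_ge0//.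
by rewrite normc_sqr real_normK ?num_real// lerDl sqr_ge0.
Qed.

Lemma normc_Im z : `|Im z| <= normc z.
Proof.
rewrite -(@ler_pXn2r _ 2)// ?nnegrE ?normr_ge0 ?normc_ge0//.
by rewrite normc_sqr real_normK ?num_real// lerDr sqr_ge0.
Qed.

Lemma normc_real (x : R) : normc x%:C = `|x|.
Proof. by rewrite /= expr0n /= addr0 sqrtr_sqr. Qed.

Lemma normc_le z : normc z <= `|Re z| + `|Im z|.
Proof.
rewrite -(@ler_pXn2r _ 2)// ?nnegrE ?addr_ge0 ?normc_ge0//.
rewrite normc_sqr sqrrD !real_normK ?num_real//.
by rewrite addrAC lerDl mulrn_wge0// mulr_ge0.
Qed.

Lemma normcB z w : normc (z - w) = normc (w - z).
Proof.
case: z w => a b [c d]; rewrite /= -[a - c]opprB sqrrN -[b - d]opprB.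
by rewrite [in LHS]sqrrN.
Qed.

Lemma normc_conj z : normc (conjc z) = normc z.
Proof. by case: z => a b; rewrite /= sqrrN. Qed.

(** Neighbourhoods in [R[i]] have radii in [R[i]]; a positive complex number is real,
so that real radii suffice. *)
Lemma nearC (z : C) (P : C -> Prop) :
  (\forall h \near z, P h) <->
  exists2 de : R, 0 < de & forall h, normc (h - z) < de -> P h.
Proof.
split=> [/nbhs_ballP[[e e'] /=]|[de de0 h]].
  rewrite ltcE/= => /andP[/eqP -> e0] h; exists e => // w wz; apply: h.
  by rewrite /ball/= distrC normCE ltcR.
apply/nbhs_ballP; exists de%:C => /=; first by rewrite ltcR.
by move=> w; rewrite /ball/= distrC normCE ltcR; exact: h.
Qed.

(** Complex differentiability with real epsilons, the form in which it meets the
real statements on rectangles. *)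
Definition cdiff (f : C -> C) z := exists d : C,
  forall e : R, 0 < e -> exists2 de : R, 0 < de &
  forall w, normc (w - z) < de ->
    normc (f w - f z - d * (w - z)) <= e * normc (w - z).

Lemma differentiable_cdiff (f : C -> C) z : differentiable f z -> cdiff f z.
Proof.
move=> /diff_locallyxP[_ h]; exists ('d f z 1) => e e0.
have /eqaddoP := funext h.
move=> /(_ e%:C); rewrite ltcR => /(_ e0) /nearC[de de0 {}h]; exists de => // w wz.
have := h (w - z); rewrite subr0 => /(_ wz).
rewrite /= !fctE subrK !normCE.
rewrite -rmorphM lecR opprD addrA.
suff -> : 'd f z (w - z) = 'd f z 1 * (w - z) by [].
by rewrite -[w - z in LHS]mulr1 -[_ * 1]/((w - z) *: (1 : C)) linearZ mulrC.
Qed.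

Lemma cdiff_differentiable (f : C -> C) z (d : C) :
  (forall e : R, 0 < e -> exists2 de : R, 0 < de &
  forall w, normc (w - z) < de ->
    normc (f w - f z - d * (w - z)) <= e * normc (w - z)) ->
  differentiable f z.
Proof.
move=> h; apply/derivable1_diffP; rewrite /derivable; apply/cvg_ex; exists d.
apply/cvgrPdist_le => -[e e']; rewrite ltcE/= => /andP[/eqP -> e0].
have [de de0 {}h] := h e e0.
apply: (iffRL (nearC _ (fun k => k != 0 -> _))).
exists de => // k; rewrite subr0 => kd k0.
have := h (k + z); rewrite addrK => /(_ kd) hk.
rewrite distrC normCE /= lecR.
rewrite -[k *: 1]/(k * 1) mulr1.
have nk : 0 < normc k.
  by rewrite lt_neqAle normc_ge0 andbT eq_sym; apply: contra k0 => /eqP /Normc.eq0_normc ->.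
rewrite -(ler_pM2r nk) -Normc.normcM.
rewrite (_ : (k^-1 *: (f (k + z) - f z) - d) * k = f (k + z) - f z - d * k)//.
by rewrite -[_ *: _]/(_ * _) mulrBl mulrAC mulVf// mul1r.
Qed.

End complex_norm.

Section complex_exponential.
Context {R : realType}.
Local Notation C := R[i].
Implicit Types z w : C.

Lemma cexpD z w : cexp (z + w) = cexp z * cexp w.
Proof.
case: z w => a b [x y]; rewrite /cexp /= expRD cosD sinD.
by apply/eqP; rewrite eq_complex /=; apply/andP; split; apply/eqP; ring.
Qed.

Lemma cexp0 : cexp (0 : C) = 1.
Proof.
by rewrite /cexp/= expR0 cos0 sin0; apply/eqP; rewrite eq_complex/= !mul1r !mul0r subr0 addr0 !eqxx.
Qed.

Lemma cexp_real (x : R) : cexp x%:C = (expR x)%:C.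
Proof.
by rewrite /cexp/= cos0 sin0; apply/eqP; rewrite eq_complex/= !mulr1 !mul0r !mulr0 subr0 addr0 !eqxx.
Qed.

Lemma normc_cexp z : normc (cexp z) = expR (Re z).
Proof.
rewrite /cexp Normc.normcM normc_real ger0_norm ?expR_ge0//.
by rewrite /= cos2Dsin2 sqrtr1 mulr1.
Qed.

Lemma is_derive_eps (f : R -> R) (d : R) : is_derive (0 : R) 1 f d ->
  forall e : R, 0 < e -> exists2 de : R, 0 < de &
  forall h : R, `|h| < de -> `|f h - f 0 - d * h| <= e * `|h|.
Proof.
move=> [df dE] e e0.
have : differentiable f (0 : R) by apply/derivable1_diffP.
move=> /[dup] dff /diff_locallyxP[_ /funext /eqaddoP /(_ e e0)].
move=> /nbhs_ballP[de de0 h]; exists de => // k kd.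
have := h k; rewrite /ball/= sub0r normrN => /(_ kd).
rewrite !fctE addr0 opprD addrA.
suff -> : 'd f (0 : R) k = d * k by [].
rewrite -dE -[k in LHS]mulr1 -[_ * 1]/(k *: (1 : R)) linearZ /= mulrC.
by rewrite deriveE.
Qed.

(** From the first-order expansions at [0] of the three real functions involved: the
error of a product is bounded by those of its factors. *)
Lemma cexp_near0 (e : R) : 0 < e -> exists2 de : R, 0 < de &
  forall h : C, normc h < de -> normc (cexp h - 1 - h) <= e * normc h.
Proof.
move=> e0; have [e1 [e10 e11 e18]] :
    exists e1 : R, [/\ 0 < e1, e1 <= 1 & e1 <= e / 8].
  exists (Num.min (e / 8) 1); split.
  - by rewrite lt_min ltr01 divr_gt0.
  - by rewrite ge_min lexx orbT.
  - by rewrite ge_min lexx.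
have [d1 d10 h1] := is_derive_eps (is_derive_expR (0 : R)) e10.
have [d2 d20 h2] := is_derive_eps (is_derive_sin (0 : R)) e10.
have [d3 d30 h3] := is_derive_eps (is_derive_cos (0 : R)) e10.
exists (Num.min (Num.min d1 d2) (Num.min d3 e1)).
  by rewrite !lt_min d10 d20 d30.
move=> h; rewrite !lt_min => /andP[/andP[g1 g2] /andP[g3 g4]].
have nR := normc_Re h; have nI := normc_Im h.
have := h1 (Re h) (le_lt_trans nR g1).
have := h2 (Im h) (le_lt_trans nI g2).
have := h3 (Im h) (le_lt_trans nI g3).
have := cos_le1 (Im h); have := cos_geN1 (Im h).
rewrite expR0 sin0 cos0 !mul1r subr0 oppr0 mul0r subr0.
move=> c1 c2 hc hs hX; apply: (le_trans (normc_le _)).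
move: c1 c2 hc hs hX; have nh := normc_ge0 h.
move: (normc h) nh nR nI g4 {g1 g2 g3 h1 h2 h3}; case: h => x y /= N N0 xN yN Ne.
set X := expR x; set s := sin y; set c := cos y => c1 c2.
rewrite !mul0r !subr0 addr0.
move=> hc hs hX.
have A1 : `|X * c - 1 - x| <= `|X - 1 - x| + 2 * `|c - 1|.
  rewrite (_ : X * c - 1 - x = (X - 1 - x) * c + (1 + x) * (c - 1)); last by ring.
  apply: (le_trans (ler_normD _ _)); rewrite !normrM lerD//.
    by rewrite ler_piMr// ler_norml c1 c2.
  rewrite ler_wpM2r//; apply: (le_trans (ler_normD _ _)); rewrite normr1.
  lra.
have A2 : `|X * s - y| <= 2 * N * (2 * `|y|) + `|s - y|.
  rewrite (_ : X * s - y = (X - 1) * s + (s - y)); last by ring.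
  apply: (le_trans (ler_normD _ _)); rewrite normrM lerD2r ler_pM//.
    rewrite (_ : X - 1 = (X - 1 - x) + x); last by ring.
    apply: (le_trans (ler_normD _ _)).
    have := normr_ge0 x; nra.
  rewrite (_ : s = (s - y) + y); last by ring.
  apply: (le_trans (ler_normD _ _)).
  have := normr_ge0 y; nra.
apply: (le_trans (lerD A1 A2)).
have := normr_ge0 x; have := normr_ge0 y; nra.
Qed.

Lemma differentiable_cexp z : differentiable (@cexp R) z.
Proof.
apply: (@cdiff_differentiable _ _ _ (cexp z)) => e e0.
have E0 : 0 < normc (cexp z) by rewrite normc_cexp expR_gt0.
have [de de0 h] := cexp_near0 (divr_gt0 e0 E0).
exists de => // w wz; have := h _ wz.
rewrite mulrAC ler_pdivlMr// -Normc.normcM.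
rewrite (_ : (cexp (w - z) - 1 - (w - z)) * cexp z =
  cexp w - cexp z - cexp z * (w - z))//.
by rewrite mulrBl [(_ - 1) * _]mulrBl mul1r -cexpD subrK [cexp z * _]mulrC.
Qed.

End complex_exponential.

Section mean_value.
Context {R : realType}.
Local Notation C := R[i].

Lemma cdiff_cauchy_riemann (g : C -> C) : (forall z, cdiff g z) ->
  forall x y, cauchy_riemann_at (fun x y => Re (g (x +i* y)))
    (fun x y => Im (g (x +i* y))) x y.
Proof.
move=> gP x0 y0; have [[al be] h] := gP (x0 +i* y0).
exists al, be => e e0; have [de de0 {}h] := h e e0.
exists (de / 2); first by rewrite divr_gt0.
move=> x y xx yy.
have nle : normc ((x +i* y) - (x0 +i* y0)) <= `|x - x0| + `|y - y0|.
  exact: (le_trans (normc_le _)).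
have := h (x +i* y) (le_lt_trans nle _).
have -> : `|x - x0| + `|y - y0| < de by lra.
move=> /(_ isT) hb.
have hb' := le_trans hb (ler_wpM2l (ltW e0) nle).
by split; apply: le_trans hb'; [apply: le_trans (normc_Re _)|apply: le_trans (normc_Im _)];
  rewrite le_eqVlt; apply/orP; left; apply/eqP; congr (`|_|);
  case: (g (x +i* y)) (g (x0 +i* y0)) => ? ? [? ?] /=; ring.
Qed.

Definition circ (t : R) : C := cos t +i* sin t.

Lemma cexpE x y : cexp (x +i* y) = (expR x)%:C * circ y :> C.
Proof. by []. Qed.

Lemma normc_circ t : normc (circ t) = 1.
Proof. by rewrite /= cos2Dsin2 sqrtr1. Qed.

(** The function [f \o cexp] is periodic of period [2 * pi * 'i], so the horizontal
sides of the rectangle [- L, 0] x [0, 2 * pi] cancel and Goursat's theorem equates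
the integrals over the vertical sides.  The right one is the integral of [f] over
the unit circle; as [L] grows the left one is an integral over a small circle, on
which [f] is close to [f 0]. *)
Lemma mean_value_Im (f : C -> C) : (forall z, differentiable f z) ->
  itv_integral 0 (2 * pi) (fun t => Im (f (circ t))) = Im (f 0) * (2 * pi).
Proof.
move=> df; pose g := f \o @cexp R.
have gd z : cdiff g z.
  apply: differentiable_cdiff; apply: differentiable_comp; last exact: df.
  exact: differentiable_cexp.
have CR := cdiff_cauchy_riemann gd.
set u := fun x y => Re (g (x +i* y)) in CR; set v := fun x y => Im (g (x +i* y)) in CR.
have pi0 : 0 <= 2 * pi :> R by rewrite mulr_ge0// pi_ge0.
have cv x : continuous (v x) by have [] := cauchy_riemann_continuous CR x 0.
have cu y : continuous (u ^~ y) by have [] := cauchy_riemann_continuous CR 0 y.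
have per x : u x 0 = u x (2 * pi).
  by rewrite /u /g /= /cexp /= mulr_natl cos0 sin0 cos2pi sin2pi.
have E (L : R) : 0 <= L ->
    itv_integral 0 (2 * pi) (fun t => v 0 t) = itv_integral 0 (2 * pi) (fun t => v (- L) t).
  move=> L0; have := @goursat _ _ _ CR (- L) 0 0 (2 * pi).
  rewrite oppr_le0 => /(_ L0 pi0); rewrite /contour.
  rewrite (_ : (fun x => u x 0 - _) = (fun=> 0)); last first.
    by apply/funext => x; rewrite -per subrr.
  have L0' : - L <= 0 by rewrite oppr_le0.
  rewrite (itv_integral_cst 0 L0') (itv_integralB _ _ (cv 0) (cv (- L))) mul0r sub0r => /eqP.
  by rewrite oppr_eq0 subr_eq0 => /eqP H; exact: H.
have -> : itv_integral 0 (2 * pi) (fun t => Im (f (circ t))) = itv_integral 0 (2 * pi) (v 0).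
  by apply: eq_Rintegral => t _; rewrite /v /g /= cexpE expR0 mul1r.
apply/eqP; rewrite -subr_eq0 -normr_le0; apply/ler_addgt0Pr => e e0.
rewrite add0r.
pose e1 := e / (2 * pi + 1).
have K0 : 0 < 2 * pi + 1 :> R by rewrite ltr_wpDl.
have e10 : 0 < e1 by rewrite divr_gt0.
have /differentiable_continuous/cvgrPdist_le/(_ e1%:C) := df 0.
rewrite ltcR => /(_ e10) /nearC[de de0 h].
have [L L0 Lde] : exists2 L : R, 0 <= L & expR (- L) < de.
  exists (Num.max 0 (1 - ln de)); first by rewrite le_max lexx.
  rewrite -[X in _ < X]lnK// ltr_expR ltrNl lt_max; apply/orP; right; lra.
rewrite (E L L0).
have := @itv_integral_near_cst _ 0 (2 * pi) (v (- L)) (Im (f 0)) e1 (cv _) pi0.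
rewrite subr0 => h1; apply: (le_trans (h1 _)) => [t _|]; last first.
  rewrite /e1 mulrAC ler_pdivrMr// ler_wpM2l ?(ltW e0)// lerDl//.
have := h (cexp (- L +i* t)); rewrite subr0 normc_cexp => /(_ Lde).
rewrite normCE lecR; apply: le_trans.
rewrite normcB; apply: le_trans (normc_Im _).
by rewrite /v /g /= ImD ImN.
Qed.

(** The imaginary part of ['i * f] is the real part of [f]. *)
Lemma mean_value_Re (f : C -> C) : (forall z, differentiable f z) ->
  itv_integral 0 (2 * pi) (fun t => Re (f (circ t))) = Re (f 0) * (2 * pi).
Proof.
move=> df; have E (z : C) : Im ('i * z) = Re z by case: z => a b /=; ring.
have := @mean_value_Im (fun z => 'i * f z); rewrite E => <-.
  by apply: eq_Rintegral => t _; rewrite E.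
by move=> z; apply: differentiableM => //; exact: df.
Qed.

End mean_value.

(** * Measurability of continuous functions on C^2n *)

Section continuous_measurable.
Context {R : realType} (n : nat).
Local Notation C := R[i].
Local Notation mR := (measurableTypeR R).
Local Notation Rn := (n.-tuple mR).
Local Notation T4 := ((Rn * Rn) * (Rn * Rn))%type.
Local Notation E := ('rV[C]_n * 'rV[C]_n)%type.

Definition grid4 N (p : T4) : T4 :=
  (([tuple grid N (tnth p.1.1 i) | i < n], [tuple grid N (tnth p.1.2 i) | i < n]),
   ([tuple grid N (tnth p.2.1 i) | i < n], [tuple grid N (tnth p.2.2 i) | i < n])).

Lemma discretises_grid4 : discretises grid4.
Proof.
have h := discretises_tuple n (@discretises_grid R).
exact: (discretises_pair (discretises_pair h h) (discretises_pair h h)).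
Qed.

Lemma grid_cvg (x : R) : (grid N x : R) @[N --> \oo] --> x.
Proof.
apply/cvgrPdist_le => e e0; near=> N; rewrite distrC.
apply: (le_trans (grid_dist N x)).
have : `|0 - N.+1%:R^-1| < e :> R.
  near: N; have /cvgrPdist_lt/(_ e e0) := @cvg_harmonic R; exact.
by rewrite sub0r normrN ger0_norm ?invr_ge0// => /ltW.
Unshelve. all: by end_near. Qed.

Lemma cvg_complex (T : Type) (F : set_system T) (FF : Filter F) (a b : T -> R)
    (x y : R) :
  a @ F --> x -> b @ F --> y -> (a N +i* b N : C) @[N --> F] --> (x +i* y : C).
Proof.
move=> ax bY; apply/cvgrPdist_lt => -[e e']; rewrite ltcE/= => /andP[/eqP -> e0].
near=> N; rewrite normCE ltcR; apply: (le_lt_trans (normc_le _)) => /=.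
have h1 : `|x - a N| < e / 2 by near: N; apply: cvgr_dist_lt => //; rewrite divr_gt0.
have h2 : `|y - b N| < e / 2 by near: N; apply: cvgr_dist_lt => //; rewrite divr_gt0.
lra.
Unshelve. all: by end_near. Qed.

Lemma cvg_rV (u : nat -> 'rV[C]_n) (v : 'rV[C]_n) :
  (forall j, u N 0 j @[N --> \oo] --> v 0 j) -> u @ \oo --> v.
Proof.
move=> uv; apply/cvg_ballP => e e0.
have : \forall N \near \oo, forall j, ball (v 0 j) e (u N 0 j).
  apply: filter_forall => j; apply: cvg_ball => //; exact: uv.
by apply: filterS => N h; split=> // i j; rewrite ord1; exact: h.
Qed.

(** This is what makes the grids approximate the identity for the topology of the
space of complex vectors. *)
Lemma pointC_grid_cvg (p : T4) : pointC (grid4 N p) @[N --> \oo] --> pointC p.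
Proof.
have h (x y : Rn) : vecC [tuple grid N (tnth x i) | i < n]
    [tuple grid N (tnth y i) | i < n] @[N --> \oo] --> vecC x y.
  apply: cvg_rV => j; rewrite mxE.
  under eq_fun do rewrite mxE !tnth_mktuple.
  by apply: cvg_complex; exact: grid_cvg.
exact: (cvg_pair (h p.1.1 p.1.2) (h p.2.1 p.2.2)).
Qed.

Lemma Re_continuous : continuous (@complex.Re R).
Proof.
move=> z; apply: (iffRL (@cvgrPdist_lt _ _ C (nbhs z) _ _ _)) => e e0.
apply: (iffRL (nearC _ _)); exists e => // w wz.
by rewrite distrC -ReN -ReD; exact: le_lt_trans (normc_Re _) wz.
Qed.

Lemma Im_continuous : continuous (@complex.Im R).
Proof.
move=> z; apply: (iffRL (@cvgrPdist_lt _ _ C (nbhs z) _ _ _)) => e e0.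
apply: (iffRL (nearC _ _)); exists e => // w wz.
by rewrite distrC -ImN -ImD; exact: le_lt_trans (normc_Im _) wz.
Qed.

Lemma measurable_cont d (T : measurableType d) (D : nat -> T -> T)
    (X : topologicalType) (P : T -> X) (G : X -> R) :
  discretises D -> (forall p, P (D N p) @[N --> \oo] --> P p) ->
  continuous G -> measurable_fun setT (G \o P).
Proof.
move=> dD PD cG; apply: (measurable_discretised dD) => p.
exact: (cvg_comp _ _ (PD p) (cG (P p))).
Qed.

Lemma measurable_pointC (G : E -> R) :
  continuous G -> measurable_fun setT (G \o @pointC R n).
Proof. exact: (measurable_cont discretises_grid4 pointC_grid_cvg). Qed.

Lemma measurable_Re (F : E -> C) : continuous F ->
  measurable_fun setT (fun p : T4 => Re (F (pointC p))).
Proof.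
move=> cF; apply: (@measurable_pointC (@complex.Re R \o F)) => q.
by apply: continuous_comp; [exact: cF|exact: Re_continuous].
Qed.

Lemma measurable_Im (F : E -> C) : continuous F ->
  measurable_fun setT (fun p : T4 => Im (F (pointC p))).
Proof.
move=> cF; apply: (@measurable_pointC (@complex.Im R \o F)) => q.
by apply: continuous_comp; [exact: cF|exact: Im_continuous].
Qed.

Lemma circ_cvg (a : nat -> R) (t : R) :
  a @ \oo --> t -> circ (a N) @[N --> \oo] --> circ t.
Proof.
move=> at'; apply: cvg_complex.
  exact: (cvg_comp _ _ at' (@continuous_cos R t)).
exact: (cvg_comp _ _ at' (@continuous_sin R t)).
Qed.

(** Joint measurability in the angle and the point, required to apply Fubini to the
average over all rotations. *)
Lemma measurable_rotated (G : C -> R) (F : E -> C) : continuous G -> continuous F ->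
  measurable_fun setT (fun x : mR * T4 =>
    G (F (circ (x.1 : R) *: (pointC x.2).1, circ (x.1 : R) *: (pointC x.2).2))).
Proof.
move=> cG cF; pose P (x : mR * T4) : E :=
  (circ (x.1 : R) *: (pointC x.2).1, circ (x.1 : R) *: (pointC x.2).2).
apply: (@measurable_cont _ _ _ _ P (G \o F)
  (discretises_pair (@discretises_grid R) discretises_grid4)); last first.
  by move=> q; apply: continuous_comp; [exact: cF|exact: cG].
move=> [t p]; have hc := circ_cvg (@grid_cvg t).
have hp := @pointC_grid_cvg p.
have h1 : (pointC (grid4 N p)).1 @[N --> \oo] --> (pointC p).1.
  exact: (cvg_comp _ _ hp cvg_fst).
have h2 : (pointC (grid4 N p)).2 @[N --> \oo] --> (pointC p).2.
  exact: (cvg_comp _ _ hp cvg_snd).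
exact: (cvg_pair (cvgZ hc h1) (cvgZ hc h2)).
Qed.

End continuous_measurable.

(** * The Gaussian weight *)

Section gaussian.
Context {R : realType}.
Local Notation mR := (measurableTypeR R).

(** Up to a factor the integrand is a normal density. *)
Lemma gauss_lty (e : R) : 0 < e ->
  (\int[lebesgue_measure]_(x in [set: mR]) (expR (- (e * (x : R) ^+ 2)))%:E < +oo)%E.
Proof.
move=> e0; pose s := Num.sqrt (e * 2)^-1.
have e20 : 0 <= (e * 2)^-1 by rewrite invr_ge0 mulr_ge0// ltW.
have s0 : s != 0 by rewrite gt_eqF// sqrtr_gt0 invr_gt0 mulr_gt0.
have pk := normal_peak_gt0 s0.
have E x : (expR (- (e * x ^+ 2)))%:E = ((normal_peak s)^-1%:E * (normal_pdf 0 s x)%:E)%E.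
  rewrite -EFinM normal_pdfE// mulKf ?gt_eqF// /normal_fun subr0 sqr_sqrtr//.
  congr (expR _)%:E; rewrite mulNr; congr (- _).
  by rewrite -mulr_natr; field; rewrite gt_eqF.
under eq_integral do rewrite E.
rewrite ge0_integralZl//=.
- by rewrite integral_normal_pdf// mule1 ltry.
- by apply/measurable_EFinP; exact: measurable_normal_pdf.
- by move=> x _; rewrite lee_fin normal_pdf_ge0.
- by rewrite lee_fin invr_ge0 ltW.
Qed.

Lemma integral_prod_lty d1 d2 (T1 : measurableType d1) (T2 : measurableType d2)
    (m1 : {sigma_finite_measure set T1 -> \bar R})
    (m2 : {sigma_finite_measure set T2 -> \bar R}) (f : T1 -> R) (g : T2 -> R) :
  measurable_fun setT f -> measurable_fun setT g ->
  (forall x, 0 <= f x) -> (forall y, 0 <= g y) ->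
  (\int[m1]_x (f x)%:E < +oo)%E -> (\int[m2]_y (g y)%:E < +oo)%E ->
  (\int[prodm m1 m2]_p (f p.1 * g p.2)%:E < +oo)%E.
Proof.
move=> mf mg f0 g0 fi gi.
rewrite (_ : (\int[_]_p _ = \int[m1]_x \int[m2]_y (f x * g y)%:E)%E); last first.
  apply: (@fubini_tonelli1 _ _ _ _ _ m1 m2 (fun p => (f p.1 * g p.2)%:E)).
    apply/measurable_EFinP; apply: measurable_funM.
      exact: (measurableT_comp mf measurable_fst).
    exact: (measurableT_comp mg measurable_snd).
  by move=> p; rewrite lee_fin mulr_ge0.
have gge : (0 <= \int[m2]_y (g y)%:E)%E by apply: integral_ge0 => y _; rewrite lee_fin.
have E x : (\int[m2]_y (f x * g y)%:E = (f x)%:E * \int[m2]_y (g y)%:E)%E.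
  under eq_integral do rewrite EFinM.
  rewrite ge0_integralZl//; first exact/measurable_EFinP.
    by move=> y _; rewrite lee_fin.
  by rewrite lee_fin.
under eq_integral do rewrite E.
rewrite ge0_integralZr//; last 2 first.
- exact/measurable_EFinP.
- by move=> x _; rewrite lee_fin.
rewrite lte_mul_pinfty//.
- by apply: integral_ge0 => x _; rewrite lee_fin.
- by rewrite ge0_fin_numE//; apply: integral_ge0 => x _; rewrite lee_fin.
Qed.

Definition sumsq n (v : n.-tuple mR) : R := \sum_(j < n) (tnth v j : R) ^+ 2.

Lemma measurable_sumsq n : measurable_fun setT (@sumsq n).
Proof.
apply: measurable_sum => j; apply: measurable_funX; exact: measurable_tnth.
Qed.

Definition gaussv n (e : R) (v : n.-tuple mR) : R := expR (- (e * sumsq v)).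

Lemma measurable_gaussv n e : measurable_fun setT (@gaussv n e).
Proof.
apply: measurableT_comp => //; apply: measurableT_comp => //.
apply: measurable_funM => //; exact: measurable_sumsq.
Qed.

Lemma gaussv_lty n (e : R) : 0 < e ->
  (\int[lebesgue_tuple n]_v (gaussv e v)%:E < +oo)%E.
Proof.
move=> e0; elim: n => [|n IH].
  rewrite /= integral_dirac//=; last first.
    apply/measurable_EFinP; exact: measurable_gaussv.
  by rewrite diracT mul1e ltry.
rewrite /= /lebesgue_tuple_step.
rewrite ge0_integral_pushforward//=; last 3 first.
- exact: measurable_tuple_consp.
- apply/measurable_EFinP; exact: measurable_gaussv.
- by move=> v _; rewrite lee_fin expR_ge0.
rewrite preimage_setT.
under eq_integral => p _.
  rewrite /= /gaussv /sumsq big_ord_recl /= /tuple_consp tnth0 mulrDr opprD expRD.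
  under eq_bigr do rewrite tnthS.
  over.
apply: (@integral_prod_lty _ _ _ _ lebesgue_measure (lebesgue_tuple n)
   (fun x : mR => expR (- (e * (x : R) ^+ 2))) (gaussv e)) => //.
- apply: measurableT_comp => //; apply: measurableT_comp => //.
  by apply: measurable_funM => //; apply: measurable_funX.
- exact: measurable_gaussv.
- by move=> y; exact: expR_ge0.
- exact: gauss_lty.
Qed.

End gaussian.

Section weight.
Context {R : realType} (n : nat).
Local Notation C := R[i].
Local Notation mR := (measurableTypeR R).
Local Notation Rn := (n.-tuple mR).
Local Notation T4 := ((Rn * Rn) * (Rn * Rn))%type.
Local Notation E := ('rV[C]_n * 'rV[C]_n)%type.

Definition sumsq4 (p : T4) : R :=
  (sumsq p.1.1 + sumsq p.1.2) + (sumsq p.2.1 + sumsq p.2.2).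

Lemma measurable_sumsq4 : measurable_fun setT sumsq4.
Proof.
have m11 : measurable_fun setT (fun p : T4 => p.1.1) by exact: (measurableT_comp measurable_fst measurable_fst).
have m12 : measurable_fun setT (fun p : T4 => p.1.2) by exact: (measurableT_comp measurable_snd measurable_fst).
have m21 : measurable_fun setT (fun p : T4 => p.2.1) by exact: (measurableT_comp measurable_fst measurable_snd).
have m22 : measurable_fun setT (fun p : T4 => p.2.2) by exact: (measurableT_comp measurable_snd measurable_snd).
have ms (f : T4 -> Rn) : measurable_fun setT f -> measurable_fun setT (fun p => sumsq (f p)).
  by move=> mf; exact: (measurableT_comp (@measurable_sumsq R n) mf).
by apply: measurable_funD; apply: measurable_funD; exact: ms.
Qed.

Lemma measurable_gauss4 (e : R) : measurable_fun setT (fun p => expR (- (e * sumsq4 p))).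
Proof.
apply: measurableT_comp => //; apply: measurableT_comp => //.
by apply: measurable_funM => //; exact: measurable_sumsq4.
Qed.

Lemma gauss4_lty (e : R) : 0 < e ->
  (\int[@lebesgue_C2n R n]_p (expR (- (e * sumsq4 p)))%:E < +oo)%E.
Proof.
move=> e0; have g0 := @gaussv_lty R n e e0.
have ge0 (v : Rn) : 0 <= gaussv e v by exact: expR_ge0.
have gg : (\int[prodm (lebesgue_tuple n) (lebesgue_tuple n)]_p
    (gaussv e p.1 * gaussv e p.2 : R)%:E < +oo)%E.
  by apply: integral_prod_lty => //; exact: measurable_gaussv.
have mgg : measurable_fun setT (fun p : Rn * Rn => gaussv e p.1 * gaussv e p.2).
  apply: measurable_funM.
    exact: (measurableT_comp (@measurable_gaussv R n e) measurable_fst).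
  exact: (measurableT_comp (@measurable_gaussv R n e) measurable_snd).
under eq_integral do rewrite /sumsq4 mulrDr opprD expRD !mulrDr !opprD !expRD.
exact: (integral_prod_lty mgg mgg (fun p => mulr_ge0 (ge0 p.1) (ge0 p.2))
  (fun p => mulr_ge0 (ge0 p.1) (ge0 p.2)) gg gg).
Qed.

Lemma Im_dotc_conjv_vecC (x y : Rn) (u v : Rn) : Im (dotc (vecC x y) (conjv (vecC u v))) =
  \sum_(j < n) (tnth y j * tnth u j - tnth x j * tnth v j : R).
Proof.
rewrite /dotc raddf_sum /=; apply: eq_bigr => j _; rewrite !mxE /=; ring.
Qed.

Lemma sqnormv_vecC (x y : Rn) : sqnormv (vecC x y) = sumsq x + sumsq y.
Proof.
rewrite /sqnormv /dotc raddf_sum /= /sumsq -big_split/=.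
by apply: eq_bigr => j _; rewrite !mxE /=; ring.
Qed.

Variables (c l : R).
Hypotheses (c0 : 0 < c) (l0 : l != 0).

Lemma fock_weightE (p : T4) : fock_weight c l (pointC p) =
  c * expR (l * \sum_(j < n) (tnth p.1.2 j * tnth p.2.1 j - tnth p.1.1 j * tnth p.2.2 j : R))
    * expR (- (1 / 2 * l * coth l * sumsq4 p)).
Proof. by rewrite /fock_weight /= Im_dotc_conjv_vecC !sqnormv_vecC. Qed.

Lemma fock_weight_gt0 (q : E) : 0 < fock_weight c l q.
Proof. by rewrite /fock_weight !mulr_gt0// expR_gt0. Qed.

(** The hyperbolic cotangent of a positive number exceeds one.  The gap between the
two sides is what makes the weight decay: the factor [expR (l * Im (z . conj w))]
can grow as fast as [expR (|l| / 2 * |(z, w)|^2)]. *)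
Lemma normr_lt_mulr_coth : `|l| < l * coth l.
Proof.
have main (x : R) : 0 < x -> x < x * coth x.
  move=> x0; rewrite ltr_pMr// /coth.
  have h : expR (- x) < expR x by rewrite ltr_expR; lra.
  rewrite ltr_pdivlMr ?subr_gt0// mul1r.
  have := expR_gt0 (- x); lra.
have [lp|ln|l00] := ltgtP l 0; last by move: l0; rewrite l00 eqxx.
  rewrite ltr0_norm//; have /main : 0 < - l by rewrite oppr_gt0.
  suff -> : coth (- l) = - coth l by rewrite mulrNN.
  by rewrite /coth opprK -[in RHS]mulrN -invrN opprB [in LHS]addrC.
by rewrite gtr0_norm//; exact: main.
Qed.

Lemma measurable_weight : measurable_fun setT (fun p : T4 => fock_weight c l (pointC p)).
Proof.
have m11 : measurable_fun setT (fun p : T4 => p.1.1) by exact: (measurableT_comp measurable_fst measurable_fst).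
have m12 : measurable_fun setT (fun p : T4 => p.1.2) by exact: (measurableT_comp measurable_snd measurable_fst).
have m21 : measurable_fun setT (fun p : T4 => p.2.1) by exact: (measurableT_comp measurable_fst measurable_snd).
have m22 : measurable_fun setT (fun p : T4 => p.2.2) by exact: (measurableT_comp measurable_snd measurable_snd).
under eq_fun do rewrite fock_weightE.
have mc (f : T4 -> Rn) j : measurable_fun setT f ->
    measurable_fun setT (fun p => tnth (f p) j : R).
  by move=> mf; exact: (measurableT_comp (measurable_tnth j) mf).
apply: measurable_funM; [apply: measurable_funM => //|];
  apply: measurableT_comp => //.
  apply: measurable_funM => //; apply: measurable_sum => j.
  by apply: measurable_funB; apply: measurable_funM; exact: mc.
apply: measurableT_comp => //; apply: measurable_funM => //.
exact: measurable_sumsq4.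
Qed.

(** In each pair of coordinates [l * Im (z * conj w)] is at most
[|l| / 2 * (|z|^2 + |w|^2)]: the difference is a combination, with weights
[|l| + l] and [|l| - l], of sums of two squares. *)
Lemma weight_le (p : T4) : fock_weight c l (pointC p) <=
  c * expR (- ((l * coth l - `|l|) / 2 * sumsq4 p)).
Proof.
rewrite fock_weightE -mulrA -expRD ler_pM2l// ler_expR.
rewrite /sumsq4 /sumsq -!big_split/=.
rewrite !mulr_sumr -!sumrN -big_split/=; apply: ler_sum => j _.
set x : R := tnth p.1.1 j; set y : R := tnth p.1.2 j.
set u : R := tnth p.2.1 j; set v : R := tnth p.2.2 j.
have := normr_ge0 l; have := ler_norm l; have := ler_norm (- l).
rewrite normrN.
set L : R := `|l| => h1 h2 h3.
have A1 : 0 <= (L + l) * ((y - u) ^+ 2 + (x + v) ^+ 2).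
  by apply: mulr_ge0; [lra|rewrite addr_ge0 ?sqr_ge0].
have A2 : 0 <= (L - l) * ((y + u) ^+ 2 + (x - v) ^+ 2).
  by apply: mulr_ge0; [lra|rewrite addr_ge0 ?sqr_ge0].
rewrite -subr_ge0; move: (coth l) => K.
rewrite (_ : _ - _ = 4^-1 * ((L + l) * ((y - u) ^+ 2 + (x + v) ^+ 2) + (L - l) * ((y + u) ^+ 2 + (x - v) ^+ 2))); last by field.
by rewrite mulr_ge0// addr_ge0.
Qed.

Lemma integral_weight_lty : (\int[@lebesgue_C2n R n]_p (fock_weight c l (pointC p))%:E < +oo)%E.
Proof.
pose e := (l * coth l - `|l|) / 2.
have e0 : 0 < e by rewrite divr_gt0// subr_gt0 normr_lt_mulr_coth.
apply: (@le_lt_trans _ _ (\int[@lebesgue_C2n R n]_p (c%:E * (expR (- (e * sumsq4 p)))%:E))%E).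
  apply: ge0_le_integral => //.
  - by move=> p _; rewrite lee_fin ltW// fock_weight_gt0.
  - by apply/measurable_EFinP; exact: measurable_weight.
  - apply: emeasurable_funM => //.
    by apply/measurable_EFinP; exact: measurable_gauss4.
  - by move=> p _; rewrite -EFinM lee_fin weight_le.
rewrite ge0_integralZl//.
- by rewrite lte_mul_pinfty ?lee_fin ?ltW// gauss4_lty.
- by apply/measurable_EFinP; exact: measurable_gauss4.
- by rewrite lee_fin ltW.
Qed.

End weight.

(** * Square-integrable continuous functions *)

Section square_integrable.
Context {R : realType} (n : nat).
Local Notation C := R[i].
Local Notation mR := (measurableTypeR R).
Local Notation Rn := (n.-tuple mR).
Local Notation T4 := ((Rn * Rn) * (Rn * Rn))%type.
Local Notation E := ('rV[C]_n * 'rV[C]_n)%type.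
Variables (c l : R).
Hypotheses (c0 : 0 < c) (l0 : l != 0).
Local Notation mu := (@lebesgue_C2n R n).
Local Notation W p := (fock_weight c l (pointC p)).
Local Notation ip := (fock_ip n c l).
Implicit Types F G H : E -> C.

(** The conjugate of an entire function is not entire, but it is needed as an
argument of the scalar product; continuity is what entire functions and their
conjugates share. *)
Definition L2 F : Prop := continuous F /\ (fock_sqnorm c l F < +oo)%E.

Let mW : measurable_fun setT (fun p : T4 => W p).
Proof. exact: measurable_weight. Qed.

Let W0 (p : E) : 0 < fock_weight c l p :> R. Proof. exact: fock_weight_gt0. Qed.

Definition wintegrable (f : E -> R) : Prop :=
  mu.-integrable setT (EFin \o (fun p => f (pointC p) * W p)).

Lemma wintegrable_le (f g : E -> R) :
  measurable_fun setT (fun p : T4 => f (pointC p)) ->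
  (forall q, `|f q| <= g q) -> wintegrable g -> wintegrable f.
Proof.
move=> mf fg ig; apply: le_integrable ig => //.
  by apply/measurable_EFinP; apply: measurable_funM.
move=> p _; rewrite /= lee_fin !normrM ler_wpM2r//.
exact: (le_trans (fg _) (ler_norm _)).
Qed.

Lemma measurable_normc_sqr F : continuous F ->
  measurable_fun setT (fun p : T4 => normc (F (pointC p)) ^+ 2).
Proof.
move=> cF; under eq_fun do rewrite normc_sqr.
by apply: measurable_funD; apply: measurable_funX;
  [exact: measurable_Re|exact: measurable_Im].
Qed.

Lemma L2_nsq F : L2 F <-> continuous F /\ wintegrable (fun q => normc (F q) ^+ 2).
Proof.
have E0 p : (0 <= normc (F (pointC p)) ^+ 2 * W p) by rewrite mulr_ge0 ?exprn_ge0 ?normc_ge0 ?ltW.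
have Eq : (\int[mu]_p `|(EFin \o (fun p => (normc (F (pointC p)) ^+ 2 * W p)%R)) p| = fock_sqnorm c l F)%E.
  by apply: eq_integral => p _ /=; rewrite ger0_norm.
split=> -[cF fF]; split=> //.
  apply/integrableP; split; last by rewrite Eq.
  by apply/measurable_EFinP; apply: measurable_funM => //; exact: measurable_normc_sqr.
by move/integrableP : fF => [_]; rewrite Eq.
Qed.

Definition cross F G (q : E) : C := F q * conjc (G q).

Lemma normc_cross_le F G q :
  normc (cross F G q) <= normc (F q) ^+ 2 + normc (G q) ^+ 2.
Proof.
rewrite /cross Normc.normcM normc_conj.
have := normc_ge0 (F q); have := normc_ge0 (G q).
set x := normc (F q); set y := normc (G q); nra.
Qed.

Lemma wintegrableD (f g : E -> R) : wintegrable f -> wintegrable g -> wintegrable (fun q => f q + g q).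
Proof.
move=> sf sg; rewrite /wintegrable.
have := integrableD measurableT sf sg; apply: eq_integrable => // p _.
by rewrite /= mulrDl.
Qed.

Lemma wintegrableZ k (f : E -> R) : wintegrable f -> wintegrable (fun q => k * f q).
Proof.
move=> sf; rewrite /wintegrable.
have := integrableZl measurableT k sf; apply: eq_integrable => // p _.
by rewrite /= -mulrA.
Qed.

Lemma measurable_cross F G : continuous F -> continuous G ->
  measurable_fun setT (fun p : T4 => Re (cross F G (pointC p))) /\
  measurable_fun setT (fun p : T4 => Im (cross F G (pointC p))).
Proof.
move=> cF cG.
have mrF := measurable_Re cF; have miF := measurable_Im cF.
have mrG := measurable_Re cG; have miG := measurable_Im cG.
split.
  rewrite (_ : (fun _ => _) = (fun p : T4 => Re (F (pointC p)) * Re (G (pointC p))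
     + Im (F (pointC p)) * Im (G (pointC p)))).
    by apply: measurable_funD; apply: measurable_funM.
  apply/funext => p; rewrite /cross; case: (F _) (G _) => a b [x y] /=; ring.
rewrite (_ : (fun _ => _) = (fun p : T4 => Im (F (pointC p)) * Re (G (pointC p))
   - Re (F (pointC p)) * Im (G (pointC p)))).
  by apply: measurable_funB; apply: measurable_funM.
apply/funext => p; rewrite /cross; case: (F _) (G _) => a b [x y] /=; ring.
Qed.

Lemma wintegrable_cross F G : L2 F -> L2 G ->
  wintegrable (fun q => Re (cross F G q)) /\ wintegrable (fun q => Im (cross F G q)).
Proof.
move=> /L2_nsq[cF sF] /L2_nsq[cG sG]; have [m1 m2] := measurable_cross cF cG.
split; apply: wintegrable_le (wintegrableD sF sG) => // q.
  exact: le_trans (normc_Re _) (normc_cross_le _ _ _).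
exact: le_trans (normc_Im _) (normc_cross_le _ _ _).
Qed.

Definition weight_integral (f : E -> R) : R := (\int[mu]_p (f (pointC p) * W p))%R.

Lemma fock_ipE F G : ip F G = weight_integral (fun q => Re (cross F G q)) +i* weight_integral (fun q => Im (cross F G q)).
Proof. by []. Qed.

Lemma weight_integralD (f g : E -> R) : wintegrable f -> wintegrable g ->
  weight_integral (fun q => f q + g q) = weight_integral f + weight_integral g.
Proof.
move=> sf sg; rewrite /weight_integral -RintegralD//; apply: eq_Rintegral => p _.
by rewrite mulrDl.
Qed.

Lemma weight_integralZ k (f : E -> R) : wintegrable f -> weight_integral (fun q => k * f q) = k * weight_integral f.
Proof.
move=> sf; rewrite /weight_integral -RintegralZl//; apply: eq_Rintegral => p _.
by rewrite mulrA.
Qed.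

Lemma eq_weight_integral (f g : E -> R) : f =1 g -> weight_integral f = weight_integral g.
Proof. by move=> fg; apply: eq_Rintegral => p _; rewrite fg. Qed.

Lemma L2Z (k : C) F : L2 F -> L2 (k *: F).
Proof.
move=> /L2_nsq[cF sF]; apply/L2_nsq; split.
  by move=> q; apply: cvgZr; exact: cF.
rewrite (_ : (fun q => _) = (fun q => normc k ^+ 2 * normc (F q) ^+ 2)).
  exact: wintegrableZ.
by apply/funext => q; rewrite -exprMn -Normc.normcM.
Qed.

Lemma L2D F G : L2 F -> L2 G -> L2 (F + G).
Proof.
move=> /L2_nsq[cF sF] /L2_nsq[cG sG]; apply/L2_nsq.
have cFG : continuous (F + G) by move=> q; apply: cvgD; [exact: cF|exact: cG].
split=> //.
apply: wintegrable_le (wintegrableZ 2 (wintegrableD sF sG)); first exact: measurable_normc_sqr.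
move=> q; rewrite ger0_norm ?sqr_ge0//.
have := le_normcD (F q) (G q); have := normc_ge0 (F q); have := normc_ge0 (G q).
have := normc_ge0 (F q + G q).
rewrite -[(F + G) q]/(F q + G q).
move: (normc (F q + G q)) (normc (F q)) (normc (G q)) => s x y s0 y0 x0 sxy.
have : s ^+ 2 <= (x + y) ^+ 2 by rewrite lerXn2r// nnegrE addr_ge0.
have := sqr_ge0 (x - y); nra.
Qed.

Lemma L2B F G : L2 F -> L2 G -> L2 (F - G).
Proof. by move=> fF fG; rewrite -scaleN1r; apply: L2D => //; exact: L2Z. Qed.

Lemma ipDl F G H : L2 F -> L2 G -> L2 H -> ip (F + G) H = ip F H + ip G H.
Proof.
move=> fF fG fH; rewrite !fock_ipE.
have [r1 i1] := wintegrable_cross fF fH; have [r2 i2] := wintegrable_cross fG fH.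
have cE q : cross (F + G) H q = cross F H q + cross G H q.
  by rewrite /cross -[(F + G) q]/(F q + G q) mulrDl.
apply/eqP; rewrite eq_complex /=; apply/andP; split; apply/eqP.
  by rewrite -weight_integralD//; apply: eq_weight_integral => q; rewrite cE ReD.
by rewrite -weight_integralD//; apply: eq_weight_integral => q; rewrite cE ImD.
Qed.

Lemma ipZl (k : C) F G : L2 F -> L2 G -> ip (k *: F) G = k * ip F G.
Proof.
move=> fF fG; rewrite !fock_ipE; have [r1 i1] := wintegrable_cross fF fG.
have cE q : cross (k *: F) G q = k * cross F G q.
  by rewrite /cross -[(k *: F) q]/(k * F q) mulrA.
case: k cE => a b cE.
apply/eqP; rewrite eq_complex /=; apply/andP; split; apply/eqP.
  rewrite -mulNr -!weight_integralZ// -weight_integralD; try exact: wintegrableZ.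
  by apply: eq_weight_integral => q; rewrite cE; case: (cross _ _ _) => x y /=; ring.
rewrite -!weight_integralZ// -weight_integralD; try exact: wintegrableZ.
by apply: eq_weight_integral => q; rewrite cE; case: (cross _ _ _) => x y /=; ring.
Qed.

Lemma ip_conj F G : L2 F -> L2 G -> ip G F = conjc (ip F G).
Proof.
move=> fF fG; rewrite !fock_ipE; have [r1 i1] := wintegrable_cross fF fG.
apply/eqP; rewrite eq_complex /=; apply/andP; split; apply/eqP.
  apply: eq_weight_integral => q; rewrite /cross; case: (F _) (G _) => a b [x y] /=; ring.
rewrite -mulN1r -weight_integralZ//; apply: eq_weight_integral => q.
rewrite /cross; case: (F _) (G _) => a b [x y] /=; ring.
Qed.

Definition normsq F : R := Re (ip F F).

Lemma normsq_ge0 F : 0 <= normsq F.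
Proof.
rewrite /normsq fock_ip_diag fine_ge0//; apply: integral_ge0 => p _.
by rewrite lee_fin mulr_ge0 ?exprn_ge0 ?normc_ge0 ?ltW.
Qed.

Lemma hnorm_sqr F : hnorm ip F ^+ 2 = normsq F.
Proof. by rewrite sqr_sqrtr// normsq_ge0. Qed.

Lemma hnorm_ge0 F : 0 <= hnorm ip F. Proof. exact: sqrtr_ge0. Qed.

Lemma ip_self F : L2 F -> ip F F = (normsq F)%:C.
Proof.
move=> fF; have := ip_conj fF fF; rewrite /normsq; case: (ip F F) => a b /= [/eqP].
by rewrite -addr_eq0 -mulr2n mulrn_eq0/= => /eqP ->.
Qed.

Lemma ipDr F G H : L2 F -> L2 G -> L2 H -> ip H (F + G) = ip H F + ip H G.
Proof.
move=> fF fG fH; rewrite (ip_conj (L2D fF fG) fH) ipDl// rmorphD.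
by rewrite (ip_conj fF fH) (ip_conj fG fH).
Qed.

Lemma ipZr (k : C) F G : L2 F -> L2 G -> ip G (k *: F) = conjc k * ip G F.
Proof.
by move=> fF fG; rewrite (ip_conj (L2Z k fF) fG) ipZl// rmorphM (ip_conj fF fG).
Qed.

Lemma ipBl F G H : L2 F -> L2 G -> L2 H -> ip (F - G) H = ip F H - ip G H.
Proof.
move=> fF fG fH; rewrite -scaleN1r ipDl//; last exact: L2Z.
by rewrite ipZl// mulN1r.
Qed.

Lemma ipBr F G H : L2 F -> L2 G -> L2 H -> ip H (F - G) = ip H F - ip H G.
Proof.
move=> fF fG fH; rewrite -scaleN1r ipDr//; last exact: L2Z.
by rewrite ipZr// rmorphN1 mulN1r.
Qed.

Lemma normsqD F G : L2 F -> L2 G -> normsq (F + G) = normsq F + normsq G + 2 * Re (ip F G).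
Proof.
move=> fF fG; have fFG := L2D fF fG.
rewrite /normsq ipDl// !ipDr// (ip_conj fF fG) !ReD Defs.Re_conj; ring.
Qed.

Lemma normsqZ (k : C) F : L2 F -> normsq (k *: F) = normc k ^+ 2 * normsq F.
Proof.
move=> fF; rewrite /normsq ipZl//; last exact: L2Z.
rewrite ipZr// ip_self// normc_sqr; case: k => a b /=; ring.
Qed.

Lemma normsqB F G : L2 F -> L2 G -> normsq (F - G) = normsq F + normsq G - 2 * Re (ip F G).
Proof.
move=> fF fG; have fFG := L2B fF fG.
rewrite /normsq ipBl// !ipBr// (ip_conj fF fG) !(ReD, ReN) Defs.Re_conj; ring.
Qed.

(** The norm of [F - s <F, G> G] is nonnegative for every real [s]; take [s] to be the
inverse of the squared norm of [G], or large if that norm vanishes. *)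
Lemma cauchy_schwarz F G : L2 F -> L2 G ->
  normc (ip F G) ^+ 2 <= normsq F * normsq G.
Proof.
move=> fF fG; set z := ip F G; set q := normc z ^+ 2.
have q0 : 0 <= q by rewrite exprn_ge0// normc_ge0.
have key (s : R) : 0 <= normsq F - 2 * s * q + s ^+ 2 * q * normsq G.
  have fsG := L2Z (s%:C * z) fG.
  have := normsq_ge0 (F - (s%:C * z) *: G); rewrite normsqB// normsqZ//.
  rewrite ipZr// -/z Normc.normcM normc_real exprMn -/q real_normK ?num_real//.
  suff -> : Re (conjc (s%:C * z) * z) = s * q by rewrite addrAC mulrA.
  by rewrite /q normc_sqr; case: (z) => a b /=; ring.
have [G0|G0] := eqVneq (normsq G) 0.
  have := key (((normsq F) + 1) / (2 * q)); rewrite G0 mulr0 addr0.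
  have [->|qn] := eqVneq q 0; first by rewrite !mulr0.
  rewrite (_ : normsq F - _ = - 1); last by field.
  by rewrite ler0N1.
have Gp : 0 < normsq G by rewrite lt_neqAle eq_sym G0 normsq_ge0.
have := key ((normsq G)^-1); rewrite (_ : _ + _ = (normsq F * normsq G - q) / normsq G); last by field.
by rewrite pmulr_lge0 ?invr_gt0// subr_ge0.
Qed.

Lemma hnorm_cauchy_schwarz F G : L2 F -> L2 G -> normc (ip F G) <= hnorm ip F * hnorm ip G.
Proof.
move=> fF fG; rewrite -(@ler_pXn2r _ 2)// ?nnegrE ?normc_ge0 ?mulr_ge0 ?hnorm_ge0//.
by rewrite exprMn !hnorm_sqr cauchy_schwarz.
Qed.

Lemma hnorm_triangle F G : L2 F -> L2 G -> hnorm ip (F + G) <= hnorm ip F + hnorm ip G.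
Proof.
move=> fF fG; rewrite -(@ler_pXn2r _ 2)// ?nnegrE ?addr_ge0 ?hnorm_ge0//.
rewrite sqrrD !hnorm_sqr normsqD// -mulr_natl.
have := hnorm_cauchy_schwarz fF fG; have := ler_norm (Re (ip F G)); have := normc_Re (ip F G).
lra.
Qed.

(** The source of all limits in norm below: a pointwise limit of a bounded sequence
stays in the same ball. *)
Lemma fatou_L2 (u : nat -> E -> C) F (K : R) :
  (forall j, L2 (u j)) -> continuous F -> (forall j, normsq (u j) <= K) ->
  (forall q, u j q @[j --> \oo] --> F q) -> L2 F /\ normsq F <= K.
Proof.
move=> uL cF uK uF.
pose f j (p : T4) : \bar R := (normc (u j (pointC p)) ^+ 2 * W p)%:E.
have f0 j p : (0 <= f j p)%E by rewrite lee_fin mulr_ge0 ?exprn_ge0 ?normc_ge0 ?ltW.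
have mf j : measurable_fun setT (f j).
  apply/measurable_EFinP; apply: measurable_funM => //; apply: measurable_normc_sqr.
  by have [] := uL j.
have := @fatou _ _ _ mu setT measurableT f mf (fun j p _ => f0 j p).
have fl p : limn_einf (f^~ p) = (normc (F (pointC p)) ^+ 2 * W p)%:E.
  apply: (cvg_limn_einf_sup _).1.
  apply: cvg_EFin; first by near=> j.
  apply: cvgMl.
  under eq_fun do rewrite /= normc_sqr.
  rewrite normc_sqr.
  have hR := cvg_comp _ _ (uF (pointC p)) (@Re_continuous R _).
  have hI := cvg_comp _ _ (uF (pointC p)) (@Im_continuous R _).
  by apply: cvgD; rewrite expr2; under eq_fun do rewrite expr2; exact: cvgM.
under eq_integral do rewrite fl.
have intf j : (\int[mu]_p f j p <= K%:E)%E.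
  have [_ fj] := uL j; have := uK j; rewrite /normsq fock_ip_diag -lee_fin fineK//.
  rewrite ge0_fin_numE//; apply: integral_ge0 => p _; exact: f0.
have lK : (limn_einf (fun j => \int[mu]_p f j p) <= K%:E)%E.
  rewrite limn_einf_lim; apply: lime_le; first exact: is_cvg_einfs.
  apply: nearW => j; apply: le_trans (intf j).
  by apply: ereal_inf_lbound; exists j => /=.
move=> /le_trans/(_ lK) h.
have FL : (fock_sqnorm c l F < +oo)%E by exact: (le_lt_trans h (ltry _)).
split=> //; rewrite /normsq fock_ip_diag -lee_fin fineK//.
rewrite ge0_fin_numE//; apply: integral_ge0 => p _.
by rewrite lee_fin mulr_ge0 ?exprn_ge0 ?normc_ge0 ?ltW.
Unshelve. all: by end_near. Qed.

End square_integrable.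

(** * The mean value property for the Gaussian weight *)

Section symmetries.
Context {R : realType} (n : nat).
Local Notation C := R[i].
Local Notation mR := (measurableTypeR R).
Local Notation Rn := (n.-tuple mR).
Local Notation T4 := ((Rn * Rn) * (Rn * Rn))%type.
Local Notation E := ('rV[C]_n * 'rV[C]_n)%type.
Local Notation mu := (@lebesgue_C2n R n).

Definition rot4 (c s : R) (p : T4) : T4 := (rotpair c s p.1, rotpair c s p.2).

Lemma preserves_rot4 c s : c ^+ 2 + s ^+ 2 = 1 -> preserves mu (rot4 c s).
Proof. by move=> cs; apply: preserves_prod; exact: preserves_rotpair. Qed.

Lemma pointC_rot4 c s p : pointC (rot4 c s p) =
  ((c +i* s) *: (pointC p).1, (c +i* s) *: (pointC p).2) :> E.
Proof.
rewrite /pointC /=; congr pair; apply/rowP => j; rewrite !mxE !tnth_mktuple;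
  by apply/eqP; rewrite eq_complex /=; apply/andP; split; apply/eqP; ring.
Qed.

Definition shift4 (a p : T4) : T4 :=
  ((shift_tuple a.1.1 p.1.1, shift_tuple a.1.2 p.1.2),
   (shift_tuple a.2.1 p.2.1, shift_tuple a.2.2 p.2.2)).

Lemma preserves_shift4 a : preserves mu (shift4 a).
Proof.
have h (b : Rn * Rn) : preserves (prodm (lebesgue_tuple n) (lebesgue_tuple n))
    (fun p => (shift_tuple b.1 p.1, shift_tuple b.2 p.2)).
  by apply: preserves_prod; exact: preserves_shift_tuple.
exact: (preserves_prod (h a.1) (h a.2)).
Qed.

Lemma pointC_shift4 a p : pointC (shift4 a p) =
  ((pointC p).1 + (pointC a).1, (pointC p).2 + (pointC a).2) :> E.
Proof.
by rewrite /pointC /=; congr pair; apply/rowP => j; rewrite !mxE !tnth_mktuple.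
Qed.

Definition coordC (q : E) : T4 :=
  (([tuple (Re (q.1 0 j) : R) | j < n], [tuple (Im (q.1 0 j) : R) | j < n]),
   ([tuple (Re (q.2 0 j) : R) | j < n], [tuple (Im (q.2 0 j) : R) | j < n])).

Lemma coordCK q : pointC (coordC q) = q.
Proof.
case: q => z w; rewrite /pointC /=; congr pair; apply/rowP => j;
  rewrite !mxE !tnth_mktuple /=; by case: (_ 0 j).
Qed.

(** The bilinear pairing with the conjugate vector is invariant under multiplication of
both arguments by a number of modulus one. *)
Lemma weight_rot c l (k : C) (q : E) : normc k = 1 ->
  fock_weight c l (k *: q.1, k *: q.2) = fock_weight c l q.
Proof.
move=> k1; have kk : k * conjc k = 1.
  case: k k1 => a b /= k1; apply/eqP; rewrite eq_complex /=.
  apply/andP; split; apply/eqP; last by ring.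
  have : a ^+ 2 + b ^+ 2 = 1.
    by rewrite -[LHS]sqr_sqrtr ?addr_ge0 ?sqr_ge0// k1 expr1n.
  by move=> <-; ring.
have D (z w : 'rV[C]_n) : dotc (k *: z) (conjv (k *: w)) = dotc z (conjv w).
  rewrite /dotc; apply: eq_bigr => j _; rewrite !mxE rmorphM.
  by rewrite mulrACA -[k * _]/(k * conjc k) kk mul1r.
by rewrite /fock_weight /sqnormv /= !D.
Qed.

End symmetries.

Section mean_value_integral.
Context {R : realType} (n : nat).
Local Notation C := R[i].
Local Notation mR := (measurableTypeR R).
Local Notation Rn := (n.-tuple mR).
Local Notation T4 := ((Rn * Rn) * (Rn * Rn))%type.
Local Notation E := ('rV[C]_n * 'rV[C]_n)%type.
Variables (c l : R).
Hypotheses (c0 : 0 < c) (l0 : l != 0).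
Local Notation mu := (@lebesgue_C2n R n).
Local Notation W p := (fock_weight c l (pointC p)).
Local Notation leb := (@lebesgue_measure R).

(** Averaging over the rotations [circ t], which preserve measure and weight, does
not change the weighted integral.  By Fubini the averages can be taken first,
where by hypothesis they are constant. *)
Lemma weight_integral_average (G : C -> R) (F : E -> C) :
  continuous G -> continuous F ->
  (forall q : E, itv_integral 0 (2 * pi) (fun t => G (F (circ t *: q.1, circ t *: q.2))) =
    G (F 0) * (2 * pi)) ->
  (forall q : E, continuous (fun t => G (F (circ t *: q.1, circ t *: q.2)))) ->
  wintegrable c l (G \o F) -> weight_integral c l (G \o F) = G (F 0) * weight_integral c l (fun _ : E => 1).
Proof.
move=> cG cF mv ct sGF.
pose D : set mR := `[0, 2 * pi]%classic.
have mD : measurable D by exact: measurable_itv.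
pose g (x : mR * T4) : R :=
  G (F (circ (x.1 : R) *: (pointC x.2).1, circ (x.1 : R) *: (pointC x.2).2)).
have mg : measurable_fun setT g by exact: (measurable_rotated cG cF).
have mW : measurable_fun setT (fun p : T4 => W p) by exact: measurable_weight.
pose f (x : mR * T4) : \bar R := (\1_D x.1 * (g x * W x.2))%:E.
have mf : measurable_fun setT f.
  apply/measurable_EFinP; apply: measurable_funM.
    exact: (measurableT_comp (measurable_indic mD) measurable_fst).
  apply: measurable_funM => //.
  exact: (measurableT_comp mW measurable_snd).
pose h (p : T4) : R := G (F (pointC p)) * W p.
have mh : measurable_fun setT (EFin \o h) by exact: measurable_int sGF.
have hrot (t : R) p : g (t, p) * W p = h (rot4 (cos t) (sin t) p).
  rewrite /h /g /= pointC_rot4 -[_ +i* _]/(circ t); congr (_ * _).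
  by rewrite weight_rot// normc_circ.
have pi0 : 0 <= 2 * pi :> R by rewrite mulr_ge0// pi_ge0.
have lD : leb D = (2 * pi)%:E.
  rewrite /D lebesgue_measure_itv/= lte_fin.
  by rewrite mulr_gt0// ?pi_gt0// -EFinB subr0.
have iD : (\int[leb]_t (\1_D t)%:E = (2 * pi)%:E)%E.
  by rewrite integral_indic// setIT.
have rotP (t : R) : preserves mu (rot4 (cos t) (sin t)).
  by apply: preserves_rot4; rewrite cos2Dsin2.
have If t : (\int[mu]_p f (t, p) = (\1_D t)%:E * \int[mu]_p (h p)%:E)%E.
  rewrite -(integral_preserves (rotP t) mh) /f indicE /=.
  case: (t \in D) => /=.
    by rewrite mul1e; apply: eq_integral => p _; rewrite mul1r hrot.
  by rewrite mul0e integral0_eq// => p _; rewrite mul0r.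
have Ifa t : (\int[mu]_p `|f (t, p)| = (\1_D t)%:E * \int[mu]_p `|(h p)%:E|)%E.
  have mah : measurable_fun setT (fun p => `|(h p)%:E|%E) by exact: measurableT_comp.
  rewrite -(ge0_integral_preserves (rotP t) mah)//.
  rewrite -ge0_integralZl//; last exact: (measurableT_comp mah (rotP t).1).
  apply: eq_integral => p _; rewrite /f /= hrot normrM EFinM.
  by rewrite ger0_norm// indicE.
have fi : (leb \x mu)%E.-integrable setT f.
  apply/integrable12ltyP => //.
  under eq_integral do rewrite Ifa.
  rewrite ge0_integralZr//; last 2 first.
  - by apply/measurable_EFinP; exact: measurable_indic.
  - by apply: integral_ge0.
  change ((\int[leb]_t (\1_D t)%:E) * \int[mu]_p `|(h p)%:E| < +oo)%E.
  rewrite iD lte_mul_pinfty//.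
  by move/integrableP : sGF => [].
have := Fubini fi.
have -> : (\int[leb]_x \int[mu]_y f (x, y) = (2 * pi * weight_integral c l (G \o F))%:E)%E.
  under eq_integral do rewrite If.
  have -> : (\int[mu]_p (h p)%:E = (weight_integral c l (G \o F))%:E)%E.
    by rewrite /weight_integral /Rintegral fineK//; exact: integrable_fin_num.
  rewrite integralZr//; last first.
    apply/integrableP; split.
      by apply/measurable_EFinP; exact: measurable_indic.
    have -> : (\int[leb]_t `|(\1_D t)%:E| = \int[leb]_t (\1_D t)%:E)%E.
      by apply: eq_integral => t _; rewrite gee0_abs.
    by rewrite iD ltry.
  change ((\int[leb]_t (\1_D t)%:E) * (weight_integral c l (G \o F))%:E = (2 * pi * weight_integral c l (G \o F))%:E)%E.
  by rewrite iD EFinM.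
have Ig p : (\int[leb]_x f (x, p) = (G (F 0) * (2 * pi))%:E * (W p)%:E)%E.
  transitivity (\int[leb]_(t in D) ((g (t, p))%:E * (W p)%:E))%E.
    rewrite [RHS]integral_mkcond; apply: eq_integral => t _.
    rewrite /f /patch indicE /=; case: ifP => _; first by rewrite mul1r EFinM.
    by rewrite mul0r.
  have ig : leb.-integrable D (EFin \o (fun t => g (t, p))).
    exact: (integrable_cont 0 (2 * pi) (ct (pointC p))).
  rewrite integralZr//; congr (_ * _)%E.
  by rewrite -(mv (pointC p)) /itv_integral /Rintegral fineK//; exact: integrable_fin_num.
have iW : mu.-integrable setT (EFin \o (fun p => 1 * W p)).
  apply/integrableP; split; first by apply/measurable_EFinP; exact: measurable_funM.
  apply: le_lt_trans (integral_weight_lty n c0 l0); rewrite le_eqVlt; apply/orP; left; apply/eqP.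
  apply: eq_integral => p _; rewrite /= mul1r ger0_norm// ltW//.
  exact: fock_weight_gt0.
under [X in _ = X -> _]eq_integral do rewrite Ig -[W _]mul1r.
rewrite integralZl//.
have -> : (\int[mu]_p (1 * W p)%:E = (weight_integral c l (fun _ : E => 1))%:E)%E.
  by rewrite /weight_integral /Rintegral fineK//; exact: integrable_fin_num.
rewrite -EFinM => -[]; rewrite mulrC [X in _ = X]mulrAC => /mulIf; apply.
by rewrite gt_eqF// mulr_gt0// pi_gt0.
Qed.

End mean_value_integral.

Section total_mass.
Context {R : realType} (n : nat).
Local Notation C := R[i].
Local Notation mR := (measurableTypeR R).
Local Notation Rn := (n.-tuple mR).
Local Notation T4 := ((Rn * Rn) * (Rn * Rn))%type.
Local Notation E := ('rV[C]_n * 'rV[C]_n)%type.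
Local Notation mu := (@lebesgue_C2n R n).

Lemma prodm_setT_gt0 d1 d2 (T1 : measurableType d1) (T2 : measurableType d2)
    (m1 : {sigma_finite_measure set T1 -> \bar R})
    (m2 : {sigma_finite_measure set T2 -> \bar R}) :
  (0 < m1 setT)%E -> (0 < m2 setT)%E -> (0 < prodm m1 m2 setT)%E.
Proof.
by move=> h1 h2; rewrite -setXTT /prodm product_measure1E// mule_gt0.
Qed.

Lemma lebesgue_tuple_setT_gt0 k : (0 < lebesgue_tuple k [set: k.-tuple mR])%E.
Proof.
elim: k => [|k IH]; first by rewrite /= diracT.
rewrite /= /lebesgue_tuple_step /pushforward preimage_setT.
apply: (@prodm_setT_gt0 _ _ _ _ lebesgue_measure (lebesgue_tuple k)) => //.
pose D : set mR := `[0%R, 1%R]%classic.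
have D1 : lebesgue_measure D = 1%E.
  by rewrite /D lebesgue_measure_itv/= lte_fin ltr01 -EFinB subr0.
apply: (@lt_le_trans _ _ (lebesgue_measure D)); first by rewrite D1.
by apply: le_measure; rewrite ?inE//; exact: measurable_itv.
Qed.

Variables (c l : R).
Hypotheses (c0 : 0 < c) (l0 : l != 0).

Lemma mass_gt0 : 0 < weight_integral c l (fun _ : E => 1).
Proof.
rewrite lt_neqAle; apply/andP; split; last first.
  apply: Rintegral_ge0 => p _; rewrite mul1r ltW//; exact: fock_weight_gt0.
apply/negP => /eqP; rewrite /weight_integral /Rintegral => /esym h.
have g0 p : (0 <= (1 * fock_weight c l (@pointC R n p))%:E)%E.
  by rewrite lee_fin mul1r ltW// fock_weight_gt0.
have fi : (\int[mu]_p (1 * fock_weight c l (pointC p))%:E < +oo)%E.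
  by under eq_integral do rewrite mul1r; exact: integral_weight_lty.
have : (\int[mu]_p (1 * fock_weight c l (pointC p))%:E = 0)%E.
  rewrite -[LHS]fineK ?h//.
  by rewrite ge0_fin_numE//; apply: integral_ge0.
have mf : measurable_fun setT (fun p => (1 * fock_weight c l (@pointC R n p))%:E).
  by apply/measurable_EFinP; apply: measurable_funM => //; exact: measurable_weight.
have -> : (\int[mu]_p (1 * fock_weight c l (pointC p))%:E =
    \int[mu]_p `|(1 * fock_weight c l (pointC p))%:E|)%E.
  by apply: eq_integral => p _; rewrite gee0_abs.
move/(ae_eq_integral_abs mu measurableT mf) => [A [mA A0 hA]].
have AT : A = setT.
  apply/seteqP; split=> // p _; apply: hA => /= /(_ I) /eqP; apply/negP.
  by rewrite eqe mul1r gt_eqF// fock_weight_gt0.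
move: A0; rewrite AT => /eqP; apply/negP; rewrite gt_eqF//.
have h2 := prodm_setT_gt0 (lebesgue_tuple_setT_gt0 n) (lebesgue_tuple_setT_gt0 n).
exact: (prodm_setT_gt0 h2 h2).
Qed.

End total_mass.

Section reproducing.
Context {R : realType} (n : nat).
Local Notation C := R[i].
Local Notation mR := (measurableTypeR R).
Local Notation Rn := (n.-tuple mR).
Local Notation T4 := ((Rn * Rn) * (Rn * Rn))%type.
Local Notation E := ('rV[C]_n * 'rV[C]_n)%type.
Variables (c l : R).
Hypotheses (c0 : 0 < c) (l0 : l != 0).
Local Notation mu := (@lebesgue_C2n R n).
Local Notation ip := (fock_ip n c l).
Local Notation mass := (weight_integral c l (fun _ : E => 1)).
Local Notation Hs := (fock_space n c l).

Definition entire (F : E -> C) := forall p, differentiable F p.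

Lemma entire_cont F : entire F -> continuous F.
Proof. by move=> eF p; apply: differentiable_continuous. Qed.

Lemma fock_L2 F : Hs F -> L2 c l F.
Proof. by move=> [eF fF]; split=> //; exact: entire_cont. Qed.

Lemma entire_line F (q : E) : entire F ->
  forall z : C, differentiable (fun z : C => F (z *: q.1, z *: q.2)) z.
Proof.
move=> eF z.
apply: (@differentiable_comp _ _ _ _ (fun z : C => (z *: q.1, z *: q.2)) F).
  by apply: differentiable_pair.
exact: eF.
Qed.

(** The mean value property on each complex line through the origin, averaged over
all lines. *)
Lemma entire_weight_integral F : entire F ->
  wintegrable c l (fun q => Re (F q)) -> wintegrable c l (fun q => Im (F q)) ->
  weight_integral c l (fun q => Re (F q)) = Re (F 0) * mass /\
  weight_integral c l (fun q => Im (F q)) = Im (F 0) * mass.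
Proof.
move=> eF sR sI; have cF := entire_cont eF.
have cc (q : E) (G : C -> R) : continuous G ->
    continuous (fun t => G (F (circ t *: q.1, circ t *: q.2))).
  move=> cG t; apply: (continuous_comp (f := circ)
    (g := fun z => G (F (z *: q.1, z *: q.2)))).
    by apply: cvg_complex; [exact: continuous_cos|exact: continuous_sin].
  exact: (cvg_comp _ _ (differentiable_continuous (entire_line q eF (circ t))) (cG _)).
split.
- apply: (@weight_integral_average _ _ _ _ c0 l0 (@complex.Re R)) => //.
  + exact: Re_continuous.
  + move=> q; rewrite (mean_value_Re (entire_line q eF)) !scale0r//.
  + by move=> q; apply: cc; exact: Re_continuous.
- apply: (@weight_integral_average _ _ _ _ c0 l0 (@complex.Im R)) => //.
  + exact: Im_continuous.
  + move=> q; rewrite (mean_value_Im (entire_line q eF)) !scale0r//.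
  + by move=> q; apply: cc; exact: Im_continuous.
Qed.

Definition vacuum : E -> C := fun=> 1.

Lemma entire_cst (k : C) : entire (fun=> k).
Proof. by move=> p; exact: differentiable_cst. Qed.

Lemma fock_vacuum : Hs vacuum.
Proof.
split; first exact: entire_cst.
rewrite /fock_sqnorm; under eq_integral do rewrite Normc.normc1 expr1n mul1r.
exact: integral_weight_lty.
Qed.

(** The integrand of the scalar product is [F] itself, to which
[entire_weight_integral] applies. *)
Lemma ip_vacuum F : Hs F -> ip F vacuum = F 0 * mass%:C.
Proof.
move=> HF; have [s1 s2] := wintegrable_cross c0 (fock_L2 HF) (fock_L2 fock_vacuum).
have E1 : cross F vacuum = F by apply/funext => q; rewrite /cross /vacuum rmorph1 mulr1.
rewrite fock_ipE; rewrite E1 in s1 s2 *.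
have [-> ->] := entire_weight_integral HF.1 s1 s2.
by case: (F 0) => a b; apply/eqP; rewrite eq_complex /=; apply/andP; split; apply/eqP; ring.
Qed.

(** Conjugation makes this map isometric and turns the scalar product of [F] with
its image into the integral of an entire function. *)
Definition reflection (F : E -> C) : E -> C := fun q => conjc (F (- q.1, - q.2)).

Lemma entire_neg F : entire F -> entire (fun q => F (- q.1, - q.2)).
Proof.
move=> eF q.
have -> : (fun q : E => F (- q.1, - q.2)) = F \o ( *:%R (-1)).
  by apply/funext => -[z w] /=; rewrite -[_ *: (z, w)]/(_ *: z, _ *: w) !scaleN1r.
by apply: differentiable_comp; [exact: ex_diff|exact: eF].
Qed.

Lemma conj_continuous : continuous (@conjc R).
Proof.
move=> z; apply: (iffRL (@cvgrPdist_lt _ _ C (nbhs z) _ _ _)) => -[e e'].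
rewrite ltcE/= => /andP[/eqP -> e0].
apply: (iffRL (nearC _ _)); exists e => // w wz.
by rewrite distrC normCE ltcR -rmorphB normc_conj.
Qed.

Lemma L2_reflection F : Hs F -> L2 c l (reflection F) /\ normsq c l (reflection F) = normsq c l F.
Proof.
move=> HF; have cr : continuous (reflection F).
  move=> q; apply: continuous_comp; last exact: conj_continuous.
  exact: (entire_cont (entire_neg HF.1)).
have E0 : fock_sqnorm c l (reflection F) = fock_sqnorm c l F.
  have cc1 : (-1) ^+ 2 + 0 ^+ 2 = 1 :> R by rewrite expr0n addr0 sqrrN expr1n.
  rewrite /fock_sqnorm -[RHS](integral_preserves (preserves_rot4 n cc1)).
    apply: eq_integral => p _; rewrite pointC_rot4 /reflection normc_conj.
    rewrite weight_rot; last by rewrite /= sqrrN expr1n expr0n addr0 sqrtr1.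
    rewrite (_ : -1 +i* 0 = -1 :> C); last by rewrite -[-1 in RHS]/(-1 +i* (-0)) oppr0.
    by rewrite !scaleN1r.
  apply/measurable_EFinP; apply: measurable_funM; last exact: measurable_weight.
  by apply: measurable_normc_sqr; exact: entire_cont HF.1.
split; first by split=> //; rewrite E0; exact: HF.2.
by rewrite /normsq !fock_ip_diag E0.
Qed.

(** The mean value property for [F q * F (- q)]. *)
Lemma ip_reflection F : Hs F -> ip F (reflection F) = F 0 ^+ 2 * mass%:C.
Proof.
move=> HF; have [s1 s2] := wintegrable_cross c0 (fock_L2 HF) (L2_reflection HF).1.
have E1 : cross F (reflection F) = (fun q => F q * F (- q.1, - q.2)).
  by apply/funext => q; rewrite /cross /reflection conjcK.
rewrite fock_ipE; rewrite E1 in s1 s2 *.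
have eFF : entire (fun q => F q * F (- q.1, - q.2)).
  by move=> q; apply: differentiableM; [exact: HF.1|exact: entire_neg HF.1 _].
have [-> ->] := entire_weight_integral eFF s1 s2.
rewrite /= !oppr0 -[(0, 0)]/(0 : E) -expr2.
by case: (F 0 ^+ 2) => a b; apply/eqP; rewrite eq_complex /=; apply/andP; split; apply/eqP; ring.
Qed.

(** Write [F 0 = x + i y] and [m] for the total mass.  Since [F] and [reflection F]
have the same norm, expanding both sides with [ip_vacuum] and [ip_reflection]
leaves the difference [4 * y ^+ 2 * m]. *)
Lemma normsq_sub_value F : Hs F ->
  2 * normsq c l (F - (fun=> F 0)) <= normsq c l (F - reflection F).
Proof.
move=> HF; have LF := fock_L2 HF; have L1 := fock_L2 fock_vacuum.
have [Lr Nr] := L2_reflection HF.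
have -> : (fun=> F 0) = F 0 *: vacuum.
  by apply/funext => q; rewrite -[RHS]/(F 0 * 1) mulr1.
have LZ := L2Z c0 (F 0) L1.
rewrite (normsqB c0 LF LZ) (normsqB c0 LF Lr) Nr ip_reflection// ipZr// ip_vacuum//.
rewrite normsqZ// (_ : normsq c l vacuum = mass); last first.
  by rewrite /normsq (ip_vacuum fock_vacuum) /vacuum mul1r.
have m0 := mass_gt0 n c0 l0; move: (mass) m0 => m m0.
rewrite normc_sqr; case: (F 0) => a b /=.
have := mulr_ge0 (sqr_ge0 b) (ltW m0); nra.
Qed.

End reproducing.

(** * The representation *)

Section representation.
Context {R : realType} (n : nat).
Local Notation C := R[i].
Local Notation mR := (measurableTypeR R).
Local Notation Rn := (n.-tuple mR).
Local Notation T4 := ((Rn * Rn) * (Rn * Rn))%type.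
Local Notation E := ('rV[C]_n * 'rV[C]_n)%type.
Variables (c l : R).
Local Notation Hs := (fock_space n c l).
Local Notation ip := (fock_ip n c l).
Implicit Types (g h : heis n l) (q : E) (F G : E -> C).

(** The exponent of the multiplier of [rho g], central character included. *)
Definition phase g q : C :=
  - 'i * (g.2)%:C + (l / 2 * Im (dotc g.1.1 (conjv g.1.2)))%:C
  + (- (l / 4 * coth l * (sqnormv g.1.1 + sqnormv g.1.2)))%:C
  + - 'i * (l / 2)%:C * (dotc q.2 (conjv g.1.1) - dotc q.1 (conjv g.1.2))
  + (l / 2 * coth l)%:C * (dotc q.1 (conjv g.1.1) + dotc q.2 (conjv g.1.2)).

Lemma rhoE g F q :
  rho g F q = cexp (phase g q) * F (q.1 - g.1.1, q.2 - g.1.2).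
Proof.
case: g q => [[a b] t] [z w]; rewrite /phase /= !cexpD !cexp_real.
by rewrite -[LHS]/(cexp (- 'i * t%:C) * rho2 l a b F (z, w)) /rho2 !mulrA.
Qed.

(** The cocycle identity, for which the last two terms of the group law are made. *)
Lemma phase_mul g h q :
  phase (g * h)%g q = phase g q + phase h (q.1 - g.1.1, q.2 - g.1.2).
Proof.
case: g h q => [[a b] t] [[a' b'] t'] [z w].
rewrite /phase /= /sqnormv !conjvD !(dotcDl, dotcDr, dotcNl).
rewrite (dotc_conjC a a') (dotc_conjC b b') (dotc_conjC b a').
move: (dotc a (conjv a)) (dotc b (conjv b)) (dotc a' (conjv a')) (dotc b' (conjv b')).
move: (dotc a (conjv b)) (dotc a' (conjv b')) (dotc a (conjv a')) (dotc b (conjv b')).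
move: (dotc a (conjv b')) (dotc b (conjv a')).
move: (dotc z (conjv a)) (dotc z (conjv b)) (dotc z (conjv a')) (dotc z (conjv b')).
move: (dotc w (conjv a)) (dotc w (conjv b)) (dotc w (conjv a')) (dotc w (conjv b')).
move=> [? ?] [? ?] [? ?] [? ?] [? ?] [? ?] [? ?] [? ?] [? ?] [? ?].
move=> [? ?] [? ?] [? ?] [? ?] [? ?] [? ?] [? ?] [? ?].
apply/eqP; rewrite eq_complex /=; apply/andP; split; apply/eqP; by field.
Qed.

Lemma rhoM g h F : rho (g * h)%g F = rho g (rho h F).
Proof.
apply/funext => q; rewrite !rhoE phase_mul cexpD -mulrA.
congr (_ * (_ * F _)); case: g h => [[a b] t] [[a' b'] t'] /=.
by rewrite !opprD !addrA.
Qed.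

Lemma phase1 q : phase 1%g q = 0.
Proof.
rewrite /phase /= /sqnormv !conjv0 !dotc0r /= !addr0 !subr0 !mulr0.
by rewrite !rmorphN !rmorph0 oppr0 !addr0.
Qed.

Lemma rho1 F : rho (1%g : heis n l) F = F.
Proof.
apply/funext => -[z w]; rewrite rhoE phase1 cexp0 mul1r /=.
by rewrite !subr0.
Qed.

Lemma rho_linear g k F G : rho g (k *: F + G) = k *: rho g F + rho g G.
Proof.
apply/funext => q; rewrite -[RHS]/(k * rho g F q + rho g G q) !rhoE.
by rewrite -[(k *: F + G) _]/(k * F _ + G _) mulrDr mulrCA.
Qed.

(** The real part of [phase g q] is half the increment of the exponent of the weight
from [q] to [q - g]. *)
Lemma phase_weight g q : normc (cexp (phase g q)) ^+ 2 * fock_weight c l q =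
  fock_weight c l (q.1 - g.1.1, q.2 - g.1.2).
Proof.
case: g q => [[a b] t] [z w].
rewrite normc_cexp -expRM_natl /fock_weight /phase /=; move: (coth l) => K.
rewrite [LHS]mulrC -!mulrA; congr (c * _); rewrite -!expRD; congr expR.
rewrite /sqnormv !conjvD !conjvN !(dotcDl, dotcDr, dotcNl, dotcNr).
rewrite (dotc_conjC z a) (dotc_conjC w b) (dotc_conjC w a).
move: (dotc a (conjv a)) (dotc b (conjv b)) (dotc a (conjv b)).
move: (dotc z (conjv z)) (dotc w (conjv w)) (dotc z (conjv w)).
move: (dotc z (conjv a)) (dotc z (conjv b)) (dotc w (conjv a)) (dotc w (conjv b)).
move=> [? ?] [? ?] [? ?] [? ?] [? ?] [? ?] [? ?] [? ?] [? ?] [? ?] /=.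
by field.
Qed.

Lemma cross_rho g F G q :
  cross (rho g F) (rho g G) q * (fock_weight c l q)%:C =
  cross F G (q.1 - g.1.1, q.2 - g.1.2)
    * (fock_weight c l (q.1 - g.1.1, q.2 - g.1.2))%:C.
Proof.
rewrite -phase_weight /cross !rhoE.
set k := cexp _; set u := F _; set v := G _.
have -> : conjc (k * v) = conjc k * conjc v by rewrite rmorphM.
have -> : (normc k ^+ 2 * fock_weight c l q)%:C =
    k * conjc k * (fock_weight c l q)%:C :> C.
  rewrite rmorphM; congr (_ * _); rewrite normc_sqr; case: (k) => x y.
  by apply/eqP; rewrite eq_complex /=; apply/andP; split; apply/eqP; ring.
by ring.
Qed.

Hypotheses (c0 : 0 < c) (l0 : l != 0).
Local Notation mu := (@lebesgue_C2n R n).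

Let shiftg g : T4 -> T4 := shift4 (coordC (- g.1.1, - g.1.2)).

Let pointC_shiftg g p : pointC (shiftg g p) =
  ((pointC p).1 - g.1.1, (pointC p).2 - g.1.2).
Proof. by rewrite /shiftg pointC_shift4 coordCK. Qed.

Let shiftgP g : preserves mu (shiftg g).
Proof. exact: preserves_shift4. Qed.

Lemma entire_shift F (a b : 'rV[C]_n) : entire F ->
  entire (fun q => F (q.1 - a, q.2 - b)).
Proof.
move=> eF q.
have -> : (fun q : E => F (q.1 - a, q.2 - b)) = F \o (fun q => q + (- (a, b))).
  by apply/funext => -[z w].
by apply: differentiable_comp; [apply: differentiableD|exact: eF].
Qed.

Lemma entire_dotc (f : E -> 'rV[C]_n) (k : 'rV[C]_n) :
  (forall j, entire (fun q => f q 0 j)) -> entire (fun q => dotc (f q) k).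
Proof.
move=> ef q.
have -> : (fun q => dotc (f q) k) = \sum_(j < n) (fun q => f q 0 j * k 0 j).
  by apply/funext => p; rewrite /dotc fct_sumE.
apply: differentiable_sum => j; apply: differentiableM => //; exact: ef.
Qed.

(** The projection is packaged as a linear map because a continuous linear map is
differentiable over [R[i]]. *)
Lemma entire_coord1 j : entire (fun q : E => q.1 0 j).
Proof.
move=> q; have lin : linear (fun q : E => q.1) by move=> k [a b] [x y].
pose M := GRing.isLinear.Build _ _ _ _ _ lin.
pose L : {linear E -> 'rV[C]_n} := HB.pack (fun q : E => q.1) M.
apply: (@differentiable_comp _ _ _ _ L (fun z : 'rV[C]_n => z 0 j)).
  by apply: linear_differentiable => -[a b]; exact: cvg_fst.
exact: differentiable_coord.
Qed.

Lemma entire_coord2 j : entire (fun q : E => q.2 0 j).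
Proof.
move=> q; have lin : linear (fun q : E => q.2) by move=> k [a b] [x y].
pose M := GRing.isLinear.Build _ _ _ _ _ lin.
pose L : {linear E -> 'rV[C]_n} := HB.pack (fun q : E => q.2) M.
apply: (@differentiable_comp _ _ _ _ L (fun z : 'rV[C]_n => z 0 j)).
  by apply: linear_differentiable => -[a b]; exact: cvg_snd.
exact: differentiable_coord.
Qed.

Lemma entireM F G : entire F -> entire G -> entire (fun q => F q * G q).
Proof. by move=> eF eG q; apply: differentiableM. Qed.

Lemma entireD F G : entire F -> entire G -> entire (fun q => F q + G q).
Proof. by move=> eF eG q; apply: differentiableD. Qed.

Lemma entireB F G : entire F -> entire G -> entire (fun q => F q - G q).
Proof. by move=> eF eG q; apply: differentiableB. Qed.

Lemma entire_cexp F : entire F -> entire (fun q => cexp (F q)).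
Proof.
by move=> eF q; apply: (@differentiable_comp _ _ _ _ F); last exact: differentiable_cexp.
Qed.

Lemma entire_phase g : entire (phase g).
Proof.
rewrite /phase; apply: entireD.
  apply: entireD; first exact: entire_cst.
  apply: entireM; first exact: entire_cst.
  by apply: entireB; apply: entire_dotc => j;
    [exact: entire_coord2|exact: entire_coord1].
apply: entireM; first exact: entire_cst.
by apply: entireD; apply: entire_dotc => j;
    [exact: entire_coord1|exact: entire_coord2].
Qed.

Lemma entire_rho g F : entire F -> entire (rho g F).
Proof.
move=> eF; have -> : rho g F = (fun q => cexp (phase g q) * F (q.1 - g.1.1, q.2 - g.1.2)).
  by apply/funext => q; exact: rhoE.
by apply: entireM; [apply: entire_cexp; exact: entire_phase|exact: entire_shift].
Qed.

Lemma fock_rho g F : Hs F -> Hs (rho g F).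
Proof.
move=> HF; split; first exact: entire_rho HF.1.
suff -> : fock_sqnorm c l (rho g F) = fock_sqnorm c l F by exact: HF.2.
rewrite /fock_sqnorm -[RHS](integral_preserves (shiftgP g)).
  apply: eq_integral => p _; rewrite pointC_shiftg rhoE Normc.normcM.
  by rewrite exprMn mulrAC phase_weight mulrC.
apply/measurable_EFinP; apply: measurable_funM; last exact: measurable_weight.
by apply: measurable_normc_sqr; exact: entire_cont HF.1.
Qed.

Lemma weight_integral_rho g (f : E -> R) (u : E -> R) :
  measurable_fun setT (fun p : T4 => f (pointC p)) ->
  (forall q, u q * fock_weight c l q = f (q.1 - g.1.1, q.2 - g.1.2)
    * fock_weight c l (q.1 - g.1.1, q.2 - g.1.2)) ->
  weight_integral c l u = weight_integral c l f.
Proof.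
move=> mf uf; rewrite /weight_integral /Rintegral; congr fine.
rewrite -[RHS](integral_preserves (shiftgP g)).
  by apply: eq_integral => p _; rewrite pointC_shiftg uf.
by apply/measurable_EFinP; apply: measurable_funM => //; exact: measurable_weight.
Qed.

Lemma ip_rho g F G : Hs F -> Hs G -> ip (rho g F) (rho g G) = ip F G.
Proof.
move=> HF HG; rewrite !fock_ipE.
have [mR mI] := measurable_cross (entire_cont HF.1) (entire_cont HG.1).
congr (_ +i* _); apply: (weight_integral_rho (g := g)) => // q; have := cross_rho g F G q.
  by case: (cross _ _ _) => x y; case: (cross _ _ _) => x' y' /= [+ _]; rewrite !mulr0 !subr0.
by case: (cross _ _ _) => x y; case: (cross _ _ _) => x' y' /= [_]; rewrite !mulr0 !add0r.
Qed.

Lemma rho_unitary : unitary_representation Hs ip (fun g : heis n l => rho g).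
Proof.
split; last 2 first.
- by move=> F _; exact: rho1.
- by move=> g h F _; exact: rhoM.
move=> g; split.
- exact: fock_rho.
- move=> F HF; exists (rho (g^-1)%g F); first exact: fock_rho.
  by rewrite -rhoM mulgV rho1.
- by move=> k F G _ _; exact: rho_linear.
- exact: ip_rho.
Qed.

End representation.

(** * Strong continuity *)

Section strong_continuity.
Context {R : realType} (n : nat).
Local Notation C := R[i].
Local Notation E := ('rV[C]_n * 'rV[C]_n)%type.
Variables (c l : R).
Hypotheses (c0 : 0 < c) (l0 : l != 0).
Local Notation Hs := (fock_space n c l).
Local Notation ip := (fock_ip n c l).

Lemma cvg_dotc (u v : nat -> 'rV[C]_n) (a b : 'rV[C]_n) :
  u @ \oo --> a -> v @ \oo --> b -> dotc (u k) (v k) @[k --> \oo] --> dotc a b.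
Proof.
move=> ua vb; rewrite /dotc; apply: cvg_big => [|j _].
  exact: add_continuous.
apply: cvgM.
  exact: (cvg_comp _ _ ua (@coord_continuous _ _ _ 0 j a)).
exact: (cvg_comp _ _ vb (@coord_continuous _ _ _ 0 j b)).
Qed.

Lemma cvg_conjv (u : nat -> 'rV[C]_n) (a : 'rV[C]_n) :
  u @ \oo --> a -> conjv (u k) @[k --> \oo] --> conjv a.
Proof.
move=> ua; apply: cvg_rV => j; rewrite mxE; under eq_fun do rewrite mxE.
have uj := cvg_comp _ _ ua (@coord_continuous _ _ _ 0 j a).
exact: (cvg_comp _ _ uj (@conj_continuous R (a 0 j))).
Qed.

Lemma cvg_realC (a : nat -> R) (x : R) :
  a @ \oo --> x -> (a k)%:C @[k --> \oo] --> (x%:C : C).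
Proof. by move=> ax; apply: cvg_complex => //; exact: cvg_cst. Qed.

Lemma cvg_Re (a : nat -> C) (x : C) :
  a @ \oo --> x -> Re (a k) @[k --> \oo] --> Re x.
Proof. by move=> ax; exact: (cvg_comp _ _ ax (@Re_continuous R x)). Qed.

Lemma cvg_Im (a : nat -> C) (x : C) :
  a @ \oo --> x -> Im (a k) @[k --> \oo] --> Im x.
Proof. by move=> ax; exact: (cvg_comp _ _ ax (@Im_continuous R x)). Qed.

Lemma cvg_rho (h : nat -> heis n l) (g : heis n l) (F : E -> C) q :
  continuous F ->
  (h k).1.1 @[k --> \oo] --> g.1.1 -> (h k).1.2 @[k --> \oo] --> g.1.2 ->
  (h k).2 @[k --> \oo] --> g.2 ->
  rho (h k) F q @[k --> \oo] --> rho g F q.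
Proof.
move=> cF h1 h2 h3; rewrite rhoE; under eq_fun do rewrite rhoE.
have d11 := cvg_dotc h1 (cvg_conjv h1); have d22 := cvg_dotc h2 (cvg_conjv h2).
have d12 := cvg_dotc h1 (cvg_conjv h2).
have e1 (z : 'rV[C]_n) := cvg_dotc (cvg_cst z) (cvg_conjv h1).
have e2 (z : 'rV[C]_n) := cvg_dotc (cvg_cst z) (cvg_conjv h2).
apply: cvgM.
  apply: (cvg_comp (fun k => phase (h k) q) (@cexp R)); last first.
    exact: differentiable_continuous (differentiable_cexp _).
  rewrite /phase; apply: cvgD; last first.
    by apply: cvgM; [exact: cvg_cst|apply: cvgD; [exact: e1|exact: e2]].
  apply: cvgD; last first.
    by apply: cvgM; [exact: cvg_cst|apply: cvgB; [exact: e1|exact: e2]].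
  apply: cvgD; last first.
    apply: cvg_realC; apply: cvgN; apply: cvgM; first exact: cvg_cst.
    by apply: cvgD; [exact: cvg_Re d11|exact: cvg_Re d22].
  apply: cvgD.
    by apply: cvgM; [exact: cvg_cst|exact: cvg_realC].
  by apply: cvg_realC; apply: cvgM; [exact: cvg_cst|exact: cvg_Im d12].
have hq : (q.1 - (h k).1.1, q.2 - (h k).1.2) @[k --> \oo] --> (q.1 - g.1.1, q.2 - g.1.2).
  have b1 : q.1 - (h k).1.1 @[k --> \oo] --> q.1 - g.1.1.
    exact: (cvgB (cvg_cst q.1) h1).
  have b2 : q.2 - (h k).1.2 @[k --> \oo] --> q.2 - g.1.2.
    exact: (cvgB (cvg_cst q.2) h2).
  exact: (cvg_pair b1 b2).
exact: (cvg_comp _ _ hq (cF _)).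
Qed.

(** The group is first countable, so a property of the points near [g] can be tested on
sequences, to which Fatou's lemma applies. *)
Lemma heis_seq (g : heis n l) (P : heis n l -> Prop) :
  (forall h : nat -> heis n l, 
    (h k).1.1 @[k --> \oo] --> g.1.1 -> (h k).1.2 @[k --> \oo] --> g.1.2 ->
    (h k).2 @[k --> \oo] --> g.2 -> exists k, P (h k)) ->
  \forall h \near g, P h.
Proof.
move=> hP; apply: contrapT => nP.
pose e k : R := k.+1%:R^-1.
have e0 k : 0 < e k by rewrite invr_gt0.
have eC0 k : 0 < (e k)%:C :> C by rewrite ltcR.
have ex k : exists h : heis n l, [/\ ball g.1.1 (e k)%:C h.1.1, ball g.1.2 (e k)%:C h.1.2,
    ball g.2 (e k) h.2 & ~ P h].
  apply: contrapT => nex; apply: nP.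
  have : \forall h \near (g : 'rV[C]_n * 'rV[C]_n * R),
     ball g.1.1 (e k)%:C h.1.1 /\ ball g.1.2 (e k)%:C h.1.2 /\ ball g.2 (e k) h.2.
    case: g {hP nex} => [[a b] t].
    exists ([set x | ball a (e k)%:C x.1 /\ ball b (e k)%:C x.2], ball t (e k)) => /=.
      split=> /=; last exact: nbhsx_ballx.
      exists (ball a (e k)%:C, ball b (e k)%:C) => /=; last by move=> [x y].
      by split; exact: nbhsx_ballx.
    by move=> [[x y] s] /= [[? ?] ?].
  apply: filterS => h [h1 [h2 h3]]; apply: contrapT => nPh; apply: nex.
  by exists (h : heis n l); split; [exact: h1|exact: h2|exact: h3|exact: nPh].
have [h hh] := choice ex.
have small (d : R) : 0 < d -> \forall k \near \oo, e k < d.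
  move=> d0; have /cvgrPdist_lt/(_ d d0) := @cvg_harmonic R.
  apply: filterS => k; rewrite sub0r normrN ger0_norm ?invr_ge0//.
have [] // := hP h.
- apply/cvg_ballP => -[d d']; rewrite ltcE/= => /andP[/eqP -> d0].
  have := small d d0; apply: filterS => k kd.
  have [hk _ _ _] := hh k; apply: le_ball hk.
  by rewrite lecR ltW.
- apply/cvg_ballP => -[d d']; rewrite ltcE/= => /andP[/eqP -> d0].
  have := small d d0; apply: filterS => k kd.
  have [_ hk _ _] := hh k; apply: le_ball hk.
  by rewrite lecR ltW.
- apply/cvg_ballP => d d0.
  have := small d d0; apply: filterS => k kd.
  have [_ _ hk _] := hh k; apply: le_ball hk.
  by rewrite ltW.
by move=> k Pk; have [_ _ _] := hh k.
Qed.

(** By contradiction, along a sequence on which [rho (h k) F - rho g F] has norm at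
least [e]: the parallelogram law bounds the squared norms of the sums away from
[4 * |F|^2], which is the squared norm of their pointwise limit. *)
Lemma rho_strongly_continuous :
  strongly_continuous Hs ip (fun g : heis n l => rho g).
Proof.
move=> F HF g; apply/cvgrPdist_lt => e e0.
apply: heis_seq => h h1 h2 h3; apply: contrapT => nex.
pose a k := rho (h k) F; pose b := rho g F.
have La k : L2 c l (a k) by apply: fock_L2; exact: fock_rho.
have Lb : L2 c l b by apply: fock_L2; exact: fock_rho.
have Na k : normsq c l (a k) = normsq c l F by rewrite /normsq /a ip_rho.
have Nb : normsq c l b = normsq c l F by rewrite /normsq /b ip_rho.
have ge k : e ^+ 2 <= normsq c l (a k - b).
  rewrite -(@hnorm_sqr R n c l c0) lerXn2r// ?nnegrE ?(ltW e0) ?hnorm_ge0//.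
  rewrite leNgt; apply/negP => lt; apply: nex; exists k.
  by rewrite sub0r normrN ger0_norm// hnorm_ge0.
have le k : normsq c l (a k + b) <= 4 * normsq c l F - e ^+ 2.
  have := ge k; rewrite (normsqB c0 (La k) Lb) (normsqD c0 (La k) Lb) Na Nb; lra.
have pw q : (a k + b) q @[k --> \oo] --> (b + b) q.
  apply: cvgD; last exact: cvg_cst.
  by apply: cvg_rho => //; exact: entire_cont HF.1.
have Lab k := L2D c0 (La k) Lb.
have [] := fatou_L2 c0 Lab (L2D c0 Lb Lb).1 le pw.
rewrite (normsqD c0 Lb Lb) -/(normsq c l b) Nb => _.
have := exprn_gt0 2 e0; lra.
Qed.

End strong_continuity.

(** * Irreducibility *)

Section invariant_subspace.
Context {R : realType} (n : nat).
Local Notation C := R[i].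
Local Notation E := ('rV[C]_n * 'rV[C]_n)%type.
Variables (c l : R).
Hypotheses (c0 : 0 < c) (l0 : l != 0).
Local Notation Hs := (fock_space n c l).
Local Notation ip := (fock_ip n c l).
Local Notation mass := (weight_integral c l (fun _ : E => 1)).
Local Notation vacuum := (@vacuum R n).
Local Notation hn := (hnorm ip).
Let hsq F : hn F ^+ 2 = normsq c l F. Proof. exact: hnorm_sqr. Qed.

Lemma normcB_le (z w : C) : normc (z - w) <= normc z + normc w.
Proof.
by apply: (le_trans (le_normcD _ _)); rewrite -[- w]sub0r (normcB 0) subr0.
Qed.

(** Used with [w = <rho g u, u>] for a [u] close to the projection of [vacuum]: both
differences on the right are then small. *)
Lemma conj_balance (r : R) (x y w : C) :
  r%:C * (x - conjc y) = (r%:C * x - w) - conjc (r%:C * y - conjc w).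
Proof.
case: x y w => x1 x2 [y1 y2] [w1 w2].
by apply/eqP; rewrite eq_complex /=; apply/andP; split; apply/eqP; ring.
Qed.

Let a (k : nat) : R := k.+1%:R^-1.

Let a_gt0 k : 0 < a k. Proof. by rewrite invr_gt0. Qed.

Let a_le k j : (k <= j)%N -> a j <= a k.
Proof. by move=> kj; rewrite lef_pV2 ?posrE// ler_nat. Qed.

Let a_small (e : R) : 0 < e -> exists k, a k < e.
Proof.
move=> e0; have /cvgrPdist_lt/(_ e e0)[k _ h] := @cvg_harmonic R.
exists k; have := h k (leqnn k); rewrite /= sub0r normrN ger0_norm ?invr_ge0//.
Qed.

Let a_cvg (K : R) : K * a k @[k --> \oo] --> (0 : R).
Proof. by rewrite -[X in _ --> X](mulr0 K); apply: cvgMr; exact: cvg_harmonic. Qed.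

(** Apply Fatou's lemma to [u k - u (j + k)] as [j] grows. *)
Lemma cauchy_limit (u : nat -> E -> C) (F : E -> C) (K : R) : 0 <= K ->
  (forall k, L2 c l (u k)) -> L2 c l F ->
  (forall j k, hn (u j - u k) <= K * (a j + a k)) ->
  (forall q, u k q @[k --> \oo] --> F q) ->
  forall k, hn (u k - F) <= K * (2 * a k).
Proof.
move=> K0 Lu LF cu pw k.
have Ka0 : 0 <= K * (2 * a k) by rewrite mulr_ge0// mulr_ge0// ltW.
have Lw j : L2 c l (u k - u (j + k)%N) by exact: L2B.
have Nw j : normsq c l (u k - u (j + k)%N) <= (K * (2 * a k)) ^+ 2.
  rewrite -hsq lerXn2r ?nnegrE ?hnorm_ge0//; apply: (le_trans (cu _ _)).
  rewrite ler_wpM2l//; have := a_le (leq_addl j k); lra.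
have LkF := L2B c0 (Lu k) LF.
have pwk q : (u k - u (j + k)%N) q @[j --> \oo] --> (u k - F) q.
  apply: cvgB; first exact: cvg_cst.
  by have := pw q; rewrite -(cvg_shiftn k).
have [_ h] := fatou_L2 c0 Lw LkF.1 Nw pwk.
by rewrite -(@ler_pXn2r _ 2) ?nnegrE ?hnorm_ge0// hsq.
Qed.

Section closed_subspace.
Variable M : set (E -> C).
Hypotheses (MH : M `<=` Hs) (Msub : Defs.subspace M).

Let ML2 v : M v -> L2 c l v. Proof. by move=> /MH; exact: fock_L2. Qed.

Let MZ (k : C) v : M v -> M (k *: v).
Proof.
by move=> Mv; have [M0 MS] := Msub; have := MS k v 0 Mv M0; rewrite addr0.
Qed.

Let MD u v : M u -> M v -> M (u + v).
Proof.
by move=> Mu Mv; have [M0 MS] := Msub; have := MS 1 u v Mu Mv; rewrite scale1r.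
Qed.

Let MB u v : M u -> M v -> M (u - v).
Proof. by move=> Mu Mv; rewrite -scaleN1r; apply: MD => //; exact: MZ. Qed.

(** Choose [u k] in [M] almost minimising the distance to [f].  A vector [f - u k]
with a large component along some [v] in [M] could be shortened by subtracting a
multiple of [v]. *)
Lemma near_orthogonal (f : E -> C) : L2 c l f ->
  exists u : nat -> E -> C, forall k, M (u k) /\
    forall v, M v -> normc (ip v (f - u k)) <= a k * hn v.
Proof.
move=> Lf; pose S : set R := [set normsq c l (f - u) | u in M].
have S0 : S !=set0 by exists (normsq c l (f - 0)); exists 0 => //; have [] := Msub.
have Slb : lbound S 0 by move=> _ [u _ <-]; exact: normsq_ge0.
have hS : has_inf S by split => //; exists 0.
pose d := inf S.
have dN u : M u -> d <= normsq c l (f - u).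
  by move=> Mu; apply: ge_inf; [exists 0|exists u].
suff ex k : exists u, M u /\ forall v, M v -> normc (ip v (f - u)) <= a k * hn v.
  by have [u uP] := choice ex; exists u.
have e0 : 0 < a k ^+ 2 by rewrite exprn_gt0.
have [_ [u Mu <-] ud] := inf_adherent e0 hS.
exists u; split=> // v Mv; have Lu := ML2 Mu; have Lv := ML2 Mv.
have Lfu := L2B c0 Lf Lu.
set z := ip v (f - u); pose q := normc z ^+ 2.
have key (s : R) : 0 <= a k ^+ 2 - 2 * s * q + s ^+ 2 * q * normsq c l v.
  have Mw : M (u + (s%:C * conjc z) *: v) by apply: MD => //; exact: MZ.
  have := dN _ Mw; rewrite opprD addrA.
  rewrite (normsqB c0 Lfu (L2Z c0 _ Lv)) (normsqZ c0 _ Lv) (ipZr c0 _ Lv Lfu).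
  rewrite (ip_conj c0 Lv Lfu) -/z Normc.normcM normc_real normc_conj exprMn.
  rewrite real_normK ?num_real// -/q.
  rewrite (_ : Re _ = s * q); last first.
    by rewrite /q normc_sqr; case: (z) => x y /=; ring.
  move: ud; rewrite -/d; lra.
rewrite -(@ler_pXn2r _ 2) ?nnegrE ?normc_ge0 ?mulr_ge0 ?hnorm_ge0 ?(ltW (a_gt0 k))//.
rewrite exprMn hsq -/q.
have [v0|v0] := eqVneq (normsq c l v) 0.
  by rewrite v0 mulr0; have := cauchy_schwarz c0 Lv Lfu; rewrite v0 mul0r.
have vp : 0 < normsq c l v by rewrite lt_neqAle eq_sym v0 normsq_ge0.
have := key (normsq c l v)^-1.
rewrite (_ : _ + _ = (a k ^+ 2 * normsq c l v - q) / normsq c l v); last by field.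
by rewrite pmulr_lge0 ?invr_gt0// subr_ge0.
Qed.

(** The vector [v = u j - u k] lies in [M] and is the difference of two vectors that
are nearly orthogonal to it. *)
Lemma near_orthogonal_cauchy (f : E -> C) (u : nat -> E -> C) : L2 c l f ->
  (forall k, M (u k) /\ forall v, M v -> normc (ip v (f - u k)) <= a k * hn v) ->
  forall j k, hn (u j - u k) <= 1 * (a j + a k).
Proof.
move=> Lf uP j k; rewrite mul1r.
have [Mj hj] := uP j; have [Mk hk] := uP k.
have Mv := MB Mj Mk; set v := u j - u k in Mv *.
have [Lj Lk Lv] := And3 (ML2 Mj) (ML2 Mk) (ML2 Mv).
have [v0|v0] := eqVneq (hn v) 0; first by rewrite v0 addr_ge0// ltW.
have vp : 0 < hn v by rewrite lt_neqAle eq_sym v0 hnorm_ge0.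
rewrite -(ler_pM2r vp) -expr2 hsq mulrDl.
have E : ip v v = ip v (f - u k) - ip v (f - u j).
  rewrite -(ipBr c0 _ _ Lv); [|exact: L2B|exact: L2B].
  by rewrite opprB addrC addrA subrK.
rewrite /normsq E; apply: (le_trans (ler_norm _)); apply: (le_trans (normc_Re _)).
apply: (le_trans (normcB_le _ _)); rewrite addrC lerD//; first exact: hj.
exact: hk.
Qed.

End closed_subspace.

Definition to_origin (q : E) : heis n l := (- q.1, - q.2, 0).

(** The modulus of the multiplier of [rho (to_origin q)] at the origin, where that
multiplier is in fact a positive number ([cexp_to_origin]). *)
Definition eval_factor (q : E) : R := normc (cexp (phase (to_origin q) 0)).

Lemma eval_factor_gt0 q : 0 < eval_factor q.
Proof. by rewrite /eval_factor normc_cexp expR_gt0. Qed.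

Lemma cexp_to_origin q : cexp (phase (to_origin q) 0) = (eval_factor q)%:C.
Proof.
rewrite /eval_factor normc_cexp -cexp_real; congr cexp.
rewrite /phase /= !dotc0l !addr0 !subr0 !mulr0 !addr0.
by apply/eqP; rewrite eq_complex /=; apply/andP; split; apply/eqP; ring.
Qed.

Lemma eval_factorN q : eval_factor (- q.1, - q.2) = eval_factor q.
Proof.
rewrite /eval_factor !normc_cexp; congr expR.
rewrite /phase /= /sqnormv !dotc0l !conjvN !dotcNl !dotcNr !opprK.
by [].
Qed.

(** Evaluate [rho (to_origin q) w] at the origin, using [ip_vacuum]. *)
Lemma ip_rho_vacuum w q : Hs w ->
  ip (rho (to_origin q) w) vacuum = (eval_factor q * mass)%:C * w q.
Proof.
move=> Hw; rewrite (ip_vacuum c0 l0 (fock_rho _ Hw)) rhoE cexp_to_origin.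
rewrite /= !sub0r !opprK rmorphM; case: q => z u /=; ring.
Qed.

Lemma to_origin_inv q : ((to_origin q)^-1)%g = to_origin (- q.1, - q.2).
Proof.
case: q => z u; rewrite /to_origin /=.
by rewrite -[LHS]/((- - z, - - u, - 0) : heis n l) oppr0.
Qed.

Lemma fockB F G : Hs F -> Hs G -> Hs (F - G).
Proof.
move=> HF HG; split; first exact: entireB HF.1 HG.1.
by have [] := L2B c0 (fock_L2 HF) (fock_L2 HG).
Qed.

Lemma hnorm_scale (k : C) F : L2 c l F -> hn (k *: F) = normc k * hn F.
Proof.
move=> LF; rewrite /hnorm -!/(normsq c l _) normsqZ// sqrtrM ?exprn_ge0 ?normc_ge0//.
by rewrite sqrtr_sqr ger0_norm// normc_ge0.
Qed.

Lemma hnorm_rho (g : heis n l) w : Hs w -> hn (rho g w) = hn w.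
Proof. by move=> Hw; rewrite /hnorm ip_rho. Qed.

Lemma ip_rhoV (g : heis n l) F G : Hs F -> Hs G ->
  ip (rho g^-1%g F) G = ip F (rho g G).
Proof.
move=> HF HG; have := ip_rho g (fock_rho g^-1%g HF) HG.
by rewrite -rhoM mulgV rho1 => <-.
Qed.

(** Cauchy-Schwarz applied to [ip_rho_vacuum]. *)
Lemma point_evaluation w q : Hs w ->
  eval_factor q * mass * normc (w q) <= hn w * hn vacuum.
Proof.
move=> Hw; have m0 := mass_gt0 n c0 l0; have g0 := eval_factor_gt0 q.
have := hnorm_cauchy_schwarz c0 (fock_L2 (fock_rho (to_origin q) Hw)) (fock_L2 (fock_vacuum n c0 l0)).
rewrite hnorm_rho// ip_rho_vacuum// Normc.normcM normc_real ger0_norm//.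
by rewrite mulr_ge0// ltW.
Qed.

Section irreducible.
Variable M : set (E -> C).
Hypotheses (MH : M `<=` Hs) (Msub : Defs.subspace M).
Hypothesis Mcl : closed_in Hs ip M.
Hypothesis Minv : forall (g : heis n l) v, M v -> M (rho g v).

Let m0 : 0 < mass. Proof. exact: mass_gt0. Qed.
Let L1 : L2 c l vacuum. Proof. exact: fock_L2 (fock_vacuum n c0 l0). Qed.

Lemma closed_limit (u : nat -> E -> C) F (K : R) : Hs F -> 0 <= K ->
  (forall k, M (u k)) -> (forall k, hn (u k - F) <= K * a k) -> M F.
Proof.
move=> HF K0 Mu uF; apply: Mcl => // e e0.
have [k ke] := a_small (divr_gt0 e0 (ltr_pwDr ltr01 K0)).
exists (u k) => //.
have -> : hn (F - u k) = hn (u k - F).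
  have Lk := fock_L2 (MH (Mu k)); have LF := fock_L2 HF.
  rewrite /hnorm -!/(normsq c l _) !(normsqB c0)// (ip_conj c0 Lk LF) Defs.Re_conj.
  by congr (Num.sqrt (_ - _)); rewrite addrC.
apply: (le_lt_trans (uF k)); move: ke; rewrite ltr_pdivlMr ?ltr_pwDr//.
by have := a_gt0 k; nra.
Qed.

(** Approximate [F] by near-projections [u k] on [M].  The orbit of [vacuum] lies in
[M], so [F - u k] is nearly orthogonal to it, which means that [F - u k] is
pointwise small.  The Cauchy sequence [u] therefore converges to [F]. *)
Lemma vacuum_generates : M vacuum -> M = Hs.
Proof.
move=> M1; apply/seteqP; split=> // F HF; have LF := fock_L2 HF.
have [u uP] := near_orthogonal MH Msub LF.
have Mu k : M (u k) by have [] := uP k.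
have Lu k : L2 c l (u k) by apply: fock_L2; exact: MH.
apply: (@closed_limit u F 2) => // k.
rewrite -[2 * _]mul1r; apply: (@cauchy_limit u F 1) => //.
  exact: (near_orthogonal_cauchy MH Msub LF uP).
move=> q; apply/cvgrPdist_le => -[e e']; rewrite ltcE /= => /andP[/eqP -> e0].
pose K := hn vacuum / (eval_factor q * mass).
have /cvgrPdist_le/(_ e e0) := a_cvg K.
apply: filterS => j; rewrite sub0r normrN => aj.
rewrite normCE lecR; apply: le_trans aj.
have g0 := eval_factor_gt0 q; have gm0 : 0 < eval_factor q * mass by exact: mulr_gt0.
rewrite ger0_norm; last by rewrite mulr_ge0 ?divr_ge0 ?hnorm_ge0 ?(ltW gm0) ?(ltW (a_gt0 j)).
rewrite /K mulrAC ler_pdivlMr// mulrC.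
have HFu : Hs (F - u j) by apply: fockB => //; exact: MH.
have [_ /(_ (rho (to_origin q)^-1%g vacuum) (Minv _ M1))] := uP j.
rewrite hnorm_rho; last exact: fock_vacuum.
have -> : ip (rho (to_origin q)^-1%g vacuum) (F - u j) =
   conjc (ip (rho (to_origin q) (F - u j)) vacuum).
  rewrite -(ip_conj c0); [|exact: fock_L2 (fock_rho _ HFu)|exact: L1].
  exact: ip_rhoV (fock_vacuum n c0 l0) HFu.
rewrite normc_conj ip_rho_vacuum// Normc.normcM normc_real ger0_norm ?(ltW gm0)//.
by rewrite [a j * _]mulrC.
Qed.

(** The near-projections [u k] of [vacuum] on [M] satisfy, up to an error tending
to [0], the symmetry [u k q = conj (u k (- q))] of the exact projection.  Hence
[u k - reflection (u k)], a Cauchy sequence tending pointwise to [0], tends to [0]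
in norm, and by [normsq_sub_value] so does [u k - u k 0].  Pairing with [v] shows
that [u k 0] tends to [1]. *)
Lemma vacuum_mem v : M v -> v 0 <> 0 -> M vacuum.
Proof.
move=> Mv v0; have [u uP] := near_orthogonal MH Msub L1.
have Mu k : M (u k) by have [] := uP k.
have Hu k := MH (Mu k); have Lu k := fock_L2 (Hu k).
have cu := near_orthogonal_cauchy MH Msub L1 uP.
pose B := hn (u 0%N) + 2.
have B0 : 0 <= B by rewrite addr_ge0 ?hnorm_ge0.
have uB k : hn (u k) <= B.
  have := hnorm_triangle c0 (L2B c0 (Lu k) (Lu 0%N)) (Lu 0%N).
  rewrite subrK => h; apply: (le_trans h); rewrite /B addrC lerD2l.
  apply: (le_trans (cu k 0%N)).
  have := a_le (leq0n k); rewrite {2 4}/a invr1; lra.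
pose D k := u k - reflection (u k).
have Lr k := (L2_reflection (Hu k)).1.
have LD k : L2 c l (D k) by exact: L2B.
have cD j k : hn (D j - D k) <= 2 * (a j + a k).
  have Hjk : Hs (u j - u k) by exact: fockB.
  have Ljk := fock_L2 Hjk; have [Lrjk Nrjk] := L2_reflection Hjk.
  have -> : D j - D k = (u j - u k) + (- 1) *: reflection (u j - u k).
    apply/funext => q; rewrite scaleN1r.
    rewrite -[RHS]/((u j q - u k q) - conjc (u j (- q.1, - q.2) - u k (- q.1, - q.2))).
    rewrite rmorphB -[LHS]/((u j q - conjc (u j (- q.1, - q.2))) - (u k q - conjc (u k (- q.1, - q.2)))).
    by rewrite !opprB addrACA [in LHS]addrC; ring.
  apply: (le_trans (hnorm_triangle c0 Ljk (L2Z c0 _ Lrjk))).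
  have -> : hn (-1 *: reflection (u j - u k)) = hn (u j - u k).
    rewrite hnorm_scale// (_ : normc (-1) = 1); last by rewrite /= oppr0 sqrrN expr1n expr0n addr0 sqrtr1.
    by rewrite mul1r /hnorm -!/(normsq c l _) Nrjk.
  by have := cu j k; rewrite mul1r; lra.
(* Compare [<rho g u, vacuum>] with [<rho g u, u>], for [g] and for its inverse. *)
have pD q : D k q @[k --> \oo] --> (0 : E -> C) q.
  apply/cvgrPdist_le => -[e e']; rewrite ltcE /= => /andP[/eqP -> e0].
  have g0 := eval_factor_gt0 q; have gm0 : 0 < eval_factor q * mass by exact: mulr_gt0.
  pose K := 2 * B / (eval_factor q * mass).
  have /cvgrPdist_le/(_ e e0) := a_cvg K.
  apply: filterS => k; rewrite !sub0r normrN => ak.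
  rewrite normrN normCE lecR; apply: le_trans ak.
  have aB0 : 0 <= 2 * B * a k by rewrite !mulr_ge0// ltW.
  rewrite ger0_norm; last by rewrite /K mulrAC divr_ge0// ltW.
  rewrite /K mulrAC ler_pdivlMr// mulrC.
  pose g := to_origin q; have [_ uk] := uP k.
  have h1 := uk _ (Minv g (Mu k)); have h2 := uk _ (Minv g^-1%g (Mu k)).
  rewrite !hnorm_rho// in h1 h2.
  have Lg x := fock_L2 (fock_rho x (Hu k)).
  rewrite (ipBr c0 L1 (Lu k) (Lg _)) in h1.
  rewrite (ipBr c0 L1 (Lu k) (Lg _)) in h2.
  have E1 : ip (rho g^-1%g (u k)) (u k) = conjc (ip (rho g (u k)) (u k)).
    by rewrite -(ip_conj c0 (Lg g) (Lu k)); exact: ip_rhoV.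
  have E2 : ip (rho g^-1%g (u k)) vacuum = (eval_factor q * mass)%:C * u k (- q.1, - q.2).
    by rewrite to_origin_inv ip_rho_vacuum// eval_factorN.
  rewrite E1 E2 in h2; rewrite ip_rho_vacuum// in h1.
  rewrite -[X in X * normc _]ger0_norm ?(ltW gm0)// -normc_real -Normc.normcM.
  set X := ip _ (u k) in h1 h2.
  have -> : (eval_factor q * mass)%:C * D k q = ((eval_factor q * mass)%:C * u k q - X) -
      conjc ((eval_factor q * mass)%:C * u k (- q.1, - q.2) - conjc X).
    exact: conj_balance.
  apply: (le_trans (normcB_le _ _)); rewrite normc_conj.
  have := uB k; have := a_gt0 k; nra.
have L00 : L2 c l (0 : E -> C) by have := L2B c0 (Lu 0%N) (Lu 0%N); rewrite subrr.
have ND := cauchy_limit (ler0n _ 2) LD L00 cD pD.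
have near_cst k : hn (u k - u k 0 *: vacuum) <= 3 * a k.
  have := normsq_sub_value c0 l0 (Hu k).
  have -> : (fun=> u k 0) = u k 0 *: vacuum.
    by apply/funext => q; rewrite -[RHS]/(u k 0 * 1) mulr1.
  rewrite -!hsq -/(D k); have := ND k; rewrite subr0.
  have := hnorm_ge0 c l (D k); have := hnorm_ge0 c l (u k - u k 0 *: vacuum).
  have := a_gt0 k; set z := a k; set x := hn (D k); set y := hn _.
  move=> z0 y0 x0 xz yx; rewrite -(@ler_pXn2r _ 2) ?nnegrE ?mulr_ge0 ?(ltW z0)//.
  have xz2 : x ^+ 2 <= (2 * (2 * z)) ^+ 2.
    by rewrite lerXn2r ?nnegrE ?mulr_ge0 ?(ltW z0).
  rewrite exprMn; rewrite !exprMn in xz2; have := sqr_ge0 z; lra.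
have Lv := fock_L2 (MH Mv).
have LuZ k : L2 c l (u k 0 *: vacuum) by exact: L2Z.
pose K := 4 * hn v / (normc (v 0) * mass).
have nv0 : 0 < normc (v 0).
  by rewrite lt_neqAle normc_ge0 andbT eq_sym; apply/eqP => /Normc.eq0_normc.
have vm0 : 0 < normc (v 0) * mass by exact: mulr_gt0.
(* [vacuum - u k] is nearly orthogonal to [v], and [u k - u k 0] is small. *)
have s1 k : normc (1 - u k 0) <= K * a k.
  rewrite /K mulrAC ler_pdivlMr//.
  have [_ /(_ v Mv) h1] := uP k.
  have h2 := hnorm_cauchy_schwarz c0 Lv (L2B c0 (Lu k) (LuZ k)).
  have E1 : conjc (1 - u k 0) * (v 0 * mass%:C) =
      ip v (vacuum - u k) + ip v (u k - u k 0 *: vacuum).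
    rewrite (ipBr c0 L1 (Lu k) Lv) (ipBr c0 (Lu k) (LuZ k) Lv) (ipZr c0 _ L1 Lv).
    by rewrite (ip_vacuum c0 l0 (MH Mv)) rmorphB rmorph1; ring.
  rewrite -[X in normc X]conjcK normc_conj -(ger0_norm (ltW m0)) -normc_real.
  rewrite -!Normc.normcM E1.
  apply: (le_trans (le_normcD _ _)).
  have := near_cst k; have := hnorm_ge0 c l v; nra.
apply: (@closed_limit u vacuum (3 + K * hn vacuum)) => //.
- exact: fock_vacuum.
- rewrite addr_ge0// mulr_ge0 ?hnorm_ge0// divr_ge0 ?(ltW vm0)// mulr_ge0//.
  exact: hnorm_ge0.
move=> k.
have -> : u k - vacuum = (u k - u k 0 *: vacuum) + (u k 0 - 1) *: vacuum.
  by rewrite scalerBl scale1r addrA subrK.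
apply: (le_trans (hnorm_triangle c0 (L2B c0 (Lu k) (LuZ k)) (L2Z c0 _ L1))).
rewrite hnorm_scale// mulrDl lerD// normcB mulrAC ler_wpM2r ?hnorm_ge0//.
Qed.

Lemma invariant_trivial : M = [set 0] \/ M = Hs.
Proof.
have [[v Mv v0]|nv] := pselect (exists2 v, M v & v <> 0); last first.
  left; apply/seteqP; split=> [v Mv|_ ->]; last by have [] := Msub.
  by apply: contrapT => v0; apply: nv; exists v.
right; apply: vacuum_generates.
have [q vq] : exists q, v q <> 0.
  by apply: contrapT => nq; apply: v0; apply/funext => q; apply: contrapT => vq; apply: nq; exists q.
apply: (@vacuum_mem (rho (to_origin q) v)); first exact: Minv.
rewrite rhoE cexp_to_origin /= !sub0r !opprK.
rewrite (_ : (q.1, q.2) = q); last by case: q {vq}.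
move=> /eqP; rewrite mulf_eq0 => /orP[|/eqP//].
by rewrite eq_complex /= gt_eqF ?eval_factor_gt0.
Qed.

End irreducible.

Lemma rho_irreducible : Defs.irreducible Hs ip (fun g : heis n l => rho g).
Proof.
split; last by move=> M MH Msub Mcl Minv; exact: invariant_trivial.
exists vacuum; first exact: fock_vacuum.
by move=> /(congr1 (fun f : E -> C => f 0)) /eqP; rewrite oner_eq0.
Qed.

End invariant_subspace.

(** * The restriction to the real subgroup *)

Section real_restriction.
Context {R : realType} (n : nat).
Local Notation C := R[i].
Local Notation mR := (measurableTypeR R).
Local Notation Rn := (n.-tuple mR).
Local Notation T4 := ((Rn * Rn) * (Rn * Rn))%type.
Local Notation E := ('rV[C]_n * 'rV[C]_n)%type.
Variables (c l : R).
Hypotheses (n0 : (0 < n)%N) (c0 : 0 < c) (l0 : l != 0).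
Local Notation Hs := (fock_space n c l).
Local Notation ip := (fock_ip n c l).
Local Notation mass := (weight_integral c l (fun _ : E => 1)).
Local Notation hn := (hnorm ip).

Let j0 : 'I_n := Ordinal n0.
Let s : R := Num.sg l.
Let s2 : s * s = 1. Proof. by rewrite -expr2 sqr_sg l0. Qed.
Let sl : s * l = `|l|. Proof. by rewrite normrEsg. Qed.

(* The value forced by [covariant_real]: the translations in [dir] change the
   exponent of [rho g], for real [g], by [2 * al * t] times [lin] of [g]. *)
Let al : R := l * (coth l - s) / 4.

Let al_gt0 : 0 < al.
Proof.
by rewrite divr_gt0// mulrBr (mulrC l s) sl subr_gt0 normr_lt_mulr_coth.
Qed.

Let dir (t : C) (q : E) : E :=
  (q.1 + t *: delta_mx 0 j0, q.2 - ((s%:C * 'i) * t) *: delta_mx 0 j0).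

Let lin (q : E) : C := q.1 0 j0 - s%:C * 'i * q.2 0 j0.

(** The common fixed vectors of the operators
[F |-> (q |-> cexp (- (2 * al)%:C * t * lin q) * F (dir t q))] for complex [t],
which commute with [rho g] for real [g]. *)
Definition covariant : set (E -> C) := [set F | Hs F /\
  forall q t, F (dir t q) = cexp ((2 * al)%:C * t * lin q) * F q].

Lemma fock_lin k F G : Hs F -> Hs G -> Hs (k *: F + G).
Proof.
move=> HF HG; split.
  apply: entireD HG.1; apply: (@entireM _ _ (fun=> k)) HF.1; exact: entire_cst.
by have [] := L2D c0 (L2Z c0 k (fock_L2 HF)) (fock_L2 HG).
Qed.

Lemma covariant_subspace : Defs.subspace covariant.
Proof.
split.
  split; last by move=> q t; rewrite mulr0.
  rewrite -[0 : E -> C](subrr (@vacuum R n)); apply: fockB => //; exact: fock_vacuum.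
move=> k F G [HF cF] [HG cG]; split; first exact: fock_lin.
move=> q t; rewrite -[LHS]/(k * F (dir t q) + G (dir t q)) cF cG.
by rewrite mulrCA -mulrDr.
Qed.

(** Point evaluations are continuous, and covariance is a relation between the values
at two points. *)
Lemma covariant_closed : closed_in Hs ip covariant.
Proof.
move=> F HF hF; split=> // q t.
set k := cexp _; set p := dir t q.
have m0 := mass_gt0 n c0 l0.
have gp := mulr_gt0 (eval_factor_gt0 l p) m0; have gq := mulr_gt0 (eval_factor_gt0 l q) m0.
pose Kp := hn (@vacuum R n) / (eval_factor l p * mass).
pose Kq := hn (@vacuum R n) / (eval_factor l q * mass).
have Kp0 : 0 <= Kp by rewrite divr_ge0 ?hnorm_ge0 ?ltW.
have Kq0 : 0 <= Kq by rewrite divr_ge0 ?hnorm_ge0 ?ltW.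
apply/eqP; rewrite -subr_eq0; apply/eqP/Normc.eq0_normc/eqP.
rewrite eq_le normc_ge0 andbT; apply/ler_addgt0Pr => e e0; rewrite add0r.
pose B := Kp + normc k * Kq + 1.
have B0 : 0 < B by rewrite ltr_pwDr// addr_ge0// mulr_ge0// normc_ge0.
have [u [Hu cu] ue] := hF (e / B) (divr_gt0 e0 B0).
have HFu : Hs (F - u) by exact: fockB.
have ev r : normc (F r - u r) <= hn (F - u) * (hn (@vacuum R n) / (eval_factor l r * mass)).
  have gr := mulr_gt0 (eval_factor_gt0 l r) m0.
  have := point_evaluation c0 l0 r HFu; rewrite mulrA ler_pdivlMr// mulrC.
  by apply: le_trans.
have -> : F p - k * F q = (F p - u p) - k * (F q - u q).
  by rewrite (cu q t : u p = k * u q); ring.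
apply: (le_trans (normcB_le _ _)); rewrite Normc.normcM.
have h1 := ev p; have h2 := ev q; rewrite -/Kp in h1; rewrite -/Kq in h2.
have k0 := normc_ge0 k; have hh := hnorm_ge0 c l (F - u).
have h3 : normc k * normc (F q - u q) <= normc k * (hn (F - u) * Kq) by exact: ler_wpM2l.
move: ue; rewrite ltr_pdivlMr// /B => ue.
nra.
Qed.

Lemma dotc_delta (a : 'rV[C]_n) (t : C) : dotc (t *: delta_mx 0 j0) a = t * a 0 j0.
Proof.
rewrite /dotc (bigD1 j0)//= big1 ?addr0; first by rewrite !mxE !eqxx mulr1.
by move=> j jj; rewrite !mxE eqxx (negbTE jj) mulr0 mul0r.
Qed.

(** Both sides have the same argument of [F] since [dir] is a translation.  It remains to
compare exponents: those terms that do not cancel carry the factor [1 - s ^+ 2]. *)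
Lemma covariant_real (g : heis n l) F :
  g \in @real_heis R n l -> covariant F -> covariant (rho g F).
Proof.
move=> greal [HF cF]; split; first exact: fock_rho.
move=> q t; rewrite !rhoE.
have [ga gb] : Im (g.1.1 0 j0) = 0 /\ Im (g.1.2 0 j0) = 0.
  by move/forallP : greal => /(_ j0) /andP[/eqP ? /eqP ?].
have -> : ((dir t q).1 - g.1.1, (dir t q).2 - g.1.2) =
    dir t (q.1 - g.1.1, q.2 - g.1.2).
  by rewrite /dir /=; congr pair; rewrite addrAC.
rewrite cF [LHS]mulrA [RHS]mulrA; congr (_ * _); rewrite -2!cexpD; congr cexp.
rewrite /phase /dir /lin /= !dotcDl !dotcNl !dotc_delta !mxE.
move: ga gb; case: (g.1.1 0 j0) (g.1.2 0 j0) => a1 a2 [b1 b2] /= -> ->.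
move: (dotc q.1 _) (dotc q.2 _) (dotc q.1 _) (dotc q.2 _) => [x1 x2] [y1 y2] [z1 z2] [w1 w2].
move: (q.1 0 j0) (q.2 0 j0) => [p1 p2] [r1 r2].
have s2' : s ^+ 2 = 1 by rewrite expr2.
move: (sqnormv _) (sqnormv _) (Im _) g.2 => X1 X2 X3 X4.
rewrite /al; move: s2'; move: (coth l) => K; move: (s) => S S2; case: t => t1 t2.
have S0 : 1 - S ^+ 2 = 0 by rewrite S2 subrr.
apply/eqP; rewrite eq_complex /=; apply/andP; split; rewrite -subr_eq0; apply/eqP.
  transitivity (- (l / 2) * t2 * b1 * (1 - S ^+ 2)); last by rewrite S0 mulr0.
  by field.
transitivity ((l / 2) * t1 * b1 * (1 - S ^+ 2)); last by rewrite S0 mulr0.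
by field.
Qed.

Definition gaussian_state (q : E) : C :=
  cexp (al%:C * (q.1 0 j0 * q.1 0 j0 + q.2 0 j0 * q.2 0 j0)).

Lemma entire_gaussian_state : entire gaussian_state.
Proof.
apply: entire_cexp; apply: entireM; first exact: entire_cst.
by apply: entireD; apply: entireM; (exact: entire_coord1 || exact: entire_coord2).
Qed.

Let decay : R := `|l| * (l * coth l - `|l|) / (2 * (l * coth l)).

(** In the coordinates other than [j0] the decay of the weight is more than enough.  In
the pair [j0], with [K = l * coth l] and [L = |l|], the Gaussian changes the
coefficients of the weight from [K / 2] to [L / 2] for the squared real parts and
to [K - L / 2] for the squared imaginary parts, and the cross term couples the
real part of each variable to the imaginary part of the other.  The two binary
quadratic forms so obtained are positive definite because [L / 2 * (K - L / 2)]
exceeds [L ^+ 2 / 4], and they remain nonnegative when [decay] times the sum of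
squares is subtracted. *)
Lemma gaussian_state_le (p : T4) :
  normc (gaussian_state (pointC p)) ^+ 2 * fock_weight c l (pointC p) <=
  c * expR (- (decay * sumsq4 p)).
Proof.
rewrite normc_cexp -expRM_natl fock_weightE.
rewrite [X in X <= _]mulrC -[X in X <= _]mulrA -expRD -[X in X <= _]mulrA -expRD.
rewrite ler_pM2l// ler_expR.
pose q j : R := ((tnth p.1.1 j : R) ^+ 2 + (tnth p.1.2 j : R) ^+ 2) +
                ((tnth p.2.1 j : R) ^+ 2 + (tnth p.2.2 j : R) ^+ 2).
pose X j : R := tnth p.1.2 j * tnth p.2.1 j - tnth p.1.1 j * tnth p.2.2 j : R.
have qE : sumsq4 p = \sum_(j < n) q j by rewrite /sumsq4 /sumsq -!big_split.
rewrite qE -[X in l * X]/(\sum_(j < n) X j).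
have L0 : 0 < `|l| by rewrite normr_gt0.
have LK := normr_lt_mulr_coth l0.
have lL : l ^+ 2 = `|l| ^+ 2 by rewrite real_normK ?num_real.
have hl := ler_norm l; have hnl : - l <= `|l| by rewrite -normrN ler_norm.
have -> : 1 / 2 * l * coth l = (l * coth l) / 2 by rewrite mul1r -mulrA mulrC.
rewrite /pointC /vecC /= !mxE /= /al /decay (mulrBr l) (mulrC l s) sl.
move: LK L0 lL hl hnl; move: (l * coth l) `|l| => K L LK L0 lL hl hnl.
have K0 : 0 < K by exact: lt_trans LK.
pose e := L * (K - L) / (2 * K); rewrite -/e.
have eK : e * K = L * (K - L) / 2 by rewrite /e; field; rewrite gt_eqF.
have e0 : 0 < e.
  by rewrite /e; apply: divr_gt0; apply: mulr_gt0 => //; rewrite subr_gt0.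
have eL : e < L / 2.
  have : e * K < L / 2 * K by rewrite eK; nra.
  by rewrite ltr_pM2r.
have eKL : e <= (K - L) / 2.
  have : e * K <= (K - L) / 2 * K by rewrite eK; nra.
  by rewrite ler_pM2r.
rewrite (bigD1 j0)//= [X in K / 2 * X](bigD1 j0)//= [X in e * X](bigD1 j0)//=.
set SX := \sum_(i < n | _) X i; set Sq := \sum_(i < n | _) q i.
have rest : l * SX - K / 2 * Sq <= - (e * Sq).
  rewrite -subr_ge0 /SX /Sq !mulr_sumr -!sumrN -!big_split /=.
  rewrite -sumrN -big_split /=; apply: sumr_ge0 => j _; rewrite /X /q.
  set x : R := tnth p.1.1 j; set y : R := tnth p.1.2 j.
  set u : R := tnth p.2.1 j; set v : R := tnth p.2.2 j.
  have A1 : 0 <= (L + l) * ((y - u) ^+ 2 + (x + v) ^+ 2).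
    by apply: mulr_ge0; [lra|rewrite addr_ge0 ?sqr_ge0].
  have A2 : 0 <= (L - l) * ((y + u) ^+ 2 + (x - v) ^+ 2).
    by apply: mulr_ge0; [lra|rewrite addr_ge0 ?sqr_ge0].
  have A3 : 0 <= ((K - L) / 2 - e) * (x ^+ 2 + y ^+ 2 + (u ^+ 2 + v ^+ 2)).
    by apply: mulr_ge0; [lra|rewrite !addr_ge0 ?sqr_ge0].
  lra.
rewrite /X /q.
set x : R := tnth p.1.1 j0; set y : R := tnth p.1.2 j0.
set u : R := tnth p.2.1 j0; set v : R := tnth p.2.2 j0.
pose A := L / 2 - e; pose B := K - L / 2 - e.
have A0 : 0 < A by rewrite /A subr_gt0.
have AB : A * B = L ^+ 2 / 4 + e ^+ 2.
  rewrite (_ : A * B = L / 2 * K - L ^+ 2 / 4 + e ^+ 2 - e * K); last first.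
    by rewrite /A /B; field.
  by rewrite eK; field.
(* completing the square, the discriminant being [- 4 * e ^+ 2] *)
have Q (r t m : R) : m ^+ 2 = L ^+ 2 -> 0 <= A * r ^+ 2 + B * t ^+ 2 - m * (t * r).
  move=> mL; rewrite -(@pmulr_rge0 _ (4 * A)) ?mulr_gt0//.
  have -> : 4 * A * (A * r ^+ 2 + B * t ^+ 2 - m * (t * r)) =
      (2 * A * r - m * t) ^+ 2 + (4 * (A * B) - m ^+ 2) * t ^+ 2 by ring.
  rewrite AB mL addr_ge0 ?sqr_ge0// mulr_ge0 ?sqr_ge0//.
  by have := sqr_ge0 e; lra.
have Q1 := Q u y l lL; have := Q x v (- l); rewrite sqrrN => /(_ lL) Q2.
rewrite /A /B in Q1 Q2; lra.
Qed.

Lemma fock_gaussian_state : Hs gaussian_state.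
Proof.
split; first exact: entire_gaussian_state.
have L0 : 0 < `|l| by rewrite normr_gt0.
have LK := normr_lt_mulr_coth l0.
have e0 : 0 < decay.
  rewrite /decay; apply: divr_gt0; apply: mulr_gt0 => //; first by rewrite subr_gt0.
  exact: lt_trans LK.
apply: (@le_lt_trans _ _
    (\int[@lebesgue_C2n R n]_p (c%:E * (expR (- (decay * sumsq4 p)))%:E))%E).
  apply: ge0_le_integral => //.
  - by move=> p _; rewrite lee_fin mulr_ge0 ?sqr_ge0// ltW// fock_weight_gt0.
  - apply/measurable_EFinP; apply: measurable_funM; last exact: measurable_weight.
    by apply: measurable_normc_sqr; apply: entire_cont; exact: entire_gaussian_state.
  - apply: emeasurable_funM => //.
    by apply/measurable_EFinP; exact: measurable_gauss4.
  - by move=> p _; rewrite -EFinM lee_fin gaussian_state_le.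
rewrite ge0_integralZl//.
- by rewrite lte_mul_pinfty ?lee_fin ?ltW// gauss4_lty.
- by apply/measurable_EFinP; exact: measurable_gauss4.
- by rewrite lee_fin ltW.
Qed.

Lemma covariant_gaussian_state : covariant gaussian_state.
Proof.
split=> [|q t]; first exact: fock_gaussian_state.
rewrite /gaussian_state /dir /lin /= -cexpD; congr cexp; rewrite !mxE !eqxx !mulr1.
have S0 : 1 - s ^+ 2 = 0 by rewrite expr2 s2 subrr.
move: S0; move: (al) (s) (q.1 0 j0) (q.2 0 j0) => A S [z1 z2] [w1 w2] S0.
case: t => t1 t2.
apply/eqP; rewrite eq_complex /=; apply/andP; split; rewrite -subr_eq0; apply/eqP.
  transitivity (A * (t1 ^+ 2 - t2 ^+ 2) * (1 - S ^+ 2)); last by rewrite S0 mulr0.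
  by ring.
transitivity (2 * A * (t1 * t2) * (1 - S ^+ 2)); last by rewrite S0 mulr0.
by ring.
Qed.

(** At the unit vector of coordinate [j0] and [t = 1] covariance would give
[expR (2 * al) = 1]. *)
Lemma vacuum_not_covariant : ~ covariant (@vacuum R n).
Proof.
move=> [_ /(_ (delta_mx 0 j0, 0) 1)].
rewrite /vacuum /lin /= !mxE !eqxx mulr0 subr0 !mulr1.
move=> /(congr1 (fun z => normc z)); rewrite normc_cexp Normc.normc1 /=.
apply/eqP; rewrite lt_eqF// -[X in X < _]expR0 ltr_expR mulr_gt0//.
Qed.

Theorem rho_real_reducible : ~ Defs.irreducible Hs ip
  (fun g : real_subgroup n l => rho (val g)).
Proof.
move=> [_ irr].
have [] := irr covariant (fun F cF => cF.1) covariant_subspace covariant_closed.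
- by move=> g F; apply: covariant_real; exact: valP.
- move=> E0; have := covariant_gaussian_state; rewrite E0 => /(congr1 (fun F => F 0)).
  move=> /(congr1 (fun z => normc z)) /eqP; rewrite normc_cexp Normc.normc0.
  by rewrite gt_eqF// expR_gt0.
- move=> EH; apply: vacuum_not_covariant; rewrite EH; exact: fock_vacuum.
Qed.

End real_restriction.

Theorem theorem1p3 (R : realType) (n : nat) (c l : R)
    (n_gt0 : (0 < n)%N) (c_gt0 : 0 < c) (l_neq0 : l != 0) :
  [/\ unitary_representation (fock_space n c l) (fock_ip n c l)
        (fun g : heis n l => rho g),
      strongly_continuous (fock_space n c l) (fock_ip n c l)
        (fun g : heis n l => rho g),
      irreducible (fock_space n c l) (fock_ip n c l)
        (fun g : heis n l => rho g)
    & ~ irreducible (fock_space n c l) (fock_ip n c l)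
        (fun g : real_subgroup n l => rho (val g))].
Proof.
split.
- exact: rho_unitary.
- exact: rho_strongly_continuous.
- exact: rho_irreducible.
- exact: rho_real_reducible.
Qed.
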